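(* For every sequence $(\varepsilon_n)_{n\ge1}$ of positive numbers with $\lim_n\varepsilon_n=0$, there exists a surjective and four-valent analytic map $\varphi\colon\mathbb{D}\to\mathbb{D}$ such that, for some constant $K>0$, $a_n(C_\varphi)\le Ke^{-n\varepsilon_n}$ for all $n\ge1$, where $C_\varphi\colon H^2\to H^2$. Consequently, there exists a surjective and four-valent analytic map $\varphi\colon\mathbb{D}\to\mathbb{D}$ such that $C_\varphi\colon H^2\to H^2$ belongs to every Schatten class $S_p(H^2)$, $p>0$.
   Context: $H^2$ is the Hardy space of the unit disk $\mathbb{D}$, $C_\varphi f=f\circ\varphi$. The approximation numbers are $a_n(T)=\inf\{\|T-R\|:\operatorname{rank}R<n\}$, and $T\in S_p$ means $(a_n(T))_n\in\ell^p$. Four-valent means every point has at most four preimages. *)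

(* Defs.v *)
From Stdlib Require Import Reals Lra List ClassicalEpsilon.
Open Scope R_scope.

Record Cplx : Type := mkC { Re : R; Im : R }.
Definition C0 : Cplx := mkC 0 0.
Definition C1 : Cplx := mkC 1 0.
Definition Cadd (z w : Cplx) : Cplx := mkC (Re z + Re w) (Im z + Im w).
Definition Copp (z : Cplx) : Cplx := mkC (- Re z) (- Im z).
Definition Csub (z w : Cplx) : Cplx := Cadd z (Copp w).
Definition Cmul (z w : Cplx) : Cplx :=
  mkC (Re z * Re w - Im z * Im w) (Re z * Im w + Im z * Re w).
Fixpoint Cpow (z : Cplx) (n : nat) : Cplx :=
  match n with O => C1 | S m => Cmul z (Cpow z m) end.
Definition Cmod (z : Cplx) : R := sqrt (Re z ^ 2 + Im z ^ 2).

Definition in_disc (z : Cplx) : Prop := Cmod z < 1.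

Fixpoint Csum (a : nat -> Cplx) (n : nat) : Cplx :=
  match n with O => a O | S m => Cadd (Csum a m) (a (S m)) end.
Definition Cseries_cv (a : nat -> Cplx) (l : Cplx) : Prop :=
  forall eps, eps > 0 -> exists N, forall n, (n >= N)%nat -> Cmod (Csub (Csum a n) l) < eps.

Definition analytic_on_disc (phi : Cplx -> Cplx) : Prop :=
  exists a : nat -> Cplx, forall z, in_disc z ->
    Cseries_cv (fun k => Cmul (a k) (Cpow z k)) (phi z).
Definition maps_disc_to_disc (phi : Cplx -> Cplx) : Prop :=
  forall z, in_disc z -> in_disc (phi z).
Definition surjective_on_disc (phi : Cplx -> Cplx) : Prop :=
  forall w, in_disc w -> exists z, in_disc z /\ phi z = w.
Definition four_valent (phi : Cplx -> Cplx) : Prop :=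
  forall (w : Cplx) (l : list Cplx), NoDup l ->
    (forall z, In z l -> in_disc z /\ phi z = w) -> (length l <= 4)%nat.

(** An element f of H^2 is represented by its Taylor coefficient sequence
    (f(z) = sum_k f_k z^k on D), and ||f||^2 = sum_k |f_k|^2. *)
Definition cseq := nat -> Cplx.
Definition H2_norm2_is (f : cseq) (s : R) : Prop :=
  infinite_sum (fun k => (Cmod (f k)) ^ 2) s.
Definition in_H2 (f : cseq) : Prop := exists s, H2_norm2_is f s.
Definition H2_norm (f : cseq) : R :=
  sqrt (epsilon (inhabits 0) (fun s => H2_norm2_is f s)).

Definition composes (phi : Cplx -> Cplx) (f g : cseq) : Prop :=
  forall z, in_disc z -> exists w,
    Cseries_cv (fun k => Cmul (f k) (Cpow (phi z) k)) w /\
    Cseries_cv (fun k => Cmul (g k) (Cpow z k)) w.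

Definition Cphi (phi : Cplx -> Cplx) (f : cseq) : cseq :=
  epsilon (inhabits (fun _ => C0)) (fun g => in_H2 g /\ composes phi f g).

Definition op := cseq -> cseq.

Definition op_bound (T : op) (c : R) : Prop :=
  forall f, in_H2 f -> in_H2 (T f) /\ H2_norm (T f) <= c * H2_norm f.

Definition bounded_op (T : op) : Prop := exists c, op_bound T c.

Definition op_linear (T : op) : Prop :=
  forall (f g : cseq) (a b : Cplx), in_H2 f -> in_H2 g ->
    forall k, T (fun j => Cadd (Cmul a (f j)) (Cmul b (g j))) k
              = Cadd (Cmul a (T f k)) (Cmul b (T g k)).

Fixpoint lincomb (cs : list Cplx) (vs : list cseq) : cseq :=
  match cs, vs with
  | c :: cs', v :: vs' => fun k => Cadd (Cmul c (v k)) (lincomb cs' vs' k)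
  | _, _ => fun _ => C0
  end.

Definition rank_lt (Rop : op) (n : nat) : Prop :=
  exists vs : list cseq, (length vs < n)%nat /\ (forall v, In v vs -> in_H2 v) /\
    forall f, in_H2 f -> exists cs : list Cplx, length cs = length vs /\
      forall k, Rop f k = lincomb cs vs k.

Definition approx_bounds (T : op) (n : nat) (c : R) : Prop :=
  exists Rop : op, op_linear Rop /\ rank_lt Rop n /\
    op_bound (fun f k => Csub (T f k) (Rop f k)) c.

Definition is_lower_bound (E : R -> Prop) (m : R) : Prop := forall x, E x -> m <= x.
Definition is_glb (E : R -> Prop) (m : R) : Prop :=
  is_lower_bound E m /\ (forall b, is_lower_bound E b -> b <= m).
Definition Rinf (E : R -> Prop) : R := epsilon (inhabits 0) (fun m => is_glb E m).

Definition approx_number (T : op) (n : nat) : R := Rinf (approx_bounds T n).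

(** x^p for x >= 0, p > 0 (with 0^p = 0) *)
Definition Rpow_nn (x p : R) : R := if Rle_dec x 0 then 0 else Rpower x p.

Definition in_Schatten (T : op) (p : R) : Prop :=
  bounded_op T /\
  exists l, infinite_sum (fun n => Rpow_nn (approx_number T (S n)) p) l.

(* Main.v *)
(** For [R_n f = sum_(k<n) f_k phi^k] one has [||C_phi f - R_n f||^2 <= ||f||^2 sum_(k>=n) ||phi^k||^2], so it is
    enough to make [||phi^k||] decay at a prescribed rate [exp(-k eta_k)] with [eta_k -> 0].  This holds as soon as
    [|phi| <= exp(-eta_k)] off the disc [|1 - z| < exp(-4k)], because [|phi^k|^2] then has a harmonic majorant built
    from [(1 - z)^(-1/2)] whose value at 0 bounds [||phi^k||^2].

    The function [zeta = 1 - log(1 - z)] maps the disc into the half strip [Re > 0, |Im| < pi/2].  Put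
    [q = sum c_m exp(-lam_m zeta)] and [F = P + i H] with [H' = q] and [P' = - q^2 / 3].  Since [q] varies slowly,
    [F (t + i s)] is close to [P t - q t * s + i H t]: the image of [F] is a channel in the right half plane which
    climbs to infinity while approaching the imaginary axis.  Its width is about [pi q]; an increment [2 pi] of the
    height costs [2 pi q / 3 < pi q] and an increment [4 pi] costs [4 pi q / 3 > pi q].  Hence [exp(-F)] covers an
    annulus [a <= |w| < 1], and takes no value more than twice.  Composing with the square of the Moebius map
    [(w - a) / (1 - a w)] gives a surjective four-valent map of the disc, and the [c_m] can be chosen so that [P]
    tends to 0 as slowly as desired. *)

Require Import Defs.
From Stdlib Require Import Reals ZArith Ranalysis5 Lra Lia List ClassicalEpsilon.
From Coquelicot Require Import Coquelicot.
Open Scope R_scope.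

(** Since [dP = - (q / 3) dH], the factor 1/3 could be any constant strictly between 1/4 and 1/2:
    one turn must cost less, and two turns more, than the width [pi q]. The obstacle is that all
    errors have to be small relative to [q], which itself tends to 0. So [q] must lose little over a
    turn, in the form [- q' <= 16 s0 q ^ 2], although the [c_m] obey an arbitrary prescribed rate.
    The geometric frequencies [lam m = s0 ^ 2 * 4 ^ (- m)] reconcile the two: the normalised
    coefficients [d m] need only never fall by more than a factor 2 per step, and term [m] of [- q']
    is then controlled by the square of term [m + 1] of [q]. The same comparison gives [P >= 200 q],
    so the channel keeps off the imaginary axis. Conversely, a value [d m >= 2 ^ (- i)] holds [P]
    above a multiple of [4 ^ (- i)] until time [1 / lam m], and such bumps may be placed as late as
    desired; this makes the decay of [P] arbitrarily slow. Squaring after the Moebius map fills the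
    hole of the annulus: of two opposite square roots, at least one comes from the annulus. The
    price is a factor 2 in valence. *)

Fixpoint rsum (a : nat -> R) (n : nat) : R :=
  match n with O => 0 | S m => rsum a m + a m end.

Lemma rsum_sum_n a n : sum_n a n = rsum a (S n).
Proof.
  induction n as [|n IH].
  - rewrite sum_O. simpl. lra.
  - rewrite sum_Sn, IH. reflexivity.
Qed.

Lemma rsum_le a b n : (forall k, (k < n)%nat -> a k <= b k) -> rsum a n <= rsum b n.
Proof.
  induction n; intros H; simpl; [lra|].
  apply Rplus_le_compat; auto.
Qed.

Lemma rsum_ge0 a n : (forall k, (k < n)%nat -> 0 <= a k) -> 0 <= rsum a n.
Proof.
  induction n; intros H; simpl; [lra|].
  assert (0 <= rsum a n) by auto. assert (0 <= a n) by auto. lra.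
Qed.

Lemma rsum_mono a n m : (forall k, 0 <= a k) -> (n <= m)%nat -> rsum a n <= rsum a m.
Proof. intros H; induction 1; simpl; [lra|]. specialize (H m). lra. Qed.

Lemma rsum_plus a b n : rsum (fun k => a k + b k) n = rsum a n + rsum b n.
Proof. induction n; simpl; [lra|]. rewrite IHn; lra. Qed.

Lemma rsum_scal c a n : rsum (fun k => c * a k) n = c * rsum a n.
Proof. induction n; simpl; [lra|]. rewrite IHn; lra. Qed.

Lemma rsum_term_le a n k : (forall k, 0 <= a k) -> (k < n)%nat -> a k <= rsum a n.
Proof.
  intros H Hk. apply Rle_trans with (rsum a (S k)).
  - simpl. assert (0 <= rsum a k) by (apply rsum_ge0; auto). lra.
  - apply rsum_mono; auto.
Qed.

Lemma rsum_Series_lim a : ex_series a ->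
  forall eps, 0 < eps -> exists N, forall n, (n >= N)%nat -> Rabs (rsum a n - Series a) < eps.
Proof.
  intros H eps He.
  apply Series_correct in H.
  destruct (proj1 (filterlim_locally _ _) H (mkposreal eps He)) as [N HN].
  exists (S N). intros [|n] Hn; [lia|].
  assert (h : (N <= n)%nat) by lia.
  specialize (HN n h). rewrite rsum_sum_n in HN. exact HN.
Qed.

Lemma rsum_le_Series a n : (forall k, 0 <= a k) -> ex_series a -> rsum a n <= Series a.
Proof.
  intros H0 H. apply Rnot_lt_le. intros Hlt.
  destruct (rsum_Series_lim a H (rsum a n - Series a)) as [N HN]; [lra|].
  specialize (HN (max N n) ltac:(lia)).
  assert (rsum a n <= rsum a (max N n)) by (apply rsum_mono; auto; lia).
  apply Rabs_def2 in HN. lra.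
Qed.

Lemma term_le_Series a k : (forall k, 0 <= a k) -> ex_series a -> a k <= Series a.
Proof.
  intros H0 H. eapply Rle_trans; [|apply (rsum_le_Series a (S k)); auto].
  apply rsum_term_le; auto.
Qed.

Lemma Series_le_bound a M : ex_series a -> (forall n, rsum a n <= M) -> Series a <= M.
Proof.
  intros H HM. apply Rnot_lt_le. intros Hlt.
  destruct (rsum_Series_lim a H (Series a - M)) as [N HN]; [lra|].
  specialize (HN N ltac:(lia)). specialize (HM N). apply Rabs_def2 in HN. lra.
Qed.

Lemma ex_series_bounded a M :
  (forall k, 0 <= a k) -> (forall n, rsum a n <= M) -> ex_series a.
Proof.
  intros H0 HM.
  assert (Hf : ex_finite_lim_seq (sum_n a)).
  { apply ex_finite_lim_seq_incr with M.
    - intros n. rewrite !rsum_sum_n. apply rsum_mono; auto.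
    - intros n. rewrite rsum_sum_n. auto. }
  destruct Hf as [l Hl]. exists l. exact Hl.
Qed.

Lemma Series_nonneg a : (forall k, 0 <= a k) -> ex_series a -> 0 <= Series a.
Proof. intros H0 H. apply (rsum_le_Series a 0 H0 H). Qed.

Lemma ex_series_dom a b : (forall k, Rabs (a k) <= b k) -> ex_series b -> ex_series a.
Proof. intros H Hb. apply (ex_series_le (K:=R_AbsRing) (V:=R_CompleteNormedModule) a b); auto. Qed.

Lemma Series_le' a b : (forall k, a k <= b k) -> ex_series a -> ex_series b -> Series a <= Series b.
Proof.
  intros H Ha Hb.
  assert (0 <= Series (fun k => b k - a k)).
  { apply Series_nonneg; [intros k; specialize (H k); lra|]. apply (ex_series_minus b a); auto. }
  rewrite Series_minus in H0; auto. lra.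
Qed.

Lemma ex_series_rplus a b : ex_series a -> ex_series b -> ex_series (fun k => a k + b k).
Proof. apply (ex_series_plus (V:=R_NormedModule)). Qed.

Lemma ex_series_rscal c a : ex_series a -> ex_series (fun k => c * a k).
Proof. apply (ex_series_scal_l (V:=R_NormedModule)). Qed.

Lemma ex_series_rext (a b : nat -> R) : (forall n, a n = b n) -> ex_series a -> ex_series b.
Proof. intros H. apply (ex_series_ext a b H). Qed.

Lemma ex_series_rsum (a : nat -> nat -> R) N : (forall n, ex_series (fun k => a k n)) ->
  ex_series (fun k => rsum (a k) N).
Proof.
  intros H. induction N; simpl.
  - apply (ex_series_rext (fun k => 0 * a k 0%nat)); [intros; ring|]. apply ex_series_rscal; auto.
  - apply ex_series_rplus; auto.
Qed.

Lemma Series_rsum (a : nat -> nat -> R) N : (forall n, ex_series (fun k => a k n)) ->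
  Series (fun k => rsum (a k) N) = rsum (fun n => Series (fun k => a k n)) N.
Proof.
  intros H. induction N; simpl.
  - rewrite (Series_ext _ (fun k => 0 * a k 0%nat)); [|intros; ring]. rewrite Series_scal_l. ring.
  - rewrite Series_plus; auto. rewrite IHN; auto. apply ex_series_rsum; auto.
Qed.

(** Tonelli in one direction, which is what the Hilbert-Schmidt bounds ask for: a partial sum over
    [n] commutes with the series over [k], and each row dominates its own partial sums. *)
Lemma Fubini_le (a : nat -> nat -> R) (M : nat -> R) :
  (forall k n, 0 <= a k n) -> (forall k, ex_series (a k)) -> (forall k, Series (a k) <= M k) ->
  ex_series M ->
  ex_series (fun n => Series (fun k => a k n)) /\ Series (fun n => Series (fun k => a k n)) <= Series M.
Proof.
  intros H0 Ha HaM HM.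
  assert (Hc : forall n, ex_series (fun k => a k n)).
  { intros n. apply (ex_series_dom _ M); auto. intros k. rewrite Rabs_pos_eq; auto.
    eapply Rle_trans; [|apply HaM]. apply term_le_Series; auto. }
  assert (Hb : forall N, rsum (fun n => Series (fun k => a k n)) N <= Series M).
  { intros N. rewrite <- Series_rsum; auto. apply Series_le; auto.
    intros k. split. apply rsum_ge0; auto. eapply Rle_trans; [|apply HaM]. apply rsum_le_Series; auto. }
  assert (He : ex_series (fun n => Series (fun k => a k n))).
  { apply ex_series_bounded with (Series M); auto. intros n. apply Series_nonneg; auto. }
  split; auto. apply Series_le_bound; auto.
Qed.

(** * Absolutely convergent complex series *)

(* [Series], hence [CS], has a junk value on divergent series; [summable] is the accompanying side condition. *)
Definition CS (a : nat -> C) : C := (Series (fun n => Re (a n)), Series (fun n => Im (a n))).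

Definition summable (a : nat -> C) : Prop := ex_series (fun n => Cmod (a n)).

Fixpoint csum (a : nat -> C) (n : nat) : C :=
  match n with O => 0 | S m => (csum a m + a m)%C end.

Lemma im_le_Cmod (z : C) : Rabs (Im z) <= Cmod z.
Proof. eapply Rle_trans; [|apply Rmax_Cmod]. apply Rmax_r. Qed.

Lemma Re_le_Cmod (z : C) : Re z <= Cmod z.
Proof. eapply Rle_trans; [apply Rle_abs|apply re_le_Cmod]. Qed.

Lemma summable_Re a : summable a -> ex_series (fun n => Re (a n)).
Proof. intros H. eapply ex_series_dom; [|apply H]. intros; apply re_le_Cmod. Qed.

Lemma summable_Im a : summable a -> ex_series (fun n => Im (a n)).
Proof. intros H. eapply ex_series_dom; [|apply H]. intros; apply im_le_Cmod. Qed.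

Lemma summable_dom a b : (forall n, Cmod (a n) <= b n) -> ex_series b -> summable a.
Proof.
  intros H Hb. eapply ex_series_dom; [|apply Hb]. intros n. rewrite Rabs_pos_eq; auto. apply Cmod_ge_0.
Qed.

Lemma summable_ext a b : (forall n, a n = b n) -> summable a -> summable b.
Proof. intros H. apply ex_series_ext. intros n; rewrite H; auto. Qed.

Lemma summable_plus a b : summable a -> summable b -> summable (fun n => (a n + b n)%C).
Proof.
  intros Ha Hb. eapply summable_dom; [|apply (ex_series_rplus _ _ Ha Hb)].
  intros n. apply Cmod_triangle.
Qed.

Lemma summable_scal c a : summable a -> summable (fun n => (c * a n)%C).
Proof.
  intros Ha. eapply summable_dom; [|apply (ex_series_rscal (Cmod c) _ Ha)].
  intros n. rewrite Cmod_mult. lra.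
Qed.

Lemma CS_ext a b : (forall n, a n = b n) -> CS a = CS b.
Proof. intros H. unfold CS. f_equal; apply Series_ext; intros; rewrite H; auto. Qed.

Lemma CS_plus a b : summable a -> summable b -> CS (fun n => (a n + b n)%C) = (CS a + CS b)%C.
Proof.
  intros Ha Hb. unfold CS, Cplus; simpl. f_equal; rewrite <- Series_plus; auto using summable_Re, summable_Im.
Qed.

Lemma CS_scal c a : summable a -> CS (fun n => (c * a n)%C) = (c * CS a)%C.
Proof.
  intros Ha. pose proof (summable_Re a Ha). pose proof (summable_Im a Ha).
  apply injective_projections.
  - change (Series (fun n => Re c * Re (a n) - Im c * Im (a n))
      = Re c * Series (fun n => Re (a n)) - Im c * Series (fun n => Im (a n))).
    rewrite <- !Series_scal_l. apply Series_minus; apply ex_series_rscal; auto.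
  - change (Series (fun n => Re c * Im (a n) + Im c * Re (a n))
      = Re c * Series (fun n => Im (a n)) + Im c * Series (fun n => Re (a n))).
    rewrite <- !Series_scal_l. apply Series_plus; apply ex_series_rscal; auto.
Qed.

Lemma CS_opp a : summable a -> CS (fun n => (- a n)%C) = (- CS a)%C.
Proof.
  intros Ha. rewrite (CS_ext _ (fun n => (-1) * a n)%C) by (intros; ring).
  rewrite CS_scal; auto. ring.
Qed.

Lemma summable_opp a : summable a -> summable (fun n => (- a n)%C).
Proof. intros Ha. apply (summable_ext (fun n => (-1) * a n)%C); [intros; ring|]. apply summable_scal; auto. Qed.

Lemma CS_minus a b : summable a -> summable b -> CS (fun n => (a n - b n)%C) = (CS a - CS b)%C.
Proof. intros Ha Hb. unfold Cminus. rewrite CS_plus, CS_opp; auto. apply summable_opp; auto. Qed.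

Lemma summable_minus a b : summable a -> summable b -> summable (fun n => (a n - b n)%C).
Proof. intros Ha Hb. apply summable_plus; auto. apply summable_opp; auto. Qed.

(** [CS] is defined by components, so the modulus of a sum is reached through real parts of
    rotations. The extremal [u] is the conjugate of [z] divided by its modulus. *)
Lemma Cmod_le_proj (z : C) M : 0 <= M -> (forall u, Cmod u <= 1 -> Re (u * z) <= M) -> Cmod z <= M.
Proof.
  intros HM H. destruct (Ceq_dec z 0) as [->|Hz].
  - rewrite Cmod_0; auto.
  - assert (Hp : 0 < Cmod z) by (apply Cmod_gt_0; auto).
    specialize (H (/ Cmod z * Cconj z)%C).
    assert (He : (/ Cmod z * Cconj z * z)%C = RtoC (Cmod z)).
    { rewrite <- Cmult_assoc, (Cmult_comm (Cconj z)), <- Cmod2_conj. rewrite <- RtoC_inv, <- RtoC_mult by lra.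
      f_equal. field. lra. }
    rewrite He in H. simpl in H. apply H.
    rewrite Cmod_mult, Cmod_conj. rewrite <- RtoC_inv by lra. rewrite Cmod_R, Rabs_pos_eq.
    + right. field. lra.
    + left. apply Rinv_0_lt_compat; auto.
Qed.

Lemma Cmod_CS_le a : summable a -> Cmod (CS a) <= Series (fun n => Cmod (a n)).
Proof.
  intros Ha. apply Cmod_le_proj.
  - apply Series_nonneg; auto. intros; apply Cmod_ge_0.
  - intros u Hu. rewrite <- CS_scal; auto. simpl.
    apply Series_le'; auto.
    + intros n. change (Re (u * a n) <= Cmod (a n)). eapply Rle_trans; [apply Re_le_Cmod|].
      rewrite Cmod_mult. pose proof (Cmod_ge_0 (a n)). nra.
    + apply (summable_Re (fun n => u * a n)%C). apply summable_scal; auto.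
Qed.

Lemma CS_le a b : (forall n, Cmod (a n) <= b n) -> ex_series b -> Cmod (CS a) <= Series b.
Proof.
  intros H Hb. eapply Rle_trans; [apply Cmod_CS_le; eapply summable_dom; eauto|].
  apply Series_le; auto. intros n. split; auto. apply Cmod_ge_0.
Qed.

Lemma Re_csum a n : Re (csum a n) = rsum (fun k => Re (a k)) n.
Proof. induction n; [reflexivity|]. simpl csum. rewrite re_plus, IHn. reflexivity. Qed.
Lemma Im_csum a n : Im (csum a n) = rsum (fun k => Im (a k)) n.
Proof. induction n; [reflexivity|]. simpl csum. rewrite im_plus, IHn. reflexivity. Qed.

Lemma csum_ext a b n : (forall k, (k < n)%nat -> a k = b k) -> csum a n = csum b n.
Proof. induction n; intros H; simpl; [easy|]. rewrite IHn, H; auto. Qed.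

Lemma csum_scal c a n : csum (fun k => (c * a k)%C) n = (c * csum a n)%C.
Proof. induction n; simpl; [ring|]. rewrite IHn; ring. Qed.

Lemma csum_plus a b n : csum (fun k => (a k + b k)%C) n = (csum a n + csum b n)%C.
Proof. induction n; simpl; [ring|]. rewrite IHn; ring. Qed.

Lemma csum_zero n : csum (fun _ => RtoC 0) n = 0.
Proof. induction n; simpl; [easy|]. rewrite IHn; ring. Qed.

Lemma csum_switch (a : nat -> nat -> C) n m :
  csum (fun i => csum (a i) m) n = csum (fun j => csum (fun i => a i j) n) m.
Proof.
  induction n; simpl.
  - symmetry; apply csum_zero.
  - rewrite IHn, <- csum_plus. reflexivity.
Qed.

Lemma csum_incr_1 a n : csum a (S n) = (a 0%nat + csum (fun k => a (S k)) n)%C.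
Proof. induction n; [simpl; ring|]. change (csum a (S (S n))) with (csum a (S n) + a (S n))%C. rewrite IHn.
simpl; ring. Qed.

Lemma summable_shift a n : summable a -> summable (fun k => a (n + k)%nat).
Proof. intros H. apply (ex_series_incr_n (fun k => Cmod (a k)) n). exact H. Qed.

Lemma CS_incr_n a n : summable a -> CS a = (csum a n + CS (fun k => a (n + k)%nat))%C.
Proof.
  intros H. destruct n as [|n].
  - simpl. rewrite Cplus_0_l. reflexivity.
  - apply injective_projections.
    + change (Series (fun k => Re (a k)) = Re (csum a (S n)) + Series (fun k => Re (a (S n + k)%nat))).
      rewrite Re_csum, (Series_incr_n (fun k => Re (a k)) (S n)); [|lia|apply summable_Re; auto].
      rewrite <- rsum_sum_n, sum_n_Reals. reflexivity.
    + change (Series (fun k => Im (a k)) = Im (csum a (S n)) + Series (fun k => Im (a (S n + k)%nat))).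
      rewrite Im_csum, (Series_incr_n (fun k => Im (a k)) (S n)); [|lia|apply summable_Im; auto].
      rewrite <- rsum_sum_n, sum_n_Reals. reflexivity.
Qed.

Lemma Series_incr_rsum a n : ex_series a -> Series a = rsum a n + Series (fun k => a (n + k)%nat).
Proof.
  intros H. destruct n as [|n].
  - simpl. ring_simplify. reflexivity.
  - rewrite (Series_incr_n a (S n)); [|lia|auto]. rewrite <- rsum_sum_n, sum_n_Reals. reflexivity.
Qed.

Lemma Series_unique_lim a l :
  (forall eps, 0 < eps -> exists N, forall n, (n >= N)%nat -> Rabs (rsum a n - l) < eps) -> is_series a l.
Proof.
  intros H. assert (Hl : is_lim_seq (sum_n a) l); [|exact Hl].
  apply is_lim_seq_spec. intros [eps He]. destruct (H eps He) as [N HN]. exists N. intros n Hn.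
  rewrite rsum_sum_n. apply HN. lia.
Qed.

Lemma CS_unique_lim a (l : C) :
  (forall eps, 0 < eps -> exists N, forall n, (n >= N)%nat -> Cmod (csum a n - l) < eps) -> CS a = l.
Proof.
  intros Hl. apply injective_projections; apply is_series_unique; apply Series_unique_lim;
  intros eps He; destruct (Hl eps He) as [N HN]; exists N; intros n Hn; specialize (HN n Hn);
  (eapply Rle_lt_trans; [|apply HN]).
  - rewrite <- Re_csum. change (Rabs (Re (csum a n - l)%C) <= Cmod (csum a n - l)). apply re_le_Cmod.
  - rewrite <- Im_csum. change (Rabs (Im (csum a n - l)%C) <= Cmod (csum a n - l)). apply im_le_Cmod.
Qed.

Lemma tail_small b : ex_series b -> (forall k, 0 <= b k) ->
  forall eps, 0 < eps -> exists N, forall n, (n >= N)%nat -> 0 <= Series (fun k => b (n + k)%nat) < eps.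
Proof.
  intros Hb H0 eps He. destruct (rsum_Series_lim b Hb eps He) as [N HN]. exists N. intros n Hn.
  specialize (HN n Hn). rewrite (Series_incr_rsum b n Hb) in HN.
  assert (0 <= Series (fun k => b (n + k)%nat)).
  { apply Series_nonneg; auto. apply (ex_series_incr_n b n); auto. }
  split; auto. apply Rabs_def2 in HN. lra.
Qed.

Lemma csum_lim a : summable a ->
  forall eps, 0 < eps -> exists N, forall n, (n >= N)%nat -> Cmod (csum a n - CS a) < eps.
Proof.
  intros H eps He.
  destruct (tail_small _ H (fun k => Cmod_ge_0 (a k)) eps He) as [N HN]. exists N. intros n Hn.
  specialize (HN n Hn). rewrite (CS_incr_n a n H).
  replace (csum a n - (csum a n + CS (fun k => a (n + k)%nat)))%C with (- CS (fun k => a (n + k)%nat))%C by ring.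
  rewrite Cmod_opp. eapply Rle_lt_trans; [apply Cmod_CS_le; apply summable_shift; auto|apply HN].
Qed.

Lemma CS_csum (a : nat -> nat -> C) N : (forall n, summable (fun k => a k n)) ->
  summable (fun k => csum (a k) N) /\ CS (fun k => csum (a k) N) = csum (fun n => CS (fun k => a k n)) N.
Proof.
  intros H. induction N; simpl.
  - split.
    + apply (summable_ext (fun k => 0 * a k 0%nat)%C); [intros; ring|]. apply summable_scal; auto.
    + rewrite (CS_ext _ (fun k => 0 * a k 0%nat)%C); [|intros; ring]. rewrite CS_scal; auto. ring.
  - destruct IHN as [I1 I2]. split; [apply summable_plus; auto|]. rewrite CS_plus, I2; auto.
Qed.

Lemma ex_series_geom_pos r : 0 <= r < 1 -> ex_series (fun n => r ^ n).
Proof. intros H. apply ex_series_geom. rewrite Rabs_pos_eq; lra. Qed.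
Lemma Series_geom_pos r : 0 <= r < 1 -> Series (fun n => r ^ n) = / (1 - r).
Proof. intros H. apply Series_geom. rewrite Rabs_pos_eq; lra. Qed.

(** * Power series on the unit disc *)

Definition PS (a : nat -> C) (f : C -> C) : Prop :=
  forall z, Cmod z < 1 -> summable (fun n => (a n * z ^ n)%C) /\ f z = CS (fun n => (a n * z ^ n)%C).

Definition Analytic (f : C -> C) : Prop := exists a, PS a f.

Lemma PS_ext a f g : (forall z, Cmod z < 1 -> f z = g z) -> PS a f -> PS a g.
Proof. intros H Hf z Hz. destruct (Hf z Hz) as [H1 H2]. rewrite <- H; auto. Qed.

Lemma Analytic_ext f g : (forall z, Cmod z < 1 -> f z = g z) -> Analytic f -> Analytic g.
Proof. intros H [a Ha]. exists a. eapply PS_ext; eauto. Qed.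

Lemma PS_abs a f r : PS a f -> 0 <= r < 1 -> ex_series (fun n => Cmod (a n) * r ^ n).
Proof.
  intros H Hr. assert (Hm : Cmod r = r) by (rewrite Cmod_R; apply Rabs_pos_eq; lra).
  destruct (H (RtoC r)) as [H1 _]; [lra|].
  eapply ex_series_rext; [|apply H1]. intros n; simpl. rewrite Cmod_mult, Cmod_pow, Hm. reflexivity.
Qed.

Lemma PS_coef_bound a f r : PS a f -> 0 <= r < 1 -> exists B, 0 <= B /\ forall n, Cmod (a n) * r ^ n <= B.
Proof.
  intros H Hr. pose proof (PS_abs a f r H Hr) as He.
  assert (Hp : forall n, 0 <= Cmod (a n) * r ^ n).
  { intros n. apply Rmult_le_pos; [apply Cmod_ge_0|apply pow_le; lra]. }
  exists (Series (fun n => Cmod (a n) * r ^ n)). split; [apply Series_nonneg; auto|].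
  intros n. apply (term_le_Series (fun n => Cmod (a n) * r ^ n)); auto.
Qed.

Lemma PS_bounded a f r : PS a f -> 0 <= r < 1 -> exists B, 0 <= B /\ forall z, Cmod z <= r -> Cmod (f z) <= B.
Proof.
  intros H Hr. pose proof (PS_abs a f r H Hr) as He.
  assert (Hp : forall n, 0 <= Cmod (a n) * r ^ n).
  { intros n. apply Rmult_le_pos; [apply Cmod_ge_0|apply pow_le; lra]. }
  exists (Series (fun n => Cmod (a n) * r ^ n)). split; [apply Series_nonneg; auto|].
  intros z Hz. destruct (H z) as [_ ->]; [lra|]. apply CS_le; auto.
  intros n. rewrite Cmod_mult, Cmod_pow. apply Rmult_le_compat_l; [apply Cmod_ge_0|].
  apply pow_incr. split; [apply Cmod_ge_0|auto].
Qed.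

Lemma PSC_plus a b f g : PS a f -> PS b g -> PS (fun n => (a n + b n)%C) (fun z => (f z + g z)%C).
Proof.
  intros Hf Hg z Hz. destruct (Hf z Hz) as [F1 F2], (Hg z Hz) as [G1 G2].
  assert (E : forall n, (a n * z ^ n + b n * z ^ n = (a n + b n) * z ^ n)%C) by (intros; ring).
  split.
  - eapply summable_ext; [apply E|]. apply summable_plus; auto.
  - rewrite <- (CS_ext _ _ E), CS_plus, F2, G2; auto.
Qed.

Lemma PSC_scal c a f : PS a f -> PS (fun n => (c * a n)%C) (fun z => (c * f z)%C).
Proof.
  intros Hf z Hz. destruct (Hf z Hz) as [F1 F2].
  assert (E : forall n, (c * (a n * z ^ n) = c * a n * z ^ n)%C) by (intros; ring).
  split.
  - eapply summable_ext; [apply E|]. apply summable_scal; auto.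
  - rewrite <- (CS_ext _ _ E), CS_scal, F2; auto.
Qed.

Definition shift_coef (b : nat -> C) (n : nat) : C := match n with O => 0 | S m => b m end.

Lemma PS_shift b g : PS b g -> PS (shift_coef b) (fun z => (z * g z)%C).
Proof.
  intros Hg z Hz. destruct (Hg z Hz) as [G1 G2].
  assert (S1 : summable (fun n => (shift_coef b n * z ^ n)%C)).
  { apply (ex_series_incr_1 (fun n => Cmod (shift_coef b n * z ^ n)%C)). simpl.
    eapply ex_series_rext; [|apply (ex_series_rscal (Cmod z) _ G1)].
    intros n. simpl. rewrite <- Cmod_mult. f_equal. ring. }
  split; auto.
  rewrite (CS_incr_n _ 1 S1). simpl. rewrite G2, <- CS_scal; auto.
  rewrite (CS_ext _ (fun n => (b n * (z * z ^ n))%C)); [ring|]. intros; ring.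
Qed.

Definition one_coef (n : nat) : C := match n with O => 1 | _ => 0 end.

Lemma PS_one : PS one_coef (fun _ => RtoC 1).
Proof.
  intros z Hz.
  assert (S1 : summable (fun n => (one_coef n * z ^ n)%C)).
  { apply ex_series_bounded with 1; [intros; apply Cmod_ge_0|].
    intros [|n]; [simpl; lra|]. induction n.
    - simpl. rewrite Cmult_1_r, Cmod_1. lra.
    - simpl rsum in *. rewrite Cmult_0_l, Cmod_0. lra. }
  split; auto. rewrite (CS_incr_n _ 1 S1). simpl.
  rewrite (CS_ext _ (fun n => 0 * (one_coef n * z ^ n))%C); [|intros; simpl; ring].
  rewrite CS_scal; auto. ring.
Qed.

(** Weierstrass's theorem at the level of coefficients. A radius [r] strictly between |z| and 1
    turns the domination into [M k * x ^ n] with [x = |z| / r < 1], a summable double array, so the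
    two summations may be exchanged. *)
Lemma PS_sum (a : nat -> nat -> C) (f : nat -> C -> C) :
  (forall k, PS (a k) (f k)) ->
  (forall r, 0 < r < 1 -> exists M : nat -> R, ex_series M /\ forall k n, Cmod (a k n) * r ^ n <= M k) ->
  PS (fun n => CS (fun k => a k n)) (fun z => CS (fun k => f k z)) /\
  forall z, Cmod z < 1 -> summable (fun k => f k z).
Proof.
  intros Hf HM.
  assert (Key : forall z, Cmod z < 1 ->
    (summable (fun n => (CS (fun k => a k n) * z ^ n)%C) /\
     CS (fun k => f k z) = CS (fun n => (CS (fun k => a k n) * z ^ n)%C)) /\ summable (fun k => f k z)).
  { intros z Hz. set (m := Cmod z). assert (Hm : 0 <= m) by apply Cmod_ge_0. fold m in Hz.
    set (r := (1 + m) / 2). assert (Hr : 0 < r < 1) by (unfold r; lra).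
    destruct (HM r Hr) as [M [HM1 HM2]].
    set (x := m / r). assert (Hx : 0 <= x < 1).
    { unfold x, r. split. apply Rmult_le_pos; auto. left; apply Rinv_0_lt_compat; lra.
      apply (Rmult_lt_reg_r ((1 + m)/2)); [lra|]. field_simplify; lra. }
    assert (Mp : forall k, 0 <= M k).
    { intros k. eapply Rle_trans; [|apply (HM2 k 0%nat)]. simpl. rewrite Rmult_1_r. apply Cmod_ge_0. }
    assert (Rn : forall n, 0 < r ^ n) by (intros; apply pow_lt; lra).
    assert (Ha : forall k n, Cmod (a k n * z ^ n) <= M k * x ^ n).
    { intros k n. rewrite Cmod_mult, Cmod_pow. fold m. specialize (HM2 k n). specialize (Rn n).
      replace m with (r * x) by (unfold x; field; lra). rewrite Rpow_mult_distr, <- Rmult_assoc.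
      apply Rmult_le_compat_r; auto. apply pow_le; lra. }
    assert (Hcol : forall n, summable (fun k => a k n)).
    { intros n. apply (summable_dom _ (fun k => / r ^ n * M k)); [|apply ex_series_rscal; auto].
      intros k. specialize (HM2 k n). specialize (Rn n).
      apply (Rmult_le_reg_r (r ^ n)); auto. replace (/ r ^ n * M k * r ^ n) with (M k) by (field; lra). auto. }
    set (S := Series M).
    assert (HS : 0 <= S) by (apply Series_nonneg; auto).
    assert (Hc : forall n, Cmod (CS (fun k => a k n) * z ^ n) <= S * x ^ n).
    { intros n. rewrite Cmult_comm, <- CS_scal by auto.
      rewrite (Rmult_comm S). unfold S. rewrite <- Series_scal_l.
      apply CS_le; [|apply ex_series_rscal; auto].
      intros k. rewrite Cmult_comm, (Rmult_comm _ (M k)). auto. }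
    assert (Hs1 : summable (fun n => (CS (fun k => a k n) * z ^ n)%C)).
    { eapply summable_dom; [apply Hc|]. apply ex_series_rscal, ex_series_geom_pos; auto. }
    (* Truncating in [n] leaves a finite sum, which commutes with the series over [k]; the error is
       a geometric tail, uniform in [k] up to the factor [M k]. *)
    assert (Hfk : forall k N, Cmod (csum (fun n => (a k n * z ^ n)%C) N - f k z) <= M k * (x ^ N * / (1 - x))).
    { intros k N. destruct (Hf k z Hz) as [H1 H2]. rewrite H2, (CS_incr_n _ N H1).
      match goal with |- Cmod (?u - (?u + ?v)) <= _ => replace (u - (u + v))%C with (- v)%C by ring end.
      rewrite Cmod_opp. rewrite <- Series_geom_pos by auto. rewrite <- !Series_scal_l. apply CS_le.
      - intros n. eapply Rle_trans; [apply Ha|]. rewrite pow_add. lra.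
      - apply ex_series_rscal, ex_series_rscal, ex_series_geom_pos; auto. }
    assert (Hx1 : 0 < / (1 - x)) by (apply Rinv_0_lt_compat; lra).
    assert (Hs2 : summable (fun k => f k z)).
    { apply (summable_dom _ (fun k => / (1 - x) * M k)); [|apply ex_series_rscal; auto].
      intros k. specialize (Hfk k 0%nat). simpl in Hfk.
      replace (0 - f k z)%C with (- f k z)%C in Hfk by ring. rewrite Cmod_opp in Hfk. lra. }
    split; auto. split; auto. symmetry. apply CS_unique_lim.
    intros eps He.
    destruct (pow_lt_1_zero x ltac:(rewrite Rabs_pos_eq; lra) (eps * (1 - x) / (S + 1))) as [N HN].
    { apply Rdiv_lt_0_compat; [|lra]. apply Rmult_lt_0_compat; lra. }
    exists N. intros n Hn. specialize (HN n Hn).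
    rewrite Rabs_pos_eq in HN by (apply pow_le; lra).
    destruct (CS_csum (fun k n => (a k n * z ^ n)%C) n) as [K1 K2].
    { intros j. apply (summable_ext (fun k => z ^ j * a k j)%C); [intros; ring|]. apply summable_scal; auto. }
    rewrite (csum_ext _ (fun j => CS (fun k => (a k j * z ^ j)%C))).
    2:{ intros j _. rewrite Cmult_comm, <- CS_scal by auto. apply CS_ext. intros; ring. }
    rewrite <- K2, <- CS_minus by auto.
    eapply Rle_lt_trans.
    { apply CS_le with (b := fun k => x ^ n * / (1 - x) * M k); [|apply ex_series_rscal; auto].
      intros k. rewrite (Rmult_comm _ (M k)). apply Hfk. }
    rewrite Series_scal_l. fold S.
    apply Rle_lt_trans with (x ^ n * / (1 - x) * (S + 1)).
    { apply Rmult_le_compat_l; [|lra]. apply Rmult_le_pos; [apply pow_le|]; lra. }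
    apply (Rmult_lt_compat_r (/ (1 - x) * (S + 1))) in HN; [|apply Rmult_lt_0_compat; lra].
    replace (eps * (1 - x) / (S + 1) * (/ (1 - x) * (S + 1))) with eps in HN by (field; lra). lra. }
  split; [intros z Hz|intros z Hz]; apply Key; auto.
Qed.

Fixpoint shiftn (k : nat) (b : nat -> C) : nat -> C :=
  match k with O => b | S k' => shift_coef (shiftn k' b) end.

Lemma PS_shiftn k b g : PS b g -> PS (shiftn k b) (fun z => (z ^ k * g z)%C).
Proof.
  intros H. induction k; simpl.
  - eapply PS_ext; [|apply H]. intros; ring.
  - eapply PS_ext; [|apply PS_shift, IHk]. intros; simpl; ring.
Qed.

Lemma shiftn_bound k b r B : 0 <= r -> (forall n, Cmod (b n) * r ^ n <= B) -> 0 <= B ->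
  forall n, Cmod (shiftn k b n) * r ^ n <= r ^ k * B.
Proof.
  intros Hr Hb HB. induction k; intros n; simpl.
  - rewrite Rmult_1_l; auto.
  - destruct n; simpl.
    + rewrite Cmod_0, Rmult_0_l. apply Rmult_le_pos; auto. apply Rmult_le_pos; auto. apply pow_le; auto.
    + specialize (IHk n). apply (Rmult_le_compat_l r) in IHk; auto. lra.
Qed.

(** The product is expanded as the series of [a k * z ^ k * g z], whose terms are shifts of the
    coefficients of [g]; [PS_sum] takes the place of a Cauchy product. *)
Lemma Analytic_mult f g : Analytic f -> Analytic g -> Analytic (fun z => (f z * g z)%C).
Proof.
  intros [a Ha] [b Hb].
  destruct (PS_sum (fun k n => (a k * shiftn k b n)%C) (fun k z => (a k * (z ^ k * g z))%C)) as [H _].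
  - intros k. apply PSC_scal, PS_shiftn; auto.
  - intros r Hr. destruct (PS_coef_bound b g r Hb ltac:(lra)) as [B [HB0 HB]].
    exists (fun k => B * (Cmod (a k) * r ^ k)). split.
    + apply ex_series_rscal. eapply PS_abs; [eauto|lra].
    + intros k n. rewrite Cmod_mult. pose proof (shiftn_bound k b r B ltac:(lra) HB HB0 n).
      pose proof (Cmod_ge_0 (a k)). nra.
  - eexists. eapply PS_ext; [|apply H]. intros z Hz. simpl.
    destruct (Ha z Hz) as [A1 A2]. rewrite A2, Cmult_comm, <- CS_scal; auto.
    apply CS_ext. intros; ring.
Qed.

Lemma Analytic_plus f g : Analytic f -> Analytic g -> Analytic (fun z => (f z + g z)%C).
Proof. intros [a Ha] [b Hb]. eexists. apply PSC_plus; eauto. Qed.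

Lemma Analytic_scal c f : Analytic f -> Analytic (fun z => (c * f z)%C).
Proof. intros [a Ha]. eexists. apply PSC_scal; eauto. Qed.

Lemma Analytic_const c : Analytic (fun _ => c).
Proof.
  apply (Analytic_ext (fun _ => c * 1)%C); [intros; ring|]. apply Analytic_scal. exists one_coef. apply PS_one.
Qed.

Lemma Analytic_pow f k : Analytic f -> Analytic (fun z => (f z ^ k)%C).
Proof.
  intros H. induction k; simpl; [apply Analytic_const|]. apply Analytic_mult; auto.
Qed.

(** * Parseval's inequality through averages over roots of unity *)

Definition cis (t : R) : C := (cos t, sin t).

Lemma cis_plus a b : cis (a + b) = (cis a * cis b)%C.
Proof. unfold cis, Cmult; simpl. rewrite cos_plus, sin_plus. f_equal; ring. Qed.

Lemma cis_0 : cis 0 = 1.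
Proof. unfold cis. rewrite cos_0, sin_0. reflexivity. Qed.

Lemma cis_pow t n : (cis t ^ n)%C = cis (INR n * t).
Proof.
  induction n.
  - simpl. rewrite Rmult_0_l, cis_0. reflexivity.
  - rewrite Cpow_S, IHn, S_INR, <- cis_plus. f_equal. ring.
Qed.

Lemma Cmod_cis t : Cmod (cis t) = 1.
Proof.
  unfold Cmod, cis; simpl. replace (_ + _) with (Rsqr (sin t) + Rsqr (cos t)) by (unfold Rsqr; ring).
  rewrite sin2_cos2. apply sqrt_1.
Qed.

Lemma cis_2PI_INR n : cis (INR n * (2 * PI)) = 1.
Proof.
  unfold cis. replace (INR n * (2 * PI)) with (0 + 2 * INR n * PI) by ring.
  rewrite cos_period, sin_period, cos_0, sin_0. reflexivity.
Qed.

Lemma cis_conj t : Cconj (cis t) = cis (- t).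
Proof. unfold Cconj, cis; simpl. rewrite cos_neg, sin_neg. reflexivity. Qed.

Lemma cis_neq_1 t : 0 < t < 2 * PI -> cis t <> 1.
Proof.
  intros Ht H. injection H as Hc Hs.
  replace t with (2 * (t / 2)) in Hc by field. rewrite cos_2a_sin in Hc.
  pose proof (sin_gt_0 (t / 2) ltac:(lra) ltac:(lra)). nra.
Qed.

Lemma geom_csum w n : ((w - 1) * csum (fun l => w ^ l) n = w ^ n - 1)%C.
Proof. induction n; simpl; [ring|]. rewrite Cmult_plus_distr_l, IHn. ring. Qed.

Definition root_unity (K : nat) : C := cis (2 * PI / INR K).

Lemma root_pow_K K : (0 < K)%nat -> (root_unity K ^ K)%C = 1.
Proof.
  intros HK. unfold root_unity. rewrite cis_pow. rewrite <- (cis_2PI_INR 1). f_equal.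
  simpl. field. apply not_0_INR; lia.
Qed.

Lemma root_pow_neq K m : (0 < m < K)%nat -> (root_unity K ^ m)%C <> 1.
Proof.
  intros Hm. unfold root_unity. rewrite cis_pow. apply cis_neq_1.
  assert (0 < INR m) by (apply lt_0_INR; lia). assert (INR m < INR K) by (apply lt_INR; lia).
  pose proof PI_RGT_0.
  replace (INR m * (2 * PI / INR K)) with (INR m / INR K * (2 * PI)) by (field; lra).
  assert (0 < INR m / INR K < 1).
  { split. apply Rdiv_lt_0_compat; lra. apply (Rmult_lt_reg_r (INR K)); [lra|]. field_simplify; lra. }
  nra.
Qed.

Lemma root_conj K : (root_unity K * Cconj (root_unity K) = 1)%C.
Proof.
  rewrite <- Cmod2_conj. unfold root_unity. rewrite Cmod_cis. f_equal. ring.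
Qed.

(** For [i <> j] the sum is geometric, and its ratio is a [K]-th root of unity different from 1
    because |i - j| < K. *)
Lemma root_orth K i j : (i < K)%nat -> (j < K)%nat ->
  csum (fun l => (root_unity K ^ l) ^ i * Cconj (root_unity K ^ l) ^ j)%C K = if Nat.eq_dec i j then RtoC (INR K) else 0.
Proof.
  intros Hi Hj. set (u := root_unity K).
  assert (Huc : (u * Cconj u = 1)%C) by apply root_conj.
  set (w := (u ^ i * Cconj u ^ j)%C).
  rewrite (csum_ext _ (fun l => w ^ l)%C).
  2:{ intros l _. unfold w. rewrite Cpow_mult_l, Cpow_conj, <- !Cpow_mult_r, (Nat.mul_comm l i), (Nat.mul_comm l j).
  reflexivity. }
  assert (Hpow : forall m, (u ^ m * Cconj u ^ m = 1)%C).
  { intros m. rewrite <- Cpow_mult_l, Huc. apply Cpow_1_l. }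
  destruct (Nat.eq_dec i j) as [<-|Hne].
  - unfold w. rewrite Hpow. clear. generalize K. intros K'. induction K'; [reflexivity|].
    rewrite S_INR. simpl. rewrite Cpow_1_l, IHK', RtoC_plus. reflexivity.
  - assert (HK : (0 < K)%nat) by lia.
    assert (w <> 1).
    { unfold w. intros Hw. destruct (Nat.lt_gt_cases i j) as [H _]. destruct (H Hne) as [Hlt|Hlt].
      - apply (root_pow_neq K (j - i)); [lia|]. fold u.
        replace j with (i + (j - i))%nat in Hw by lia. rewrite Cpow_add_r, Cmult_assoc, Hpow, Cmult_1_l in Hw.
        rewrite <- (Hpow (j - i)%nat), Hw. ring.
      - apply (root_pow_neq K (i - j)); [lia|]. fold u.
        replace i with ((i - j) + j)%nat in Hw by lia. rewrite Cpow_add_r, <- Cmult_assoc, Hpow, Cmult_1_r in Hw.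
        auto. }
    assert (Hz : (w ^ K = 1)%C).
    { unfold w. rewrite Cpow_mult_l, <- !Cpow_mult_r, (Nat.mul_comm i K), (Nat.mul_comm j K), !Cpow_mult_r.
      rewrite <- (Cpow_conj u K). unfold u. rewrite root_pow_K by auto.
      replace (Cconj 1) with (RtoC 1) by (unfold Cconj, RtoC; simpl; f_equal; ring). rewrite !Cpow_1_l. ring. }
    pose proof (geom_csum w K) as Hg. rewrite Hz in Hg.
    replace (1 - 1)%C with (RtoC 0) in Hg by ring.
    destruct (Ceq_dec (csum (fun l => w ^ l)%C K) 0) as [E|E]; auto.
    exfalso. apply (Cmult_neq_0 (w - 1) (csum (fun l => w ^ l)%C K)); auto. apply Cminus_eq_contra; auto.
Qed.

Lemma csum_delta (i N : nat) (c : nat -> C) : (i < N)%nat ->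
  csum (fun j => if Nat.eq_dec i j then c j else 0) N = c i.
Proof.
  revert i; induction N; intros i Hi; [lia|]. simpl.
  destruct (Nat.eq_dec i N) as [<-|Hne].
  - rewrite (csum_ext _ (fun _ => 0)).
    + rewrite csum_zero; ring.
    + intros k Hk. destruct (Nat.eq_dec i k); [lia|auto].
  - rewrite IHN by lia. ring.
Qed.

Lemma csum_conj a n : Cconj (csum a n) = csum (fun k => Cconj (a k)) n.
Proof.
  induction n; simpl.
  - unfold Cconj, RtoC; simpl; f_equal; ring.
  - rewrite Cplus_conj, IHn. reflexivity.
Qed.

Lemma csum_RtoC a n : csum (fun k => RtoC (a k)) n = RtoC (rsum a n).
Proof. induction n; simpl; [easy|]. rewrite IHn, RtoC_plus. reflexivity. Qed.

Lemma RtoC_conj r : Cconj (RtoC r) = RtoC r.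
Proof. unfold Cconj, RtoC; simpl; f_equal; ring. Qed.

Lemma csum_scal_r c a n : csum (fun k => (a k * c)%C) n = (csum a n * c)%C.
Proof. induction n; simpl; [ring|]. rewrite IHn; ring. Qed.

(** Equidistant points form an exact quadrature for a monomial times a conjugate monomial, both of
    degree below [K]. These finite averages do the work of integrals over circles. *)
Lemma poly_parseval (a : nat -> C) (r : R) K :
  rsum (fun l => Cmod (csum (fun j => a j * (r * root_unity K ^ l) ^ j)%C K) ^ 2) K
  = INR K * rsum (fun j => Cmod (a j) ^ 2 * (r ^ j) ^ 2) K.
Proof.
  apply RtoC_inj. rewrite <- csum_RtoC. rewrite RtoC_mult, <- csum_RtoC.
  set (u := root_unity K).
  transitivity (csum (fun l => csum (fun i => csum (fun j =>
     (a i * r ^ i * Cconj (a j) * r ^ j) * ((u ^ l) ^ i * Cconj (u ^ l) ^ j))%C K) K) K).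
  { apply csum_ext. intros l _. rewrite Cmod2_conj, csum_conj, <- csum_scal_r.
    apply csum_ext. intros i _. rewrite <- csum_scal. apply csum_ext. intros j _.
    rewrite Cmult_conj, (Cpow_conj _ j), (Cmult_conj r), RtoC_conj, !Cpow_mult_l. ring. }
  rewrite csum_switch. rewrite <- csum_scal. apply csum_ext. intros i Hi.
  rewrite csum_switch.
  rewrite (csum_ext _ (fun j => if Nat.eq_dec i j then (a i * r ^ i * Cconj (a j) * r ^ j * INR K)%C else 0)).
  - rewrite (csum_delta i K (fun j => (a i * r ^ i * Cconj (a j) * r ^ j * INR K)%C)) by auto.
    rewrite RtoC_mult, Cmod2_conj, RtoC_pow, RtoC_pow. simpl. ring.
  - intros j Hj. rewrite csum_scal. unfold u. rewrite root_orth by auto.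
    destruct (Nat.eq_dec i j); ring.
Qed.

Lemma poly_mean (b : nat -> C) (r : R) K : (0 < K)%nat ->
  csum (fun l => csum (fun j => b j * (r * root_unity K ^ l) ^ j)%C K) K = (INR K * b 0%nat)%C.
Proof.
  intros HK. set (u := root_unity K). rewrite csum_switch.
  rewrite (csum_ext _ (fun j => if Nat.eq_dec 0 j then (b j * r ^ j * INR K)%C else 0)).
  - rewrite (csum_delta 0 K (fun j => (b j * r ^ j * INR K)%C)) by auto. simpl. ring.
  - intros j Hj. pose proof (root_orth K j 0 Hj HK) as Ho. fold u in Ho.
    rewrite (csum_ext _ (fun l => (b j * r ^ j) * ((u ^ l) ^ j * Cconj (u ^ l) ^ 0))%C).
    2:{ intros l _. rewrite Cpow_mult_l. simpl. ring. }
    rewrite csum_scal, Ho. destruct (Nat.eq_dec j 0), (Nat.eq_dec 0 j); try lia; ring.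
Qed.

Lemma PS_tail a f r : PS a f -> 0 <= r < 1 -> forall eps, 0 < eps -> exists N, forall K, (K >= N)%nat ->
  forall z, Cmod z = r -> Cmod (f z - csum (fun j => a j * z ^ j)%C K) <= eps.
Proof.
  intros H Hr eps He.
  assert (Hp : forall n, 0 <= Cmod (a n) * r ^ n).
  { intros n. apply Rmult_le_pos; [apply Cmod_ge_0|apply pow_le; lra]. }
  destruct (tail_small _ (PS_abs a f r H Hr) Hp eps He) as [N HN]. exists N. intros K HK z Hz.
  specialize (HN K HK). destruct (H z) as [H1 ->]; [lra|].
  rewrite (CS_incr_n _ K H1).
  match goal with |- Cmod (?u + ?v - ?u) <= _ => replace (u + v - u)%C with v by ring end.
  eapply Rle_trans; [|left; apply HN]. apply CS_le.
  - intros n. rewrite Cmod_mult, Cmod_pow, Hz. lra.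
  - apply (ex_series_incr_n (fun n => Cmod (a n) * r ^ n) K). apply PS_abs with f; auto.
Qed.

(* The mean of |f|^2 over the circle of radius r is at most that of Re g, which is the value of Re g at the centre. *)
Lemma Parseval_majorant a b f g r N : PS a f -> PS b g -> 0 <= r < 1 ->
  (forall z, Cmod z = r -> Cmod (f z) ^ 2 <= Re (g z)) ->
  rsum (fun j => Cmod (a j) ^ 2 * (r ^ j) ^ 2) N <= Re (b 0%nat).
Proof.
  intros Hf Hg Hr Hm. apply le_epsilon. intros eps He.
  destruct (PS_bounded a f r Hf Hr) as [B [HB0 HB]].
  (* Replacing [f] and [g] by partial sums within [d] costs at most [2 * B * d + d ^ 2 + d], hence
     at most [eps]. *)
  set (d := Rmin 1 (eps / (2 * B + 2))).
  assert (Hd : 0 < d) by (apply Rmin_pos; [lra|apply Rdiv_lt_0_compat; lra]).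
  assert (Hd1 : d <= 1) by apply Rmin_l.
  assert (Hd2 : d * (2 * B + 2) <= eps).
  { assert (h : d <= eps / (2 * B + 2)) by apply Rmin_r. apply (Rmult_le_compat_r (2 * B + 2)) in h; [|lra].
    replace (eps / (2 * B + 2) * (2 * B + 2)) with eps in h by (field; lra). auto. }
  destruct (PS_tail a f r Hf Hr d Hd) as [N1 HN1].
  destruct (PS_tail b g r Hg Hr d Hd) as [N2 HN2].
  set (K := S (N + N1 + N2)).
  assert (HK : 0 < INR K) by (apply lt_0_INR; unfold K; lia).
  assert (Hz : forall l, Cmod (r * root_unity K ^ l) = r).
  { intros l. rewrite Cmod_mult, Cmod_pow, Cmod_R. unfold root_unity. rewrite Cmod_cis, pow1, Rabs_pos_eq; lra. }
  apply Rle_trans with (rsum (fun j => Cmod (a j) ^ 2 * (r ^ j) ^ 2) K).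
  { apply rsum_mono; [|unfold K; lia]. intros k. apply Rmult_le_pos; apply pow2_ge_0. }
  apply (Rmult_le_reg_l (INR K)); auto. rewrite <- poly_parseval.
  assert (Hpoint : forall l, (l < K)%nat -> Cmod (csum (fun j => a j * (r * root_unity K ^ l) ^ j)%C K) ^ 2
     <= Re (csum (fun j => b j * (r * root_unity K ^ l) ^ j)%C K) + eps).
  { intros l _. specialize (Hz l). set (z := (r * root_unity K ^ l)%C) in *.
    specialize (HN1 K ltac:(unfold K; lia) z Hz). specialize (HN2 K ltac:(unfold K; lia) z Hz).
    specialize (Hm z Hz). specialize (HB z ltac:(lra)).
    set (p := csum (fun j => a j * z ^ j)%C K) in *. set (q := csum (fun j => b j * z ^ j)%C K) in *.
    assert (Cmod p <= Cmod (f z) + d).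
    { replace p with (f z + - (f z - p))%C by ring. eapply Rle_trans; [apply Cmod_triangle|]. rewrite Cmod_opp. lra. }
    assert (Re (g z) <= Re q + d).
    { assert (h : Re (g z - q) <= d) by (eapply Rle_trans; [apply Re_le_Cmod|auto]).
      unfold Cminus in h. rewrite re_plus, re_opp in h. lra. }
    pose proof (Cmod_ge_0 p). nra. }
  eapply Rle_trans; [apply rsum_le, Hpoint|].
  rewrite rsum_plus. rewrite <- (Re_csum (fun l => csum (fun j => b j * (r * root_unity K ^ l) ^ j)%C K)).
  rewrite poly_mean by (unfold K; lia). rewrite re_scal_l.
  assert (E : forall n, rsum (fun _ => eps) n = INR n * eps).
  { induction n; [simpl; ring|]. rewrite S_INR. simpl rsum. rewrite IHn. ring. }
  rewrite E. lra.
Qed.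

(** The constant [M ^ 2] serves as the majorant in [Parseval_majorant], and a single term of the
    resulting sum is kept. *)
Lemma Cauchy_estimate a f r M n : PS a f -> 0 <= r < 1 -> 0 <= M ->
  (forall z, Cmod z = r -> Cmod (f z) <= M) -> Cmod (a n) * r ^ n <= M.
Proof.
  intros Hf Hr HM Hb.
  pose proof (Parseval_majorant a _ f _ r (S n) Hf (PSC_scal (RtoC (M ^ 2)) _ _ PS_one) Hr) as H.
  apply Rsqr_incr_0_var; auto. unfold Rsqr.
  eapply Rle_trans; [|eapply Rle_trans; [apply H|]].
  - eapply Rle_trans; [|apply (rsum_term_le (fun j => Cmod (a j) ^ 2 * (r ^ j) ^ 2) (S n) n); [|lia]].
    + right; ring.
    + intros k. apply Rmult_le_pos; apply pow2_ge_0.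
  - intros z Hz. rewrite Cmult_1_r. simpl. specialize (Hb z Hz). pose proof (Cmod_ge_0 (f z)). nra.
  - unfold one_coef. rewrite Cmult_1_r. simpl. right; ring.
Qed.

Lemma PS_unique a b f : PS a f -> PS b f -> forall n, a n = b n.
Proof.
  intros Ha Hb n.
  assert (H : PS (fun n => (a n + (-1) * b n)%C) (fun z => (f z + (-1) * f z)%C)).
  { apply PSC_plus; auto. apply PSC_scal; auto. }
  pose proof (Cauchy_estimate _ _ (1/2) 0 n H ltac:(lra) ltac:(lra)) as Hc.
  assert (Hp : 0 < (1/2)^n) by (apply pow_lt; lra).
  pose proof (Cmod_ge_0 (a n + (-1) * b n)).
  assert (Cmod (a n + (-1) * b n) = 0).
  { assert (Cmod (a n + -1 * b n) * (1 / 2) ^ n <= 0).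
    { apply Hc. intros z _. replace (f z + -1 * f z)%C with (RtoC 0) by ring. rewrite Cmod_0. lra. }
    nra. }
  apply Cmod_eq_0 in H1. apply Ceq_minus. rewrite <- H1. ring.
Qed.

(** Cauchy's estimate converts bounds on circles into the coefficient bounds that [PS_sum] asks
    for. *)
Lemma Analytic_sum (f : nat -> C -> C) :
  (forall k, Analytic (f k)) ->
  (forall r, 0 < r < 1 -> exists M : nat -> R, ex_series M /\ forall k z, Cmod z = r -> Cmod (f k z) <= M k) ->
  Analytic (fun z => CS (fun k => f k z)) /\ forall z, Cmod z < 1 -> summable (fun k => f k z).
Proof.
  intros Hf HM.
  destruct (choice (fun k a => PS a (f k)) Hf) as [a Ha].
  destruct (PS_sum a f Ha) as [H1 H2].
  - intros r Hr. destruct (HM r Hr) as [M [HM1 HM2]]. exists M. split; auto.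
    intros k n. apply Cauchy_estimate with (f k); [auto|lra| |auto].
    eapply Rle_trans; [apply Cmod_ge_0|apply (HM2 k (RtoC r))].
    rewrite Cmod_R. apply Rabs_pos_eq; lra.
  - split; auto. eexists; eauto.
Qed.

(** * Complex exponential and logarithm *)

Lemma Series_ray_derive (c : nat -> R) rho t : ex_series (fun n => Rabs (c n) * rho ^ n) -> Rabs t < rho ->
  is_derive (fun t => Series (fun n => c n * t ^ n)) t (Series (fun n => INR (S n) * c (S n) * t ^ n)).
Proof.
  intros H Ht.
  assert (Hr : Rbar_le rho (CV_radius c)).
  { apply Rbar_not_lt_le. intros Hlt.
    assert (Hrho : 0 < rho) by (pose proof (Rabs_pos t); lra).
    apply (CV_disk_outside c rho).
    - rewrite Rabs_pos_eq by lra. auto.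
    - apply ex_series_lim_0, ex_series_Rabs. eapply ex_series_rext; [|apply H].
      intros n. simpl. rewrite Rabs_mult, (Rabs_pos_eq (rho ^ n)); auto. apply pow_le; lra. }
  apply (is_derive_PSeries c t). eapply Rbar_lt_le_trans; [|apply Hr]. simpl; auto.
Qed.

(** Derivatives are taken only along rays. This suffices to identify a power series with an explicit
    function: along the ray both have the same derivative, or solve the same linear system, in the
    real variable [t]. *)
Lemma CS_ray_derive (c : nat -> C) rho t : ex_series (fun n => Cmod (c n) * rho ^ n) -> Rabs t < rho ->
  is_derive (fun t : R => Re (CS (fun n => (c n * t ^ n)%C))) t (Re (CS (fun n => (INR (S n) * c (S n) * t ^ n)%C))) /\
  is_derive (fun t : R => Im (CS (fun n => (c n * t ^ n)%C))) t (Im (CS (fun n => (INR (S n) * c (S n) * t ^ n)%C))).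
Proof.
  intros H Ht. assert (Hrho : 0 < rho) by (pose proof (Rabs_pos t); lra).
  assert (W : forall pr : C -> R, (forall z, Rabs (pr z) <= Cmod z) -> (forall z (r : R), pr (z * r)%C = pr z * r) ->
    is_derive (fun t : R => Series (fun n => pr (c n * t ^ n)%C)) t (Series (fun n => pr (INR (S n) * c (S n) * t ^ n)%C))).
  { intros pr H1 H2.
    assert (E : forall z (u : R) n, pr (z * u ^ n)%C = pr z * u ^ n) by (intros; rewrite <- RtoC_pow; apply H2).
    apply (is_derive_ext (fun t => Series (fun n => pr (c n) * t ^ n))).
    { intros u. apply Series_ext. intros n. symmetry. apply E. }
    rewrite (Series_ext (fun n => pr (INR (S n) * c (S n) * t ^ n)%C) (fun n => INR (S n) * pr (c (S n)) * t ^ n))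
      by (intros n; rewrite E, Cmult_comm, H2, (Rmult_comm (pr _)); reflexivity).
    apply (Series_ray_derive (fun n => pr (c n)) rho); auto.
    eapply ex_series_dom; [|apply H]. intros n. assert (0 <= rho ^ n) by (apply pow_le; lra).
    rewrite Rabs_mult, Rabs_Rabsolu, (Rabs_pos_eq (rho ^ n)) by auto. apply Rmult_le_compat_r; auto. }
  split; [apply (W Re)|apply (W Im)]; auto using re_le_Cmod, im_le_Cmod, re_scal_r, im_scal_r.
Qed.

Lemma CS_at_0 (c : nat -> C) : CS (fun n => (c n * 0 ^ n)%C) = c 0%nat.
Proof.
  apply CS_unique_lim. intros eps He. exists 1%nat. intros [|n] Hn; [lia|].
  rewrite csum_incr_1, (csum_ext _ (fun _ => RtoC 0)) by (intros; simpl; ring). rewrite csum_zero.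
  simpl. replace (c 0%nat * 1 + 0 - c 0%nat)%C with (RtoC 0) by ring. rewrite Cmod_0. auto.
Qed.

Lemma CS_at_1 (c : nat -> C) : CS (fun n => (c n * 1 ^ n)%C) = CS c.
Proof. apply CS_ext. intros n. rewrite Cpow_1_l. ring. Qed.

Definition cexp (w : C) : C := (RtoC (exp (Re w)) * cis (Im w))%C.

Lemma cexp_plus a b : cexp (a + b) = (cexp a * cexp b)%C.
Proof. unfold cexp. rewrite re_plus, im_plus, exp_plus, cis_plus, RtoC_mult. ring. Qed.

Lemma cexp_0 : cexp 0 = 1.
Proof. unfold cexp. simpl. rewrite exp_0, cis_0. ring. Qed.

Lemma Cmod_cexp w : Cmod (cexp w) = exp (Re w).
Proof. unfold cexp. rewrite Cmod_mult, Cmod_cis, Cmod_R, Rabs_pos_eq; [ring|left; apply exp_pos]. Qed.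

Lemma cexp_opp w : (cexp w * cexp (- w) = 1)%C.
Proof. rewrite <- cexp_plus, Cplus_opp_r. apply cexp_0. Qed.

Lemma cexp_RtoC (x : R) : cexp x = RtoC (exp x).
Proof. unfold cexp. simpl. rewrite cis_0. ring. Qed.

Lemma cexp_eq a b : cexp a = cexp b -> exists k : Z, (a - b)%C = (0, 2 * PI * IZR k).
Proof.
  intros H. assert (H1 : cexp (a - b) = 1).
  { unfold Cminus. rewrite cexp_plus, H. apply cexp_opp. }
  assert (Hr : Re (a - b) = 0).
  { apply exp_inv. rewrite <- Cmod_cexp, H1, Cmod_1, exp_0. reflexivity. }
  unfold cexp in H1. rewrite Hr, exp_0 in H1. rewrite Cmult_1_l in H1. set (y := Im (a - b)) in *.
  assert (Hc : cos y = 1) by exact (f_equal fst H1).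
  replace y with (2 * (y / 2)) in Hc by field. rewrite cos_2a_sin in Hc.
  assert (Hz : sin (y / 2) = 0) by nra.
  destruct (sin_eq_0_0 _ Hz) as [k Hk]. exists k.
  apply injective_projections; [exact Hr|]. change (y = 2 * PI * IZR k). lra.
Qed.

Lemma polar (w : C) : w <> 0 -> exists v, cexp v = w.
Proof.
  intros Hw. assert (Hp : 0 < Cmod w) by (apply Cmod_gt_0; auto).
  assert (Hth : exists t, cos t = Re w / Cmod w /\ sin t = Im w / Cmod w).
  { set (x := Re w / Cmod w). set (y := Im w / Cmod w).
    assert (Hxy : x ^ 2 + y ^ 2 = 1).
    { unfold x, y. replace (_ + _) with ((Re w ^ 2 + Im w ^ 2) / Cmod w ^ 2) by (field; lra).
      rewrite <- Cmod2_alt. field. lra. }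
    assert (Hx : -1 <= x <= 1) by nra.
    assert (Hs : sqrt (1 - x²) = Rabs y).
    { rewrite <- sqrt_Rsqr_abs. f_equal. unfold Rsqr. lra. }
    destruct (Rle_dec 0 y).
    - exists (acos x). rewrite cos_acos, sin_acos by auto. rewrite Hs, Rabs_pos_eq; auto.
    - exists (- acos x). rewrite cos_neg, sin_neg, cos_acos, sin_acos by auto.
      rewrite Hs, Rabs_left; lra. }
  destruct Hth as [t [Hc Hs]].
  exists (ln (Cmod w), t). unfold cexp. simpl. rewrite exp_ln by auto.
  unfold cis. rewrite Hc, Hs. apply injective_projections; simpl; unfold Re, Im; field; lra.
Qed.

Definition exp_term (w : C) (n : nat) : C := (/ INR (Factorial.fact n) * w ^ n)%C.

Lemma Cmod_exp_term w n : Cmod (exp_term w n) = / INR (Factorial.fact n) * Cmod w ^ n.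
Proof.
  unfold exp_term. rewrite Cmod_mult, Cmod_pow, <- RtoC_inv by apply INR_fact_neq_0.
  rewrite Cmod_R, Rabs_pos_eq; auto.
  left. apply Rinv_0_lt_compat, INR_fact_lt_0.
Qed.

Lemma ex_series_exp x : ex_series (fun n => / INR (Factorial.fact n) * x ^ n).
Proof.
  exists (exp x). eapply is_series_ext; [|apply (is_exp_Reals x)].
  intros n; simpl. rewrite pow_n_pow. unfold scal; simpl; unfold mult; simpl. ring.
Qed.

Lemma Series_exp x : Series (fun n => / INR (Factorial.fact n) * x ^ n) = exp x.
Proof. symmetry. apply exp_Reals. Qed.

Lemma summable_exp_term w : summable (exp_term w).
Proof. eapply ex_series_rext; [|apply (ex_series_exp (Cmod w))]. intros n. rewrite Cmod_exp_term. reflexivity. Qed.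

Lemma fact_S_inv n : (INR (S n) * / INR (Factorial.fact (S n)) = / INR (Factorial.fact n))%R.
Proof.
  change (Factorial.fact (S n)) with (S n * Factorial.fact n)%nat. rewrite mult_INR.
  pose proof (INR_fact_neq_0 n). assert (INR (S n) <> 0) by (apply not_0_INR; lia). field; auto.
Qed.

(* Both components of [t -> CS (t w)^n / n!] solve the linear system of the exponential along the ray. *)
Lemma cexp_series w : cexp w = CS (exp_term w).
Proof.
  set (x := Re w). set (y := Im w).
  set (G := fun t : R => CS (fun n => (exp_term w n * t ^ n)%C)).
  set (A := fun t => Re (G t)). set (B := fun t => Im (G t)).
  assert (Hs : forall rho, ex_series (fun n => Cmod (exp_term w n) * rho ^ n)).
  { intros rho. eapply ex_series_rext; [|apply (ex_series_exp (Cmod w * rho))].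
    intros n. rewrite Cmod_exp_term, Rpow_mult_distr. simpl. ring. }
  assert (HG : forall t : R, CS (fun n => (INR (S n) * exp_term w (S n) * t ^ n)%C) = (w * G t)%C).
  { intros t. unfold G. rewrite <- CS_scal.
    - apply CS_ext. intros n. unfold exp_term. rewrite Cpow_S, <- !RtoC_inv by apply INR_fact_neq_0.
      rewrite <- (fact_S_inv n), RtoC_mult. ring.
    - eapply ex_series_rext; [|apply (Hs (Rabs t))]. intros n. simpl. rewrite Cmod_mult, Cmod_pow, Cmod_R. auto. }
  assert (HAB : forall t, is_derive A t (x * A t - y * B t) /\ is_derive B t (x * B t + y * A t)).
  { intros t. destruct (CS_ray_derive (exp_term w) (Rabs t + 1) t (Hs _) ltac:(lra)) as [D1 D2].
    rewrite HG, re_mult in D1. rewrite HG, im_mult in D2.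
    split; [exact D1|]. replace (x * B t + y * A t) with (Re w * Im (G t) + Im w * Re (G t)); [exact D2|].
    unfold A, B, x, y. ring. }
  (* [g1] and [g2] are the real and imaginary parts of [exp (- t w) * G t], constant because
     [G' = w G]. *)
  set (g1 := fun t => exp (- (t * x)) * (A t * cos (t * y) + B t * sin (t * y))).
  set (g2 := fun t => exp (- (t * x)) * (B t * cos (t * y) - A t * sin (t * y))).
  assert (HA : forall t, is_derive A t (x * A t - y * B t)) by apply HAB.
  assert (HB : forall t, is_derive B t (x * B t + y * A t)) by apply HAB.
  assert (eA : forall t, ex_derive A t) by (intros t; eexists; apply HA).
  assert (eB : forall t, ex_derive B t) by (intros t; eexists; apply HB).
  assert (G1 : g1 0 = g1 1).
  { apply (eq_is_derive g1); [|lra]. intros t _. unfold g1. auto_derive; [auto|].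
    change (fun x => A x) with A. change (fun x => B x) with B.
    rewrite (is_derive_unique _ _ _ (HA t)), (is_derive_unique _ _ _ (HB t)). unfold zero; simpl. ring. }
  assert (G2 : g2 0 = g2 1).
  { apply (eq_is_derive g2); [|lra]. intros t _. unfold g2. auto_derive; [auto|].
    change (fun x => A x) with A. change (fun x => B x) with B.
    rewrite (is_derive_unique _ _ _ (HA t)), (is_derive_unique _ _ _ (HB t)). unfold zero; simpl. ring. }
  assert (Hw0 : G 0 = 1).
  { unfold G. rewrite CS_at_0. unfold exp_term. simpl. rewrite Cmult_1_r, <- RtoC_inv by lra. f_equal. field. }
  assert (A0 : A 0 = 1) by (unfold A; rewrite Hw0; reflexivity).
  assert (B0 : B 0 = 0) by (unfold B; rewrite Hw0; reflexivity).
  unfold g1, g2 in G1, G2. rewrite A0, B0, !Rmult_0_l, !Rmult_1_l, Ropp_0, exp_0 in G1, G2. rewrite cos_0 in G1.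
  rewrite sin_0 in G2.
  assert (E1 : G 1 = CS (exp_term w)) by apply CS_at_1.
  assert (Ee : exp (- x) * exp x = 1) by (rewrite <- exp_plus, Rplus_opp_l; apply exp_0).
  pose proof (sin2_cos2 y) as Hsc. unfold Rsqr in Hsc.
  assert (K1 : exp (- x) * (A 1 * cos y + B 1 * sin y) = 1) by lra.
  assert (K2 : exp (- x) * (B 1 * cos y - A 1 * sin y) = 0) by lra.
  assert (K1' : A 1 * cos y + B 1 * sin y = exp x).
  { transitivity (exp x * (exp (- x) * (A 1 * cos y + B 1 * sin y))); [|rewrite K1; ring].
    transitivity ((exp (- x) * exp x) * (A 1 * cos y + B 1 * sin y)); [rewrite Ee; ring|ring]. }
  assert (K2' : B 1 * cos y - A 1 * sin y = 0).
  { transitivity (exp x * (exp (- x) * (B 1 * cos y - A 1 * sin y))); [|rewrite K2; ring].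
    transitivity ((exp (- x) * exp x) * (B 1 * cos y - A 1 * sin y)); [rewrite Ee; ring|ring]. }
  rewrite <- E1. apply injective_projections.
  - change (Re (cexp w) = A 1). unfold cexp. rewrite re_scal_l. fold x y. simpl. rewrite <- K1'.
    transitivity (A 1 * (sin y * sin y + cos y * cos y) + sin y * (B 1 * cos y - A 1 * sin y)); [ring|].
    rewrite Hsc, K2'. ring.
  - change (Im (cexp w) = B 1). unfold cexp. rewrite im_scal_l. fold x y. simpl. rewrite <- K1'.
    transitivity (B 1 * (sin y * sin y + cos y * cos y) - cos y * (B 1 * cos y - A 1 * sin y)); [ring|].
    rewrite Hsc, K2'. ring.
Qed.

Lemma cexp_taylor (w : C) : Cmod w <= 1 -> Cmod (cexp w - 1 - w) <= Cmod w ^ 2.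
Proof.
  intros Hw. pose proof (Cmod_ge_0 w) as H0. set (m := Cmod w) in *.
  rewrite cexp_series. pose proof (summable_exp_term w) as Hs. rewrite (CS_incr_n _ 2 Hs).
  replace (csum (exp_term w) 2) with (1 + w)%C.
  2:{ simpl. unfold exp_term. simpl. rewrite <- !RtoC_inv by lra. rewrite !Rinv_1. ring. }
  match goal with |- Cmod (?u + ?v - _ - _) <= _ => replace (u + v - 1 - w)%C with v by ring end.
  eapply Rle_trans; [apply CS_le with (b := fun k => m ^ 2 * (/ INR (Factorial.fact (2 + k)) * 1 ^ (2 + k)))|].
  - intros n. rewrite Cmod_exp_term, pow_add. fold m. rewrite pow1.
    assert (m ^ n <= 1) by (rewrite <- (pow1 n); apply pow_incr; lra).
    assert (0 < / INR (Factorial.fact (2 + n))) by (apply Rinv_0_lt_compat, INR_fact_lt_0).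
    assert (0 <= m ^ 2) by apply pow2_ge_0.
    assert (0 <= / INR (Factorial.fact (2 + n)) * m ^ 2) by (apply Rmult_le_pos; lra).
    nra.
  - apply ex_series_rscal. apply (ex_series_incr_n (fun n => / INR (Factorial.fact n) * 1 ^ n) 2).
    apply ex_series_exp.
  (* The remaining sum of [1 / k!] over [k >= 2] is [exp 1 - 2], at most 1. *)
  - rewrite Series_scal_l. pose proof (Series_incr_rsum _ 2 (ex_series_exp 1)) as H.
    rewrite Series_exp in H. simpl rsum in H. rewrite Rinv_1 in H.
    set (T := Series (fun k => / INR (Factorial.fact (2 + k)) * 1 ^ (2 + k))) in *.
    pose proof exp_le_3.
    nra.
Qed.

Lemma cexp_minus1 (w : C) : Cmod w <= 1 -> Cmod (cexp w - 1) <= 2 * Cmod w.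
Proof.
  intros Hw. pose proof (cexp_taylor w Hw). pose proof (Cmod_ge_0 w).
  replace (cexp w - 1)%C with ((cexp w - 1 - w) + w)%C by ring.
  eapply Rle_trans; [apply Cmod_triangle|]. nra.
Qed.

Lemma Analytic_cexp f : Analytic f -> Analytic (fun z => cexp (f z)).
Proof.
  intros Hf.
  destruct (Analytic_sum (fun k z => (/ INR (Factorial.fact k) * f z ^ k)%C)) as [H _].
  - intros k. apply Analytic_scal, Analytic_pow; auto.
  - intros r Hr. destruct Hf as [a Ha]. destruct (PS_bounded a f r Ha ltac:(lra)) as [B [HB0 HB]].
    exists (fun k => / INR (Factorial.fact k) * B ^ k). split; [apply ex_series_exp|].
    intros k z Hz. fold (exp_term (f z) k). rewrite Cmod_exp_term. apply Rmult_le_compat_l.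
    + left. apply Rinv_0_lt_compat, INR_fact_lt_0.
    + apply pow_incr. split; [apply Cmod_ge_0|apply HB; lra].
  - eapply Analytic_ext; [|apply H]. intros z Hz. simpl. rewrite cexp_series. reflexivity.
Qed.

Lemma pow_small_C w : Cmod w < 1 -> forall eps, 0 < eps -> exists N, forall n, (n >= N)%nat -> Cmod (w ^ n) < eps.
Proof.
  intros Hw eps He. pose proof (Cmod_ge_0 w).
  destruct (pow_lt_1_zero (Cmod w) ltac:(rewrite Rabs_pos_eq; lra) eps He) as [N HN]. exists N. intros n Hn.
  specialize (HN n Hn). rewrite Cmod_pow. rewrite Rabs_pos_eq in HN; auto. apply pow_le; auto.
Qed.

Lemma Cmod_lt_1_neq w : Cmod w < 1 -> (1 - w)%C <> 0.
Proof.
  intros Hw H. assert (w = 1). { apply Ceq_minus. replace (w - 1)%C with (- (1 - w))%C by ring. rewrite H. ring. }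
  subst. rewrite Cmod_1 in Hw. lra.
Qed.

Lemma CS_geom w : Cmod w < 1 -> summable (fun n => w ^ n)%C /\ CS (fun n => (w ^ n)%C) = (/ (1 - w))%C.
Proof.
  intros Hw. pose proof (Cmod_ge_0 w). pose proof (Cmod_lt_1_neq w Hw) as Hn.
  split.
  - eapply ex_series_rext; [|apply (ex_series_geom_pos (Cmod w)); lra]. intros n; simpl. rewrite Cmod_pow.
    reflexivity.
  - apply CS_unique_lim. intros eps He.
    assert (Hp : 0 < Cmod (1 - w)) by (apply Cmod_gt_0; auto).
    destruct (pow_small_C w Hw (eps * Cmod (1 - w))) as [N HN]; [apply Rmult_lt_0_compat; auto|].
    exists N. intros n Hn'. specialize (HN n Hn').
    assert (E : (csum (fun n => w ^ n) n - / (1 - w) = - (w ^ n) / (1 - w))%C).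
    { pose proof (geom_csum w n) as G. set (s := csum (fun n => w ^ n)%C n) in *.
      assert (Gs : s = ((1 - w ^ n) / (1 - w))%C).
      { replace (1 - w ^ n)%C with (- (w ^ n - 1))%C by ring. rewrite <- G. field. auto. }
      rewrite Gs. field. auto. }
    rewrite E, Cmod_div, Cmod_opp by auto.
    apply (Rmult_lt_reg_r (Cmod (1 - w))); auto.
    replace (Cmod (w ^ n) / Cmod (1 - w) * Cmod (1 - w)) with (Cmod (w ^ n)) by (field; lra). auto.
Qed.

(* [clogm z] is the principal value of [- log (1 - z)] for [|z| < 1]. *)
Definition clogm (z : C) : C :=
  (- / 2 * ln ((1 - Re z) ^ 2 + Im z ^ 2), atan (Im z / (1 - Re z))).

Lemma disc_Re z : Cmod z < 1 -> Re z < 1.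
Proof. intros H. pose proof (Re_le_Cmod z). lra. Qed.

Definition clogm_coef (n : nat) : C := match n with O => 0 | S m => / INR (S m) end.

(** Both sides vanish at 0 and have the same derivative [z / (1 - t z)] along the segment from 0 to
    [z]. *)
Lemma PS_clogm : PS clogm_coef clogm.
Proof.
  intros z Hz. set (x := Re z). set (y := Im z).
  set (m := Cmod z). assert (Hm0 : 0 <= m) by apply Cmod_ge_0. fold m in Hz.
  set (c := fun n => (clogm_coef n * z ^ n)%C).
  assert (Hcoef : forall n, Cmod (clogm_coef n) <= 1).
  { intros [|n]; unfold clogm_coef; [rewrite Cmod_0; lra|].
    rewrite <- RtoC_inv by (apply not_0_INR; lia). rewrite Cmod_R.
    assert (1 <= INR (S n)) by (change 1 with (INR 1); apply le_INR; lia).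
    rewrite Rabs_pos_eq by (left; apply Rinv_0_lt_compat; lra).
    rewrite <- Rinv_1. apply Rinv_le_contravar; lra. }
  assert (Hc : forall n, Cmod (c n) <= m ^ n).
  { intros n. unfold c. rewrite Cmod_mult, Cmod_pow. fold m. specialize (Hcoef n).
    assert (0 <= m ^ n) by (apply pow_le; auto). nra. }
  assert (Hsum : summable c) by (eapply summable_dom; [apply Hc|apply ex_series_geom_pos; lra]).
  split; auto.
  (* A radius beyond 1 that still satisfies [m * rho < 1], so that the ray derivative is available
     up to and including [t = 1]. *)
  set (rho := 2 / (1 + m)).
  assert (Hrho : 1 < rho). { unfold rho. apply (Rmult_lt_reg_r (1 + m)); [lra|]. field_simplify; lra. }
  assert (Hmr : 0 <= m * rho < 1).
  { split; [apply Rmult_le_pos; lra|]. unfold rho. apply (Rmult_lt_reg_r (1 + m)); [lra|]. field_simplify; lra. }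
  assert (Hray : ex_series (fun n => Cmod (c n) * rho ^ n)).
  { eapply ex_series_dom; [|apply (ex_series_geom_pos (m * rho)); auto]. intros n.
    assert (0 <= rho ^ n) by (apply pow_le; lra). pose proof (Cmod_ge_0 (c n)).
    rewrite Rabs_pos_eq, Rpow_mult_distr by (apply Rmult_le_pos; auto). apply Rmult_le_compat_r; auto. }
  assert (Hg : forall t, 0 <= t <= 1 -> CS (fun n => (z * (t * z) ^ n)%C) = (z / (1 - t * z))%C /\ (1 - t * z)%C <> 0).
  { intros t Ht. assert (Cmod (t * z) < 1).
    { rewrite Cmod_mult, Cmod_R, Rabs_pos_eq by lra. fold m. nra. }
    split; [|apply Cmod_lt_1_neq; auto]. destruct (CS_geom (t * z)%C H) as [S1 S2].
    rewrite (CS_scal z (fun n => ((t * z) ^ n)%C)), S2; auto. }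
  assert (Hx : forall t, 0 <= t <= 1 -> 0 < 1 - t * x).
  { intros t Ht. pose proof (Re_le_Cmod z). fold x m in H. nra. }
  assert (Hcn : forall (t : R) n, (INR (S n) * c (S n) * t ^ n = z * (t * z) ^ n)%C).
  { intros t n. unfold c, clogm_coef. rewrite Cpow_mult_l, Cpow_S.
    assert (RtoC (INR (S n)) <> 0). { intros E. apply RtoC_inj in E. apply (not_0_INR (S n)); auto. }
    field. auto. }
  assert (HD : forall t, 0 <= t <= 1 ->
    is_derive (fun t : R => Re (CS (fun n => (c n * t ^ n)%C))) t ((x * (1 - t * x) - t * y * y) / ((1 - t * x) ^ 2 + (t * y) ^ 2)) /\
    is_derive (fun t : R => Im (CS (fun n => (c n * t ^ n)%C))) t (y / ((1 - t * x) ^ 2 + (t * y) ^ 2)) /\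
    0 < (1 - t * x) ^ 2 + (t * y) ^ 2).
  { intros t Ht. destruct (Hg t Ht) as [G1 G2]. specialize (Hx t Ht).
    assert (Hpos : 0 < (1 - t * x) ^ 2 + (t * y) ^ 2) by (pose proof (pow2_ge_0 (t * y)); nra).
    destruct (CS_ray_derive c rho t Hray ltac:(rewrite Rabs_pos_eq; lra)) as [D1 D2].
    rewrite (CS_ext _ _ (Hcn t)), G1 in D1, D2.
    split; [|split; [|exact Hpos]].
    - match type of D1 with is_derive _ _ ?v => replace v with ((x * (1 - t * x) - t * y * y) / ((1 - t * x) ^ 2 + (t * y) ^ 2)) in D1 end; auto.
      unfold x, y, Cdiv, Cinv, Cmult, Re, Im in *; simpl in *. field. nra.
    - match type of D2 with is_derive _ _ ?v => replace v with (y / ((1 - t * x) ^ 2 + (t * y) ^ 2)) in D2 end; auto.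
      unfold x, y, Cdiv, Cinv, Cmult, Re, Im in *; simpl in *. field. nra. }
  assert (c0 : c 0%nat = 0) by (unfold c, clogm_coef; ring).
  apply injective_projections.
  - set (f := fun t : R => Re (CS (fun n => (c n * t ^ n)%C)) + / 2 * ln ((1 - t * x) ^ 2 + (t * y) ^ 2)).
    assert (E : f 0 = f 1).
    { apply (eq_is_derive f); [|lra]. intros t Ht. destruct (HD t Ht) as [D1 [_ Hpos]].
      assert (D2 : is_derive (fun t => / 2 * ln ((1 - t * x) ^ 2 + (t * y) ^ 2)) t (- ((x * (1 - t * x) - t * y * y) / ((1 - t * x) ^ 2 + (t * y) ^ 2)))).
      { auto_derive; [simpl in Hpos; lra|]. simpl in Hpos. simpl. field. lra. }
      pose proof (is_derive_plus _ _ _ _ _ D1 D2) as D. unfold plus in D; simpl in D. unfold zero; simpl.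
      match type of D with is_derive _ _ ?v => replace v with 0 in D by (simpl; ring) end. exact D. }
    unfold f in E. rewrite CS_at_0, CS_at_1, c0 in E. simpl (Re 0) in E. rewrite !Rmult_0_l, !Rmult_1_l in E.
    replace ((1 - 0) ^ 2 + 0 ^ 2) with 1 in E by ring. rewrite ln_1 in E.
    change (- / 2 * ln ((1 - x) ^ 2 + y ^ 2) = Re (CS c)). lra.
  - set (f := fun t : R => Im (CS (fun n => (c n * t ^ n)%C)) - atan (t * y / (1 - t * x))).
    assert (E : f 0 = f 1).
    { apply (eq_is_derive f); [|lra]. intros t Ht. destruct (HD t Ht) as [_ [D1 Hpos]]. specialize (Hx t Ht).
      assert (D2 : is_derive (fun t => atan (t * y / (1 - t * x))) t (y / ((1 - t * x) ^ 2 + (t * y) ^ 2))).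
      { auto_derive; [lra|]. simpl in Hpos. field. split; [|lra]. intros E0. simpl in E0. nra. }
      pose proof (is_derive_minus _ _ _ _ _ D1 D2) as D. unfold minus, plus, opp in D; simpl in D. unfold zero; simpl.
      match type of D with is_derive _ _ ?v => replace v with 0 in D by (simpl; ring) end. exact D. }
    unfold f in E. rewrite CS_at_0, CS_at_1, c0 in E. simpl (Im 0) in E. rewrite !Rmult_0_l, !Rmult_1_l in E.
    replace (0 / (1 - 0)) with 0 in E by field. rewrite atan_0 in E.
    change (atan (y / (1 - x)) = Im (CS c)). lra.
Qed.

Lemma ln_sqrt_half x : 0 < x -> ln (sqrt x) = / 2 * ln x.
Proof.
  intros Hx. assert (Hs : 0 < sqrt x) by (apply sqrt_lt_R0; auto).
  rewrite <- (sqrt_sqrt x) at 2 by lra. rewrite ln_mult by auto. field.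
Qed.

Lemma clogm_0 : clogm 0 = 0.
Proof.
  unfold clogm; simpl. replace ((1 - 0) * ((1 - 0) * 1) + 0 * (0 * 1)) with 1 by ring. rewrite ln_1.
  replace (0 / (1 - 0)) with 0 by field. rewrite atan_0. unfold RtoC. f_equal. ring.
Qed.

Lemma atan_cos_sin u : cos (atan u) = / sqrt (1 + u ^ 2) /\ sin (atan u) = u / sqrt (1 + u ^ 2).
Proof.
  assert (E : 1 + u ^ 2 = 1 + u²) by (unfold Rsqr; ring). rewrite E.
  split; [rewrite cos_atan; field; apply Rgt_not_eq, sqrt_lt_R0; unfold Rsqr; nra|apply sin_atan].
Qed.

Lemma cexp_clogm z : Cmod z < 1 -> cexp (- clogm z) = (1 - z)%C.
Proof.
  intros Hz. pose proof (disc_Re z Hz) as Hx. set (x := Re z) in *. set (y := Im z).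
  set (n2 := (1 - x) ^ 2 + y ^ 2). assert (Hn : 0 < n2) by (unfold n2; pose proof (pow2_ge_0 y); nra).
  unfold cexp. rewrite re_opp, im_opp.
  replace (- Re (clogm z)) with (ln (sqrt n2)).
  2:{ rewrite ln_sqrt_half by auto. unfold clogm; simpl. fold x y. unfold n2. simpl. field. }
  rewrite exp_ln by (apply sqrt_lt_R0; auto).
  replace (Im (clogm z)) with (atan (y / (1 - x))) by reflexivity.
  rewrite <- cis_conj. unfold cis. destruct (atan_cos_sin (y / (1 - x))) as [-> ->].
  assert (E : sqrt (1 + (y / (1 - x)) ^ 2) = sqrt n2 / (1 - x)).
  { apply sqrt_lem_1.
    - pose proof (pow2_ge_0 (y / (1 - x))). lra.
    - apply Rmult_le_pos; [apply sqrt_pos|left; apply Rinv_0_lt_compat; lra].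
    - replace (sqrt n2 / (1 - x) * (sqrt n2 / (1 - x))) with (sqrt n2 * sqrt n2 / (1 - x) ^ 2) by (field; lra).
      rewrite sqrt_sqrt by lra. unfold n2. field. lra. }
  rewrite E. assert (0 < sqrt n2) by (apply sqrt_lt_R0; auto).
  unfold Cconj, Cmult, Cminus, Cplus, Copp; apply injective_projections; simpl; fold (Re z) (Im z); fold x y; field; lra.
Qed.

Definition zeta (z : C) : C := (1 + clogm z)%C.

Lemma Analytic_zeta : Analytic zeta.
Proof. apply Analytic_plus; [apply Analytic_const|eexists; apply PS_clogm]. Qed.

Lemma cexp_zeta z : Cmod z < 1 -> cexp (1 - zeta z) = (1 - z)%C.
Proof. intros Hz. unfold zeta. rewrite <- (cexp_clogm z) by auto. f_equal. ring. Qed.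

Lemma zeta_inj z z' : Cmod z < 1 -> Cmod z' < 1 -> zeta z = zeta z' -> z = z'.
Proof.
  intros Hz Hz' H. pose proof (cexp_zeta z Hz) as E. rewrite H, cexp_zeta in E by auto.
  replace z with (1 - (1 - z))%C by ring. rewrite <- E. ring.
Qed.

Lemma Re_zeta z : Cmod z < 1 -> Re (zeta z) = 1 - ln (Cmod (1 - z)).
Proof.
  intros Hz. rewrite <- cexp_zeta, Cmod_cexp, ln_exp by auto. unfold Cminus. rewrite re_plus, re_opp. simpl. ring.
Qed.

(** The summand 1 in [zeta] serves here: |1 - z| < 2 and ln 2 < 1. *)
Lemma Re_zeta_pos z : Cmod z < 1 -> 0 < Re (zeta z).
Proof.
  intros Hz. rewrite Re_zeta by auto.
  assert (Hp : 0 < Cmod (1 - z)) by (apply Cmod_gt_0, Cmod_lt_1_neq; auto).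
  assert (Cmod (1 - z) < 2).
  { unfold Cminus. eapply Rle_lt_trans; [apply Cmod_triangle|]. rewrite Cmod_1, Cmod_opp. lra. }
  assert (ln (Cmod (1 - z)) < ln 2) by (apply ln_increasing; auto).
  assert (ln 2 < 1). { rewrite <- (ln_exp 1). apply ln_increasing; [lra|]. pose proof (exp_ineq1 1). lra. }
  lra.
Qed.

Lemma Im_zeta z : - (PI / 2) < Im (zeta z) < PI / 2.
Proof. unfold zeta. rewrite im_plus. simpl. rewrite Rplus_0_l. pose proof (atan_bound (snd z / (1 - fst z))).
unfold Im, Re. lra. Qed.

(** The image of [zeta] is only part of the half strip. The candidate is [1 - exp (1 - w)], and the
    second hypothesis expresses that it lies in the disc: with [e = exp (1 - Re w)], its squared
    modulus is [1 - 2 e cos (Im w) + e ^ 2]. *)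
Lemma zeta_surj w : - (PI / 2) < Im w < PI / 2 -> exp (1 - Re w) < 2 * cos (Im w) ->
  exists z, Cmod z < 1 /\ zeta z = w.
Proof.
  intros Hi Hr. set (z := (1 - cexp (1 - w))%C).
  assert (Hz : Cmod z < 1).
  { assert (H2 : Cmod z ^ 2 < 1).
    { rewrite Cmod2_alt. unfold z, cexp.
      assert (Er : Re (1 - w) = 1 - Re w) by (unfold Cminus; rewrite re_plus, re_opp; reflexivity).
      assert (Ei : Im (1 - w) = - Im w) by (unfold Cminus; rewrite im_plus, im_opp; simpl; ring).
      rewrite Er, Ei. set (e := exp (1 - Re w)) in *. assert (0 < e) by apply exp_pos.
      unfold Cminus. rewrite re_plus, im_plus, re_opp, im_opp, re_scal_l, im_scal_l. unfold cis. simpl.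
      rewrite cos_neg, sin_neg. pose proof (sin2_cos2 (Im w)) as Hsc. unfold Rsqr in Hsc.
      unfold Im in *. nra. }
    nra. }
  exists z. split; auto.
  assert (E : cexp (1 - zeta z) = cexp (1 - w)) by (rewrite cexp_zeta by auto; unfold z; ring).
  apply cexp_eq in E. destruct E as [k Hk].
  assert (Hd : (w - zeta z)%C = (0, 2 * PI * IZR k)) by (rewrite <- Hk; ring).
  assert (Him : Im w - Im (zeta z) = 2 * PI * IZR k).
  { change (Im w - Im (zeta z)) with (Im (w - zeta z)). rewrite Hd. reflexivity. }
  pose proof (Im_zeta z) as Hiz.
  assert (k = 0%Z).
  { assert (-1 < IZR k < 1) by (split; nra). assert (-1 < k < 1)%Z by (split; apply lt_IZR; lra). lia. }
  subst k. symmetry. apply Ceq_minus. rewrite Hd. unfold RtoC. f_equal. ring.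
Qed.

(** * Quadratic differentiability on the positive half line *)

(** A Taylor bound that is uniform over the half line passes to a series by summing the constants
    [B], which yields termwise differentiation without a discussion of uniform convergence. *)
Definition quad_diff (f f' : R -> R) (B : R) : Prop :=
  forall t u, 0 < t -> 0 < u -> Rabs (f u - f t - f' t * (u - t)) <= B * (u - t) ^ 2.

Lemma quad_diff_derive f f' B t : quad_diff f f' B -> 0 < t -> is_derive f t (f' t).
Proof.
  intros H Ht. apply is_derive_Reals. intros eps He.
  set (b := Rabs B + 1). assert (Hb : 0 < b) by (pose proof (Rabs_pos B); unfold b; lra).
  assert (Hd : 0 < Rmin t (eps / b)) by (apply Rmin_pos; [lra|apply Rdiv_lt_0_compat; lra]).
  exists (mkposreal _ Hd). simpl. intros h Hh Hlt.
  assert (H1 : Rabs h < t) by (eapply Rlt_le_trans; [apply Hlt|apply Rmin_l]).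
  assert (H2 : Rabs h < eps / b) by (eapply Rlt_le_trans; [apply Hlt|apply Rmin_r]).
  assert (Hu : 0 < t + h) by (apply Rabs_def2 in H1; lra).
  specialize (H t (t + h) Ht Hu). replace (t + h - t) with h in H by ring.
  replace ((f (t + h) - f t) / h - f' t) with ((f (t + h) - f t - f' t * h) / h) by (field; auto).
  assert (Hp : 0 < Rabs h) by (apply Rabs_pos_lt; auto).
  rewrite Rabs_div by auto. apply (Rmult_lt_reg_r (Rabs h)); auto.
  replace (Rabs (f (t + h) - f t - f' t * h) / Rabs h * Rabs h) with (Rabs (f (t + h) - f t - f' t * h)) by (field; lra).
  eapply Rle_lt_trans; [apply H|].
  replace (h ^ 2) with (Rabs h * Rabs h) by (rewrite <- Rabs_mult, Rabs_pos_eq; [ring|nra]).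
  rewrite <- Rmult_assoc. apply Rmult_lt_compat_r; auto.
  apply Rle_lt_trans with (b * Rabs h).
  - apply Rmult_le_compat_r; [lra|]. pose proof (Rle_abs B). unfold b; lra.
  - apply (Rmult_lt_compat_l b) in H2; auto. replace (b * (eps / b)) with eps in H2 by (field; lra). auto.
Qed.

Lemma quad_diff_Series (f f' : nat -> R -> R) (B : nat -> R) :
  (forall m, quad_diff (f m) (f' m) (B m)) -> ex_series B ->
  (forall t, 0 < t -> ex_series (fun m => f m t)) -> (forall t, 0 < t -> ex_series (fun m => f' m t)) ->
  quad_diff (fun t => Series (fun m => f m t)) (fun t => Series (fun m => f' m t)) (Series B).
Proof.
  intros H HB Hf Hf' t u Ht Hu.
  rewrite <- Series_scal_r, <- Series_scal_r.
  rewrite <- Series_minus by auto.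
  assert (E1 : ex_series (fun m => f' m t * (u - t))) by (apply ex_series_scal_r; auto).
  assert (E2 : ex_series (fun m => f m u - f m t)) by (apply (ex_series_minus (V:=R_NormedModule)); auto).
  rewrite <- Series_minus by auto.
  assert (E3 : ex_series (fun m => B m * (u - t) ^ 2)) by (apply ex_series_scal_r; auto).
  eapply Rle_trans; [apply Series_Rabs|apply Series_le; auto].
  - eapply ex_series_dom; [|apply E3]. intros m. rewrite Rabs_Rabsolu. apply H; auto.
  - intros m. split; [apply Rabs_pos|apply H; auto].
Qed.

Lemma exp_le_1 x : x <= 0 -> exp x <= 1.
Proof. intros H. rewrite <- exp_0. destruct H as [H| ->]; [left; apply exp_increasing; auto|lra]. Qed.

Lemma exp_mono x y : x <= y -> exp x <= exp y.
Proof. intros [H| ->]; [left; apply exp_increasing; auto|lra]. Qed.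

Lemma exp_ge_1p x : 1 + x <= exp x.
Proof. destruct (Req_dec x 0) as [ ->|H]; [rewrite exp_0; lra|left; apply exp_ineq1; auto]. Qed.

Lemma exp_lipschitz mu t u : 0 <= mu -> 0 <= t -> 0 <= u -> Rabs (exp (- mu * t) - exp (- mu * u)) <= mu * Rabs (u - t).
Proof.
  assert (W : forall t u, 0 <= mu -> 0 <= t -> t <= u -> Rabs (exp (- mu * t) - exp (- mu * u)) <= mu * Rabs (u - t)).
  { intros t' u' Hm Ht Htu. rewrite (Rabs_pos_eq (u' - t')) by lra.
    assert (exp (- mu * u') <= exp (- mu * t')) by (apply exp_mono; nra).
    rewrite Rabs_pos_eq by lra.
    assert (E : exp (- mu * u') = exp (- mu * t') * exp (- mu * (u' - t'))) by (rewrite <- exp_plus; f_equal; ring).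
    pose proof (exp_ge_1p (- mu * (u' - t'))). assert (exp (- mu * t') <= 1) by (apply exp_le_1; nra).
    pose proof (exp_pos (- mu * t')). rewrite E.
    nra. }
  intros Hm Ht Hu. destruct (Rle_dec t u).
  - apply W; auto.
  - rewrite Rabs_minus_sym, (Rabs_minus_sym u). apply W; auto; lra.
Qed.

Lemma quad_diff_exp mu : 0 <= mu -> quad_diff (fun t => exp (- mu * t)) (fun t => - mu * exp (- mu * t)) (mu ^ 2).
Proof.
  intros Hm t u Ht Hu. set (h := u - t).
  assert (E1 : exp (- mu * u) = exp (- mu * t) * exp (- mu * h)) by (rewrite <- exp_plus; f_equal; unfold h; ring).
  assert (E2 : exp (- mu * t) = exp (- mu * u) * exp (mu * h)) by (rewrite <- exp_plus; f_equal; unfold h; ring).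
  pose proof (exp_ge_1p (- mu * h)). pose proof (exp_ge_1p (mu * h)).
  pose proof (exp_pos (- mu * t)). pose proof (exp_pos (- mu * u)).
  pose proof (exp_lipschitz mu t u Hm ltac:(lra) ltac:(lra)) as HL. fold h in HL.
  set (a := exp (- mu * t)) in *. set (b := exp (- mu * u)) in *.
  (* The tangent at [t] shows that the remainder is nonnegative; the tangent at [u] bounds it by
     [mu h (a - b)], to which the Lipschitz bound applies. *)
  rewrite Rabs_pos_eq by nra.
  assert (L3 : b - a - - mu * a * h <= mu * h * (a - b)) by nra.
  eapply Rle_trans; [apply L3|]. eapply Rle_trans; [apply Rle_abs|].
  rewrite !Rabs_mult, (Rabs_pos_eq mu) by auto.
  replace (mu ^ 2 * h ^ 2) with (mu * Rabs h * (mu * Rabs h)).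
  - apply Rmult_le_compat_l; auto. apply Rmult_le_pos; auto. apply Rabs_pos.
  - replace (h ^ 2) with (Rabs h * Rabs h) by (rewrite <- Rabs_mult, Rabs_pos_eq; [ring|nra]). ring.
Qed.

Lemma quad_diff_scal c f f' B : quad_diff f f' B -> quad_diff (fun t => c * f t) (fun t => c * f' t) (Rabs c * B).
Proof.
  intros H t u Ht Hu. specialize (H t u Ht Hu).
  replace (c * f u - c * f t - c * f' t * (u - t)) with (c * (f u - f t - f' t * (u - t))) by ring.
  rewrite Rabs_mult, Rmult_assoc. apply Rmult_le_compat_l; auto. apply Rabs_pos.
Qed.

Lemma quad_diff_ext f f' g g' B B' : (forall t, f t = g t) -> (forall t, f' t = g' t) -> B = B' -> quad_diff f f' B -> quad_diff g g' B'.
Proof. intros Hf Hg <- H t u Ht Hu. rewrite <- !Hf, <- Hg. auto. Qed.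

(** * The exponential sums *)

(* Any sufficiently small constant would do. *)
Definition s0 : R := / 10000.
Definition lam (m : nat) : R := s0 ^ 2 * (/ 4) ^ m.
(* Normalised so that [d m = cc d m / sqrt (lam m)]. *)
Definition cc (d : nat -> R) (m : nat) : R := s0 * (/ 2) ^ m * d m.

(** The value at 0 lets [P] start above 1/10. The two lower bounds on [d (S m)] and [d m] make [q]
    vary slowly ([cc_rec]), and the second one also makes [Hr] unbounded. The sum bounds [q] and
    [P]; the value 6 is the one that [profile] delivers. *)
Definition admissible (d : nat -> R) : Prop :=
  d 0%nat = 1 /\ (forall m, 0 < d m) /\ (forall m, d m / 2 <= d (S m)) /\ (forall m, (/ 2) ^ m <= d m) /\
  ex_series d /\ Series d <= 6.

Lemma lam_pos m : 0 < lam m.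
Proof. unfold lam, s0. apply Rmult_lt_0_compat; [lra|apply pow_lt; lra]. Qed.

Lemma lam_le m : lam m <= s0 ^ 2.
Proof.
  unfold lam. assert ((/ 4) ^ m <= 1) by (rewrite <- (pow1 m); apply pow_incr; lra).
  nra.
Qed.

Lemma lam_S m : 4 * lam (S m) = lam m.
Proof. unfold lam. simpl. field. Qed.

Lemma lam_sqrt m : lam m = (s0 * (/ 2) ^ m) ^ 2.
Proof. unfold lam. rewrite Rpow_mult_distr, <- pow_mult, Nat.mul_comm, pow_mult. f_equal. f_equal. field. Qed.

Lemma cc_pos d m : admissible d -> 0 < cc d m.
Proof.
  intros H. unfold cc. apply Rmult_lt_0_compat; [|apply H].
  apply Rmult_lt_0_compat; [unfold s0; lra|apply pow_lt; lra].
Qed.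

Lemma cc_le d m : admissible d -> cc d m <= s0 * d m.
Proof.
  intros (_ & H & _). unfold cc. specialize (H m).
  assert ((/ 2) ^ m <= 1) by (rewrite <- (pow1 m); apply pow_incr; lra).
  assert (0 < s0) by (unfold s0; lra).
  apply Rmult_le_compat_r; nra.
Qed.

Lemma ex_cc d : admissible d -> ex_series (cc d).
Proof.
  intros H. eapply ex_series_dom; [|apply (ex_series_rscal s0 d); apply H].
  intros m. rewrite Rabs_pos_eq; [apply cc_le; auto|left; apply cc_pos; auto].
Qed.

(** Term [m] of [- q'] is compared with the square of term [m + 1] of [q]. After normalisation this
    reads [d m * p <= 4 * d (S m) ^ 2] with [p = 2 ^ (- m)], which follows from the two lower bounds
    in [admissible]. The exponentials compare in the same sense, since [2 * lam (S m) <= lam m]. *)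
Lemma cc_rec d m : admissible d -> cc d m * lam m <= 16 * s0 * cc d (S m) ^ 2.
Proof.
  intros (_ & H0 & H1 & H2 & _). specialize (H1 m). specialize (H2 m). specialize (H0 m).
  assert (Hp : 0 < (/ 2) ^ m) by (apply pow_lt; lra). set (p := (/ 2) ^ m) in *.
  unfold cc. rewrite lam_sqrt. simpl pow. fold p.
  assert (K : d m * p <= 4 * d (S m) ^ 2) by nra.
  assert (S0 : 0 < s0) by (unfold s0; lra).
  replace (s0 * p * d m * (s0 * p * (s0 * p * 1))) with (s0 ^ 3 * p ^ 2 * (d m * p)) by ring.
  replace (16 * s0 * (s0 * (/ 2 * p) * d (S m) * (s0 * (/ 2 * p) * d (S m) * 1))) with (s0 ^ 3 * p ^ 2 * (4 * d (S m) ^ 2)) by field.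
  apply Rmult_le_compat_l; auto. apply Rmult_le_pos; apply pow_le; lra.
Qed.

(** [cc d m / lam m] is the limit at infinity of term [m] of [Hr]. Infinitely many terms of limit at
    least 1 make the height unbounded. *)
Lemma cc_lam_ge d m : admissible d -> 1 <= cc d m / lam m.
Proof.
  intros (_ & _ & _ & H2 & _). specialize (H2 m). pose proof (lam_pos m).
  apply (Rmult_le_reg_r (lam m)); auto. replace (cc d m / lam m * lam m) with (cc d m) by (field; lra).
  rewrite Rmult_1_l, lam_sqrt. unfold cc. assert (Hp : 0 < (/ 2) ^ m) by (apply pow_lt; lra).
  set (p := (/ 2) ^ m) in *.
  replace ((s0 * p) ^ 2) with (s0 * p * (s0 * p)) by ring.
  apply Rmult_le_compat_l; [unfold s0; lra|]. unfold s0. lra.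
Qed.

Lemma amgm_lam m n : 2 * (s0 * (/ 2) ^ n) * (s0 * (/ 2) ^ m) <= lam n + lam m.
Proof. rewrite !lam_sqrt. pose proof (pow2_ge_0 (s0 * (/ 2) ^ n - s0 * (/ 2) ^ m)). nra. Qed.

(** Coefficients of the integral of [q ^ 2 / 3] from [t] to infinity, expanded as a double series of
    exponentials. *)
Definition pc (d : nat -> R) (n m : nat) : R := cc d n * cc d m / (3 * (lam n + lam m)).

Lemma pc_pos d n m : admissible d -> 0 < pc d n m.
Proof.
  intros H. unfold pc. pose proof (lam_pos n). pose proof (lam_pos m).
  apply Rdiv_lt_0_compat; [apply Rmult_lt_0_compat; apply cc_pos; auto|lra].
Qed.

(** [lam n] and [lam m] are squares, so the inequality of means applies to the denominator and the
    scale [s0] cancels: [P] is of order 1 although [q] is of order [s0]. *)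
Lemma pc_le d n m : admissible d -> pc d n m <= / 6 * d n * d m.
Proof.
  intros H. unfold pc. pose proof (lam_pos n). pose proof (lam_pos m). pose proof (amgm_lam m n) as Ha.
  apply (Rmult_le_reg_r (3 * (lam n + lam m))); [lra|].
  replace (cc d n * cc d m / (3 * (lam n + lam m)) * (3 * (lam n + lam m))) with (cc d n * cc d m) by (field; lra).
  unfold cc. destruct H as (_ & Hd & _).
  assert (0 < d n * d m) by (apply Rmult_lt_0_compat; auto).
  replace (s0 * (/ 2) ^ n * d n * (s0 * (/ 2) ^ m * d m)) with (/ 2 * (d n * d m) * (2 * (s0 * (/ 2) ^ n) * (s0 * (/ 2) ^ m))) by field.
  replace (/ 6 * d n * d m * (3 * (lam n + lam m))) with (/ 2 * (d n * d m) * (lam n + lam m)) by field.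
  apply Rmult_le_compat_l; lra.
Qed.

Lemma lam_mono k n : (k <= n)%nat -> lam n <= lam k.
Proof.
  intros H. unfold lam. apply Rmult_le_compat_l; [apply pow2_ge_0|]. replace n with (k + (n - k))%nat by lia.
  rewrite pow_add.
  assert (0 < (/ 4) ^ k) by (apply pow_lt; lra).
  assert ((/ 4) ^ (n - k) <= 1) by (rewrite <- (pow1 (n - k)); apply pow_incr; lra). nra.
Qed.

Lemma cc_exp_ge0 d m t : admissible d -> 0 <= cc d m * exp (- lam m * t).
Proof. intros H. apply Rmult_le_pos; left; [apply cc_pos; auto|apply exp_pos]. Qed.

Lemma pc_exp_ge0 d n m t : admissible d -> 0 <= pc d n m * exp (- (lam n + lam m) * t).
Proof. intros H. apply Rmult_le_pos; left; [apply pc_pos; auto|apply exp_pos]. Qed.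

(* [qr], [Hr], [Pr] are the functions q, H, P of the introduction on the real axis, and [q1 = - q']; [Hc], [Pc] and [Fc]
   are H, P and F on the half plane. *)
Definition qr (d : nat -> R) (t : R) : R := Series (fun m => cc d m * exp (- lam m * t)).
Definition q1 (d : nat -> R) (t : R) : R := Series (fun m => cc d m * lam m * exp (- lam m * t)).
Definition Hr (d : nat -> R) (t : R) : R := Series (fun m => cc d m / lam m * (1 - exp (- lam m * t))).
Definition Pr (d : nat -> R) (t : R) : R :=
  Series (fun n => Series (fun m => pc d n m * exp (- (lam n + lam m) * t))).

Lemma exp_neg_le1 l t : 0 <= l -> 0 <= t -> 0 < exp (- l * t) <= 1.
Proof. intros. split; [apply exp_pos|apply exp_le_1; nra]. Qed.

Lemma ex_mult_exp (a l : nat -> R) t : (forall m, 0 <= a m) -> (forall m, 0 <= l m) -> 0 <= t -> ex_series a ->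
  ex_series (fun m => a m * exp (- l m * t)).
Proof.
  intros Ha Hl Ht H. eapply ex_series_dom; [|apply H]. intros m.
  pose proof (exp_neg_le1 (l m) t (Hl m) Ht). specialize (Ha m). rewrite Rabs_pos_eq; nra.
Qed.

Lemma lam_ge0 m : 0 <= lam m. Proof. left; apply lam_pos. Qed.

Lemma cc_ge0 d m : admissible d -> 0 <= cc d m. Proof. left; apply cc_pos; auto. Qed.

Lemma ex_qr d t : admissible d -> 0 <= t -> ex_series (fun m => cc d m * exp (- lam m * t)).
Proof. intros H Ht. apply ex_mult_exp; auto using lam_ge0, ex_cc. intros; apply cc_ge0; auto. Qed.

Lemma ex_cl d : admissible d -> ex_series (fun m => cc d m * lam m).
Proof.
  intros H. eapply ex_series_dom; [|apply (ex_cc d H)]. intros m.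
  pose proof (lam_le m). pose proof (lam_pos m). pose proof (cc_pos d m H).
  rewrite Rabs_pos_eq by nra. unfold s0 in *. nra.
Qed.

Lemma ex_q1 d t : admissible d -> 0 <= t -> ex_series (fun m => cc d m * lam m * exp (- lam m * t)).
Proof.
  intros H Ht. apply (ex_mult_exp (fun m => cc d m * lam m) lam); auto using lam_ge0, ex_cl.
  intros m. apply Rmult_le_pos; [apply cc_ge0; auto|apply lam_ge0].
Qed.

(** The coefficients [cc d m / lam m] are at least 1, so convergence rests on
    [1 - exp (- x) <= x]. *)
Lemma ex_Hr d t : admissible d -> 0 <= t -> ex_series (fun m => cc d m / lam m * (1 - exp (- lam m * t))).
Proof.
  intros H Ht. eapply ex_series_dom; [|apply (ex_series_rscal t _ (ex_cc d H))]. intros m.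
  pose proof (lam_pos m). pose proof (cc_pos d m H).
  pose proof (exp_neg_le1 (lam m) t (lam_ge0 m) Ht). pose proof (exp_ge_1p (- lam m * t)).
  assert (0 < cc d m / lam m) by (apply Rdiv_lt_0_compat; auto).
  rewrite Rabs_pos_eq by nra.
  replace (t * cc d m) with (cc d m / lam m * (lam m * t)) by (field; lra).
  apply Rmult_le_compat_l; lra.
Qed.

Lemma quad_qr d : admissible d -> quad_diff (qr d) (fun t => - q1 d t) (Series (fun m => Rabs (cc d m) * lam m ^ 2)).
Proof.
  intros H.
  eapply (quad_diff_ext (qr d) (fun t => Series (fun m => cc d m * (- lam m * exp (- lam m * t)))) (qr d) _ _ _ (fun _ => eq_refl)); [|reflexivity|].
  - intros t. simpl. unfold q1. rewrite <- Series_opp. apply Series_ext. intros; ring.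
  - apply (quad_diff_Series (fun m t => cc d m * exp (- lam m * t)) (fun m t => cc d m * (- lam m * exp (- lam m * t)))).
    + intros m. apply quad_diff_scal, quad_diff_exp, lam_ge0.
    + eapply ex_series_dom; [|apply (ex_cl d H)]. intros m. pose proof (lam_le m). pose proof (lam_pos m).
      pose proof (cc_pos d m H).
      rewrite (Rabs_pos_eq (cc d m)) by lra. rewrite Rabs_pos_eq by (apply Rmult_le_pos; [lra|apply pow2_ge_0]).
      replace (lam m ^ 2) with (lam m * lam m) by ring. rewrite <- Rmult_assoc.
      assert (0 < cc d m * lam m) by nra. unfold s0 in *. nra.
    + intros t Ht. apply ex_qr; auto; lra.
    + intros t Ht. eapply ex_series_rext; [|apply (ex_series_rscal (-1) _ (ex_q1 d t H ltac:(lra)))].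
      intros; simpl; ring.
Qed.

Lemma quad_Hr d : admissible d -> quad_diff (Hr d) (qr d) (Series (fun m => Rabs (cc d m / lam m) * lam m ^ 2)).
Proof.
  intros H.
  apply (quad_diff_Series (fun m t => cc d m / lam m * (1 - exp (- lam m * t))) (fun m t => cc d m * exp (- lam m * t))).
  - intros m. pose proof (lam_pos m).
    eapply (quad_diff_ext _ (fun t => cc d m / lam m * (lam m * exp (- lam m * t)))); [reflexivity| |reflexivity|].
    + intros t. field. lra.
    + apply quad_diff_scal. intros t u Ht Hu. pose proof (quad_diff_exp (lam m) (lam_ge0 m) t u Ht Hu) as Q.
      rewrite <- Rabs_Ropp in Q.
      match type of Q with Rabs ?a <= _ => match goal with |- Rabs ?b <= _ => replace b with a by ring end end. auto.
  - eapply ex_series_dom; [|apply (ex_cl d H)]. intros m. pose proof (lam_pos m). pose proof (cc_pos d m H).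
    assert (0 < cc d m / lam m) by (apply Rdiv_lt_0_compat; auto).
    rewrite (Rabs_pos_eq (cc d m / lam m)) by lra. rewrite Rabs_pos_eq by (apply Rmult_le_pos; [lra|apply pow2_ge_0]).
    right. field. lra.
  - intros t Ht. apply ex_Hr; auto; lra.
  - intros t Ht. apply ex_qr; auto; lra.
Qed.

Lemma ex_Pr_in d n t : admissible d -> 0 <= t -> ex_series (fun m => pc d n m * exp (- (lam n + lam m) * t)).
Proof.
  intros H Ht. apply (ex_mult_exp (pc d n) (fun m => lam n + lam m)); auto.
  - intros m. left; apply pc_pos; auto.
  - intros m. pose proof (lam_pos m). pose proof (lam_pos n). lra.
  - eapply ex_series_dom; [|apply (ex_series_rscal (/ 6 * d n) d); apply H]. intros m.
    rewrite Rabs_pos_eq; [apply pc_le; auto|left; apply pc_pos; auto].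
Qed.

Lemma Pr_in_le d n t : admissible d -> 0 <= t ->
  0 <= Series (fun m => pc d n m * exp (- (lam n + lam m) * t)) <= d n.
Proof.
  intros H Ht. split.
  - apply Series_nonneg; [|apply ex_Pr_in; auto]. intros m. apply pc_exp_ge0; auto.
  - assert (Hd : 0 < d n) by apply H.
    apply Rle_trans with (Series (fun m => / 6 * d n * d m)).
    + apply Series_le; [|apply ex_series_rscal; apply H]. intros m.
      pose proof (pc_pos d n m H). pose proof (pc_le d n m H). pose proof (lam_pos m). pose proof (lam_pos n).
      pose proof (exp_neg_le1 (lam n + lam m) t ltac:(lra) Ht). split; nra.
    + rewrite Series_scal_l. assert (Series d <= 6) by apply H. nra.
Qed.

Lemma ex_Pr d t : admissible d -> 0 <= t -> ex_series (fun n => Series (fun m => pc d n m * exp (- (lam n + lam m) * t))).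
Proof.
  intros H Ht. eapply ex_series_dom; [|apply H]. intros n. destruct (Pr_in_le d n t H Ht).
  rewrite Rabs_pos_eq; auto.
Qed.

Lemma pc_mul d n m : pc d n m * (lam n + lam m) = / 3 * cc d n * cc d m.
Proof. unfold pc. pose proof (lam_pos n). pose proof (lam_pos m). field. lra. Qed.

(** Differentiation cancels the denominator of [pc], and the double series factors into two copies
    of [qr]. *)
Lemma Pr_derive_sum d t : admissible d -> 0 <= t ->
  Series (fun n => Series (fun m => pc d n m * (- (lam n + lam m) * exp (- (lam n + lam m) * t)))) = - (/ 3 * qr d t ^ 2).
Proof.
  intros H Ht.
  rewrite (Series_ext _ (fun n => - / 3 * qr d t * (cc d n * exp (- lam n * t)))).
  - rewrite Series_scal_l. fold (qr d t). ring.
  - intros n. rewrite (Series_ext _ (fun m => (- / 3 * (cc d n * exp (- lam n * t))) * (cc d m * exp (- lam m * t)))).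
    + rewrite Series_scal_l. fold (qr d t). ring.
    + intros m. replace (- (lam n + lam m) * t) with (- lam n * t + - lam m * t) by ring. rewrite exp_plus.
      replace (pc d n m * (- (lam n + lam m) * (exp (- lam n * t) * exp (- lam m * t)))) with
        (- (pc d n m * (lam n + lam m)) * (exp (- lam n * t) * exp (- lam m * t))) by ring.
      rewrite pc_mul. ring.
Qed.

Lemma quad_Pr d : admissible d -> exists B, quad_diff (Pr d) (fun t => - (/ 3 * qr d t ^ 2)) B.
Proof.
  intros H.
  assert (Hterm : forall n m, 0 <= Rabs (pc d n m) * (lam n + lam m) ^ 2 <= cc d n * cc d m).
  { intros n m. pose proof (pc_pos d n m H). rewrite Rabs_pos_eq by lra.
    replace (pc d n m * (lam n + lam m) ^ 2) with ((pc d n m * (lam n + lam m)) * (lam n + lam m)) by ring.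
    rewrite pc_mul. pose proof (lam_pos n). pose proof (lam_pos m). pose proof (lam_le n). pose proof (lam_le m).
    pose proof (cc_pos d n H). pose proof (cc_pos d m H). assert (0 < cc d n * cc d m) by nra.
    assert (lam n + lam m <= 1) by (unfold s0 in *; lra). split; nra. }
  assert (Hin : forall n, ex_series (fun m => Rabs (pc d n m) * (lam n + lam m) ^ 2)).
  { intros n. eapply ex_series_dom; [|apply (ex_series_rscal (cc d n) _ (ex_cc d H))]. intros m.
    destruct (Hterm n m). rewrite Rabs_pos_eq; auto. }
  assert (Hder : forall n m t, 0 < t -> Rabs (pc d n m * (- (lam n + lam m) * exp (- (lam n + lam m) * t))) <= cc d n * cc d m).
  { intros n m t Ht. replace (pc d n m * (- (lam n + lam m) * exp (- (lam n + lam m) * t))) with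
       (- ((pc d n m * (lam n + lam m)) * exp (- (lam n + lam m) * t))) by ring.
    rewrite Rabs_Ropp, pc_mul. pose proof (lam_pos n). pose proof (lam_pos m).
    pose proof (exp_neg_le1 (lam n + lam m) t ltac:(lra) ltac:(lra)).
    pose proof (cc_pos d n H). pose proof (cc_pos d m H). assert (0 < cc d n * cc d m) by nra.
    rewrite Rabs_pos_eq by nra. nra. }
  assert (Hcol : forall n, ex_series (fun m => cc d n * cc d m)) by (intros; apply ex_series_rscal, ex_cc; auto).
  assert (Hmin : forall n t, 0 < t -> ex_series (fun m => Rabs (pc d n m * (- (lam n + lam m) * exp (- (lam n + lam m) * t))))).
  { intros n t Ht. eapply ex_series_dom; [|apply (Hcol n)]. intros m. rewrite Rabs_Rabsolu. auto. }
  assert (Hrow : ex_series (fun n => Series (fun m => cc d n * cc d m))).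
  { apply (ex_series_rext (fun n => Series (cc d) * cc d n)); [intros; rewrite Series_scal_l; ring|].
    apply ex_series_rscal, ex_cc; auto. }
  exists (Series (fun n => Series (fun m => Rabs (pc d n m) * (lam n + lam m) ^ 2))).
  assert (Q : quad_diff (Pr d) (fun t => Series (fun n => Series (fun m => pc d n m * (- (lam n + lam m) * exp (- (lam n + lam m) * t)))))
    (Series (fun n => Series (fun m => Rabs (pc d n m) * (lam n + lam m) ^ 2)))).
  { apply (quad_diff_Series (fun n t => Series (fun m => pc d n m * exp (- (lam n + lam m) * t)))
      (fun n t => Series (fun m => pc d n m * (- (lam n + lam m) * exp (- (lam n + lam m) * t))))).
    - intros n. apply (quad_diff_Series (fun m t => pc d n m * exp (- (lam n + lam m) * t))
        (fun m t => pc d n m * (- (lam n + lam m) * exp (- (lam n + lam m) * t)))); auto.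
      + intros m. apply quad_diff_scal, quad_diff_exp. pose proof (lam_pos n). pose proof (lam_pos m). lra.
      + intros t Ht. apply ex_Pr_in; auto; lra.
      + intros t Ht. apply ex_series_Rabs; auto.
    - eapply ex_series_dom; [|apply Hrow]. intros n.
      rewrite Rabs_pos_eq by (apply Series_nonneg; auto; intros; apply Hterm). apply Series_le; auto.
    - intros t Ht. apply ex_Pr; auto; lra.
    - intros t Ht. eapply ex_series_dom; [|apply Hrow]. intros n.
      eapply Rle_trans; [apply Series_Rabs; auto|apply Series_le; auto]. intros m. split; [apply Rabs_pos|auto]. }
  intros t u Ht Hu. specialize (Q t u Ht Hu). cbv beta in Q. rewrite Pr_derive_sum in Q by (auto; lra). auto.
Qed.

Lemma is_derive_qr d t : admissible d -> 0 < t -> is_derive (qr d) t (- q1 d t).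
Proof. intros H Ht. apply (quad_diff_derive _ (fun t => - q1 d t) _ t (quad_qr d H) Ht). Qed.
Lemma is_derive_Hr d t : admissible d -> 0 < t -> is_derive (Hr d) t (qr d t).
Proof. intros H Ht. apply (quad_diff_derive _ (qr d) _ t (quad_Hr d H) Ht). Qed.
Lemma is_derive_Pr d t : admissible d -> 0 < t -> is_derive (Pr d) t (- (/ 3 * qr d t ^ 2)).
Proof. intros H Ht. destruct (quad_Pr d H) as [B HB].
apply (quad_diff_derive _ (fun t => - (/ 3 * qr d t ^ 2)) _ t HB Ht). Qed.

Lemma qr_pos d t : admissible d -> 0 <= t -> 0 < qr d t.
Proof.
  intros H Ht. apply Rlt_le_trans with (cc d 0 * exp (- lam 0 * t)).
  - apply Rmult_lt_0_compat; [apply cc_pos; auto|apply exp_pos].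
  - apply (term_le_Series (fun m => cc d m * exp (- lam m * t)) 0).
    + intros m. apply cc_exp_ge0; auto.
    + apply ex_qr; auto.
Qed.

Lemma qr_le d t : admissible d -> 0 <= t -> qr d t <= 6 * s0.
Proof.
  intros H Ht. apply Rle_trans with (Series (fun m => s0 * d m)).
  - apply Series_le; [|apply ex_series_rscal; apply H]. intros m.
    pose proof (exp_neg_le1 (lam m) t (lam_ge0 m) Ht). pose proof (cc_pos d m H). pose proof (cc_le d m H).
    split; nra.
  - rewrite Series_scal_l. assert (Series d <= 6) by apply H. unfold s0. lra.
Qed.

Lemma Series_sq_le x : (forall m, 0 <= x m) -> ex_series x -> ex_series (fun m => x m ^ 2) /\ Series (fun m => x m ^ 2) <= Series x ^ 2.
Proof.
  intros H0 Hx.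
  assert (Hm : forall m, 0 <= x m ^ 2 <= Series x * x m).
  { intros m. split; [apply pow2_ge_0|]. pose proof (term_le_Series x m H0 Hx). specialize (H0 m). nra. }
  assert (He : ex_series (fun m => Series x * x m)) by (apply ex_series_rscal; auto).
  split.
  - eapply ex_series_dom; [|apply He]. intros m. destruct (Hm m). rewrite Rabs_pos_eq; auto.
  - eapply Rle_trans; [apply Series_le; [apply Hm|auto]|]. rewrite Series_scal_l. right; ring.
Qed.

Lemma cc_exp_rec d m t : admissible d -> 0 <= t ->
  cc d m * lam m * exp (- lam m * t) <= 16 * s0 * (cc d (S m) * exp (- lam (S m) * t)) ^ 2.
Proof.
  intros H Ht. pose proof (cc_rec d m H). pose proof (lam_S m). pose proof (lam_pos (S m)).
  rewrite Rpow_mult_distr. replace (exp (- lam (S m) * t) ^ 2) with (exp (- (2 * lam (S m)) * t)).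
  2:{ simpl. rewrite Rmult_1_r, <- exp_plus. f_equal. ring. }
  rewrite <- Rmult_assoc. apply Rmult_le_compat; auto.
  - apply Rmult_le_pos; [apply cc_ge0; auto|apply lam_ge0].
  - left; apply exp_pos.
  - apply exp_mono. nra.
Qed.

(* This is what makes the channel width vary slowly along the spiral. *)
Lemma q1_le d t : admissible d -> 0 <= t -> 0 <= q1 d t <= 16 * s0 * qr d t ^ 2.
Proof.
  intros H Ht.
  assert (H0 : forall m, 0 <= cc d m * exp (- lam m * t)) by (intros; apply cc_exp_ge0; auto).
  assert (H1 : forall m, 0 <= cc d m * lam m * exp (- lam m * t)).
  { intros m. apply Rmult_le_pos; [apply Rmult_le_pos; [apply cc_ge0; auto|apply lam_ge0]|left; apply exp_pos]. }
  destruct (Series_sq_le _ H0 (ex_qr d t H Ht)) as [S1 S2]. fold (qr d t) in S2.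
  split; [apply Series_nonneg; auto; apply ex_q1; auto|].
  set (x := fun m => (cc d m * exp (- lam m * t)) ^ 2) in *.
  assert (S3 : ex_series (fun m => x (S m))) by (apply (ex_series_incr_1 x); auto).
  apply Rle_trans with (Series (fun m => 16 * s0 * x (S m))).
  - apply Series_le; [|apply ex_series_rscal; auto]. intros m. split; auto. apply cc_exp_rec; auto.
  - rewrite Series_scal_l. apply Rmult_le_compat_l; [unfold s0; lra|].
    rewrite Series_incr_1 in S2 by auto. assert (0 <= x 0%nat) by apply pow2_ge_0. lra.
Qed.

(** The diagonal of [P] is enough: its term [m + 1] dominates term [m] of [q], by [cc_exp_rec]. With
    the value of [s0], [P] exceeds 200 times [q], so the distance from the channel to the imaginary
    axis is large compared with its width. *)
Lemma Pr_ge_qr d t : admissible d -> 0 <= t -> qr d t / (48 * s0) <= Pr d t.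
Proof.
  intros H Ht.
  set (x := fun m => (cc d m * exp (- lam m * t)) ^ 2).
  assert (Hx : forall n, x n / (6 * lam n) <= Series (fun m => pc d n m * exp (- (lam n + lam m) * t))).
  { intros n. pose proof (lam_pos n).
    eapply Rle_trans; [|apply (term_le_Series (fun m => pc d n m * exp (- (lam n + lam m) * t)) n)].
    - right. unfold pc, x. replace (- (lam n + lam n) * t) with (- lam n * t + - lam n * t) by ring. rewrite exp_plus.
      field. lra.
    - intros m. apply pc_exp_ge0; auto.
    - apply ex_Pr_in; auto. }
  set (P := fun n => Series (fun m => pc d n m * exp (- (lam n + lam m) * t))) in *.
  assert (HP : ex_series P) by (apply ex_Pr; auto).
  assert (HPS : ex_series (fun n => P (S n))) by (apply (ex_series_incr_1 P); auto).
  unfold Rdiv. rewrite Rmult_comm. unfold qr. rewrite <- Series_scal_l.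
  apply Rle_trans with (Series (fun n => P (S n))).
  - apply Series_le; auto. intros m.
    assert (S0 : 0 < s0) by (unfold s0; lra).
    assert (0 < cc d m * exp (- lam m * t)) by (apply Rmult_lt_0_compat; [apply cc_pos; auto|apply exp_pos]).
    assert (0 < / (48 * s0)) by (apply Rinv_0_lt_compat; lra).
    split; [nra|]. eapply Rle_trans; [|apply Hx].
    pose proof (cc_exp_rec d m t H Ht) as K. fold (x (S m)) in K. pose proof (lam_S m). pose proof (lam_pos (S m)).
    apply (Rmult_le_reg_r (6 * lam (S m) * (16 * s0))); [nra|].
    replace (x (S m) / (6 * lam (S m)) * (6 * lam (S m) * (16 * s0))) with (16 * s0 * x (S m)) by (field; lra).
    eapply Rle_trans; [|apply K]. rewrite <- (lam_S m).
    replace (/ (48 * s0) * (cc d m * exp (- (4 * lam (S m)) * t)) * (6 * lam (S m) * (16 * s0))) with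
      (2 * lam (S m) * (cc d m * exp (- (4 * lam (S m)) * t))) by (field; lra).
    rewrite lam_S. nra.
  - unfold Pr. fold P. rewrite (Series_incr_1 P) by auto.
    assert (0 <= P 0%nat) by (apply Pr_in_le; auto). lra.
Qed.

(** The diagonal coefficient [pc d m m] equals [d m ^ 2 / 6]. A single large [d m] thus holds [P] up
    until a time of order [1 / lam m]; the decay of [P] is prescribed through this bound. *)
Lemma Pr_ge_term d m t : admissible d -> 0 <= t -> / 6 * d m ^ 2 * exp (- (2 * lam m) * t) <= Pr d t.
Proof.
  intros H Ht.
  eapply Rle_trans; [|apply (term_le_Series (fun n => Series (fun m => pc d n m * exp (- (lam n + lam m) * t))) m)].
  - eapply Rle_trans; [|apply (term_le_Series (fun k => pc d m k * exp (- (lam m + lam k) * t)) m)].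
    + right. replace (lam m + lam m) with (2 * lam m) by ring. f_equal. unfold pc.
      rewrite lam_sqrt. unfold cc. assert (0 < (/ 2) ^ m) by (apply pow_lt; lra). set (p := (/ 2) ^ m) in *.
      assert (0 < s0) by (unfold s0; lra). assert (0 < s0 * p) by (apply Rmult_lt_0_compat; auto). field. nra.
    + intros k. apply pc_exp_ge0; auto.
    + apply ex_Pr_in; auto.
  - intros n. apply Pr_in_le; auto.
  - apply ex_Pr; auto.
Qed.

Lemma Pr_lim d eps : admissible d -> 0 < eps -> exists T, 0 < T /\ forall t, T <= t -> Pr d t < eps.
Proof.
  intros H He.
  assert (Hd0 : forall k, 0 <= d k) by (intros; left; apply H).
  assert (Hd : ex_series d) by apply H. assert (Hd6 : Series d <= 6) by apply H.
  (* Pr d t is bounded by S t ^ 2 / 6, where S t = sum of d n exp (- lam n t) *)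
  destruct (tail_small d Hd Hd0 (Rmin (eps / 4) (1/4))) as [N HN]; [apply Rmin_pos; lra|].
  specialize (HN N (Nat.le_refl N)). set (tl := Series (fun k => d (N + k)%nat)) in *.
  assert (Htl : tl < eps / 4) by (pose proof (Rmin_l (eps / 4) (1/4)); lra).
  pose proof (lam_pos N) as HlN.
  (* [y] will bound the exponentials of the first [N] terms, and [tl] bounds the others. In the
     final product one factor [Series e] is below 7 and the other below [eps / 2]. *)
  set (y := Rmin (eps / 32) 1). assert (Hy : 0 < y <= 1) by (split; [apply Rmin_pos; lra|apply Rmin_r]).
  exists (1 + Rabs (ln y) / lam N). split.
  { assert (0 <= Rabs (ln y) / lam N) by (apply Rmult_le_pos; [apply Rabs_pos|left; apply Rinv_0_lt_compat; auto]).
    lra. }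
  intros t Ht.
  assert (Ht1 : ln y >= - lam N * t).
  { assert (Hl : ln y <= 0) by (rewrite <- ln_1; destruct (Req_dec y 1) as [ ->|]; [lra|left; apply ln_increasing; lra]).
    rewrite Rabs_left1 in Ht by auto.
    apply (Rmult_le_compat_l (lam N)) in Ht; [|lra].
    replace (lam N * (1 + - ln y / lam N)) with (lam N - ln y) in Ht by (field; lra). lra. }
  assert (Hey : exp (- lam N * t) <= y) by (rewrite <- (exp_ln y) by lra; apply exp_mono; lra).
  assert (Ht0 : 0 <= t).
  { assert (0 <= Rabs (ln y) / lam N) by (apply Rmult_le_pos; [apply Rabs_pos|left; apply Rinv_0_lt_compat; auto]).
    lra. }
  set (e := fun n => d n * exp (- lam n * t)).
  assert (He0 : forall n, 0 <= e n) by (intros; apply Rmult_le_pos; [auto|left; apply exp_pos]).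
  assert (Hes : ex_series e) by (apply ex_mult_exp; auto using lam_ge0).
  assert (HS : Series e <= 6 * y + tl).
  { rewrite (Series_incr_rsum e N Hes). apply Rplus_le_compat.
    - apply Rle_trans with (rsum (fun k => y * d k) N).
      + apply rsum_le. intros k Hk. unfold e. rewrite Rmult_comm. apply Rmult_le_compat_r; auto.
        eapply Rle_trans; [|apply Hey]. apply exp_mono.
        pose proof (lam_mono k N ltac:(lia)).
        nra.
      + rewrite rsum_scal. pose proof (rsum_le_Series d N Hd0 Hd). nra.
    - apply Series_le.
      + intros n. split; auto. unfold e. pose proof (exp_neg_le1 (lam (N + n)) t (lam_ge0 _) Ht0).
        specialize (Hd0 (N + n)%nat). nra.
      + apply (ex_series_incr_n d N); auto. }
  assert (HSp : 0 <= Series e) by (apply Series_nonneg; auto).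
  assert (Hfin : Pr d t <= / 6 * Series e * Series e).
  { unfold Pr. rewrite <- (Series_scal_l (/ 6 * Series e)). apply Series_le; [|apply ex_series_rscal; auto]. intros n.
    split; [apply Pr_in_le; auto|].
    replace (/ 6 * Series e * e n) with (/ 6 * e n * Series e) by ring. rewrite <- Series_scal_l.
    apply Series_le; [|apply ex_series_rscal; auto]. intros m. split.
    - apply pc_exp_ge0; auto.
    - unfold e. replace (- (lam n + lam m) * t) with (- lam n * t + - lam m * t) by ring. rewrite exp_plus.
      replace (/ 6 * (d n * exp (- lam n * t)) * (d m * exp (- lam m * t))) with (/ 6 * d n * d m * (exp (- lam n * t) * exp (- lam m * t))) by ring.
      apply Rmult_le_compat_r; [apply Rmult_le_pos; left; apply exp_pos|apply pc_le; auto]. }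
  assert (Hye : y <= eps / 32) by apply Rmin_l.
  assert (tl <= 1/4) by (pose proof (Rmin_r (eps / 4) (1/4)); lra).
  nra.
Qed.

(** Once [t] exceeds [1 / lam N], each of the first [N] terms is at least 1/2. *)
Lemma Hr_lim d M : admissible d -> exists T, 0 < T /\ forall t, T <= t -> M <= Hr d t.
Proof.
  intros H.
  destruct (INR_archimed 1 (2 * Rabs M)) as [N HN]; [lra|].
  pose proof (lam_pos N) as HlN.
  exists (/ lam N). split; [apply Rinv_0_lt_compat; auto|]. intros t Ht.
  assert (Ht0 : 0 <= t) by (assert (0 < / lam N) by (apply Rinv_0_lt_compat; auto); lra).
  assert (Hge : forall m, 0 <= cc d m / lam m * (1 - exp (- lam m * t))).
  { intros m. pose proof (exp_neg_le1 (lam m) t (lam_ge0 m) Ht0). pose proof (cc_lam_ge d m H).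
    apply Rmult_le_pos; lra. }
  eapply Rle_trans; [|apply (rsum_le_Series _ N Hge (ex_Hr d t H Ht0))].
  apply Rle_trans with (rsum (fun _ => / 2) N).
  - assert (E : forall n, rsum (fun _ => / 2) n = INR n * / 2).
    { induction n; [simpl; ring|]. rewrite S_INR. simpl rsum. rewrite IHn. ring. }
    rewrite E. pose proof (Rle_abs M). lra.
  - apply rsum_le. intros k Hk.
    pose proof (lam_mono k N ltac:(lia)) as Hl.
    assert (Hk1 : 1 <= lam k * t).
    { apply (Rmult_le_compat_l (lam N)) in Ht; [|lra]. rewrite Rinv_r in Ht by lra. nra. }
    assert (Hex : exp (- lam k * t) <= / 2).
    { replace (- lam k * t) with (- (lam k * t)) by ring. rewrite exp_Ropp. apply Rinv_le_contravar; [lra|].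
      pose proof (exp_ge_1p (lam k * t)). lra. }
    pose proof (cc_lam_ge d k H). nra.
Qed.

(** * Extension of H, P and F to the right half plane *)

Lemma CS_RtoC a : CS (fun n => RtoC (a n)) = RtoC (Series a).
Proof.
  apply injective_projections; simpl; [reflexivity|].
  rewrite (Series_ext _ (fun n => 0 * 0)); [|intros; simpl; ring]. rewrite Series_scal_l. ring.
Qed.

Lemma summable_RtoC a : (forall n, 0 <= a n) -> ex_series a -> summable (fun n => RtoC (a n)).
Proof. intros H. apply ex_series_rext. intros n. rewrite Cmod_R, Rabs_pos_eq; auto. Qed.

Lemma cexp_contr w : 0 <= Re w -> Cmod (1 - cexp (- w)) <= 2 * Cmod w.
Proof.
  intros Hw. destruct (Rle_dec (Cmod w) 1) as [H|H].
  - rewrite <- Cmod_opp. replace (- (1 - cexp (- w)))%C with (cexp (- w) - 1)%C by ring.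
    rewrite <- (Cmod_opp w). apply cexp_minus1. rewrite Cmod_opp; auto.
  - unfold Cminus. eapply Rle_trans; [apply Cmod_triangle|]. rewrite Cmod_1, Cmod_opp, Cmod_cexp, re_opp.
    pose proof (exp_le_1 (- Re w) ltac:(lra)). lra.
Qed.

Lemma Cmod_cexp_neg l w : 0 <= l -> 0 <= Re w -> Cmod (cexp (RtoC (- l) * w)) <= 1.
Proof. intros Hl Hw. rewrite Cmod_cexp, re_scal_l. apply exp_le_1. nra. Qed.

Definition Hterm (d : nat -> R) (w : C) (m : nat) : C := (RtoC (cc d m / lam m) * (1 - cexp (RtoC (- lam m) * w)))%C.
Definition Hc (d : nat -> R) (w : C) : C := CS (Hterm d w).
Definition Pterm (d : nat -> R) (n : nat) (w : C) (m : nat) : C :=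
  (RtoC (pc d n m) * cexp (RtoC (- (lam n + lam m)) * w))%C.
Definition Pin (d : nat -> R) (n : nat) (w : C) : C := CS (Pterm d n w).
Definition Pc (d : nat -> R) (w : C) : C := CS (fun n => Pin d n w).
Definition Fc (d : nat -> R) (w : C) : C := (Pc d w + Ci * Hc d w)%C.

Lemma Hterm_le d w m : admissible d -> 0 <= Re w -> Cmod (Hterm d w m) <= 2 * Cmod w * cc d m.
Proof.
  intros H Hw. pose proof (lam_pos m). pose proof (cc_pos d m H).
  unfold Hterm. rewrite Cmod_mult, Cmod_R.
  assert (0 < cc d m / lam m) by (apply Rdiv_lt_0_compat; auto). rewrite Rabs_pos_eq by lra.
  replace (RtoC (- lam m) * w)%C with (- (lam m * w))%C by (rewrite RtoC_opp; ring).
  pose proof (cexp_contr (lam m * w) ltac:(rewrite re_scal_l; nra)) as K.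
  rewrite Cmod_mult, Cmod_R, Rabs_pos_eq in K by lra.
  apply Rle_trans with (cc d m / lam m * (2 * (lam m * Cmod w))).
  - apply Rmult_le_compat_l; lra.
  - right. field. lra.
Qed.

Lemma summable_Hterm d w : admissible d -> 0 <= Re w -> summable (Hterm d w).
Proof. intros H Hw. eapply summable_dom; [intros m; apply Hterm_le; auto|]. apply ex_series_rscal, ex_cc; auto. Qed.

Lemma Pterm_le d n w m : admissible d -> 0 <= Re w -> Cmod (Pterm d n w m) <= / 6 * d n * d m.
Proof.
  intros H Hw. unfold Pterm. rewrite Cmod_mult, Cmod_R, Rabs_pos_eq by (left; apply pc_pos; auto).
  pose proof (lam_pos n). pose proof (lam_pos m).
  pose proof (Cmod_cexp_neg (lam n + lam m) w ltac:(lra) Hw). pose proof (pc_le d n m H). pose proof (pc_pos d n m H).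
  nra.
Qed.

Lemma summable_Pterm d n w : admissible d -> 0 <= Re w -> summable (Pterm d n w).
Proof. intros H Hw. eapply summable_dom; [intros m; apply Pterm_le; auto|]. apply ex_series_rscal, H. Qed.

Lemma Pin_le d n w : admissible d -> 0 <= Re w -> Cmod (Pin d n w) <= d n.
Proof.
  intros H Hw. eapply Rle_trans; [apply CS_le; [intros m; apply Pterm_le; auto|apply ex_series_rscal, H]|].
  rewrite Series_scal_l. assert (Series d <= 6) by apply H. assert (0 < d n) by apply H. nra.
Qed.

Lemma summable_Pin d w : admissible d -> 0 <= Re w -> summable (fun n => Pin d n w).
Proof. intros H Hw. eapply summable_dom; [intros n; apply Pin_le; auto|]. apply H. Qed.

Lemma Hc_real d t : Hc d (RtoC t) = RtoC (Hr d t).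
Proof.
  unfold Hc, Hr. rewrite <- CS_RtoC. apply CS_ext. intros m. unfold Hterm.
  rewrite <- RtoC_mult, cexp_RtoC, <- RtoC_minus, <- RtoC_mult. reflexivity.
Qed.

Lemma Pc_real d t : Pc d (RtoC t) = RtoC (Pr d t).
Proof.
  unfold Pc, Pr. rewrite <- CS_RtoC. apply CS_ext. intros n. unfold Pin. rewrite <- CS_RtoC. apply CS_ext. intros m.
  unfold Pterm. rewrite <- RtoC_mult, cexp_RtoC, <- RtoC_mult. reflexivity.
Qed.

Lemma exp_local l (t : R) w w' : 0 <= l <= 1 / 100 -> Cmod (w - t) <= 4 -> Cmod (w' - t) <= 4 ->
  Cmod (cexp (RtoC (- l) * w) - cexp (RtoC (- l) * w') + RtoC (exp (- l * t)) * (l * (w - w')))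
    <= exp (- l * t) * (24 * l * (l * Cmod (w - w'))).
Proof.
  intros Hl Hw Hw'.
  set (u := (w - t)%C) in *. set (u' := (w' - t)%C) in *.
  assert (Ew : forall v, cexp (RtoC (- l) * v) = (RtoC (exp (- l * t)) * cexp (RtoC (- l) * (v - t)))%C).
  { intros v. rewrite <- cexp_RtoC, <- cexp_plus. f_equal. rewrite RtoC_mult. ring. }
  rewrite (Ew w), (Ew w'). fold u u'.
  replace (w - w')%C with (u - u')%C by (unfold u, u'; ring).
  set (v := (l * (u - u'))%C).
  assert (Ev : cexp (RtoC (- l) * u) = (cexp (RtoC (- l) * u') * cexp (- v))%C).
  { rewrite <- cexp_plus. f_equal. unfold v. rewrite RtoC_opp. ring. }
  rewrite Ev. set (e' := cexp (RtoC (- l) * u')).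
  (* With [exp (- l * t)] factored out, the error is a product of two small factors plus a
     second-order Taylor remainder, at most [8 l * 2 |v| + |v| ^ 2]; since [|v| <= 8 l], the
     constant is 24. *)
  match goal with |- Cmod ?x <= _ => replace x with (exp (- l * t) * ((e' - 1) * (cexp (- v) - 1) + (cexp (- v) - 1 - - v)))%C by (unfold v; ring) end.
  rewrite Cmod_mult, Cmod_R, (Rabs_pos_eq (exp _)) by (left; apply exp_pos).
  apply Rmult_le_compat_l; [left; apply exp_pos|].
  assert (Huu : Cmod (u - u') <= 8).
  { unfold Cminus. eapply Rle_trans; [apply Cmod_triangle|]. rewrite Cmod_opp. lra. }
  assert (Hv : Cmod v = l * Cmod (u - u')) by (unfold v; rewrite Cmod_mult, Cmod_R, Rabs_pos_eq; lra).
  rewrite <- Hv.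
  assert (Hv8 : Cmod v <= 8 * l) by (rewrite Hv; nra).
  pose proof (cexp_minus1 (- v) ltac:(rewrite Cmod_opp; lra)) as K1. rewrite Cmod_opp in K1.
  pose proof (cexp_taylor (- v) ltac:(rewrite Cmod_opp; lra)) as K2. rewrite Cmod_opp in K2.
  assert (K3 : Cmod (e' - 1) <= 8 * l).
  { unfold e'. eapply Rle_trans; [apply cexp_minus1|]; rewrite Cmod_mult, Cmod_R, Rabs_Ropp, Rabs_pos_eq by lra; nra. }
  eapply Rle_trans; [apply Cmod_triangle|]. rewrite Cmod_mult.
  pose proof (Cmod_ge_0 (cexp (- v) - 1)).
  nra.
Qed.

(** The error in term [m] is at most [24 * lam m] times the corresponding term of [q], up to the
    factor [Cmod (w - w')]. All terms of [q] are positive, so a relative error survives the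
    summation. *)
Lemma Hc_local d (t : R) w w' : admissible d -> 0 <= t -> 0 <= Re w -> 0 <= Re w' ->
  Cmod (w - t) <= 4 -> Cmod (w' - t) <= 4 ->
  Cmod (Hc d w - Hc d w' - qr d t * (w - w')) <= 24 * s0 ^ 2 * Cmod (w - w') * qr d t.
Proof.
  intros H Ht Hw Hw' Dw Dw'.
  assert (Hq : (qr d t * (w - w'))%C = CS (fun m => (w - w') * RtoC (cc d m * exp (- lam m * t)))%C).
  { rewrite CS_scal, CS_RtoC; [unfold qr; ring|]. apply summable_RtoC; [|apply ex_qr; auto].
    intros m. apply cc_exp_ge0; auto. }
  assert (Sq : summable (fun m => (w - w') * RtoC (cc d m * exp (- lam m * t)))%C).
  { apply summable_scal, summable_RtoC; [|apply ex_qr; auto].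
    intros m. apply cc_exp_ge0; auto. }
  rewrite Hq. unfold Hc.
  rewrite <- CS_minus by (apply summable_Hterm; auto).
  rewrite <- CS_minus by (auto; apply summable_minus; apply summable_Hterm; auto).
  unfold qr. rewrite <- Series_scal_l. apply CS_le; [|apply ex_series_rscal, ex_qr; auto].
  intros m. pose proof (lam_pos m). pose proof (lam_le m). pose proof (cc_pos d m H).
  pose proof (exp_local (lam m) t w w' ltac:(unfold s0 in *; lra) Dw Dw') as K.
  assert (Hl : RtoC (lam m) <> 0) by (intros E; apply RtoC_inj in E; lra).
  match goal with |- Cmod ?x <= _ => replace x with (- (RtoC (cc d m / lam m) *
    (cexp (RtoC (- lam m) * w) - cexp (RtoC (- lam m) * w') + RtoC (exp (- lam m * t)) * (lam m * (w - w')))))%C end.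
  2:{ unfold Hterm. rewrite RtoC_mult, RtoC_div by lra. field. auto. }
  assert (0 < cc d m / lam m) by (apply Rdiv_lt_0_compat; auto).
  rewrite Cmod_opp, Cmod_mult, Cmod_R, Rabs_pos_eq by lra.
  eapply Rle_trans; [apply Rmult_le_compat_l; [lra|apply K]|].
  replace (cc d m / lam m * (exp (- lam m * t) * (24 * lam m * (lam m * Cmod (w - w'))))) with
    (lam m * (24 * Cmod (w - w') * (cc d m * exp (- lam m * t)))) by (field; lra).
  replace (24 * s0 ^ 2 * Cmod (w - w') * (cc d m * exp (- lam m * t))) with (s0 ^ 2 * (24 * Cmod (w - w') * (cc d m * exp (- lam m * t)))) by ring.
  apply Rmult_le_compat_r; auto. pose proof (Cmod_ge_0 (w - w')). pose proof (exp_pos (- lam m * t)).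
  apply Rmult_le_pos; [lra|]. apply Rmult_le_pos; lra.
Qed.

(** [P'] is of order [q ^ 2], and [q <= 6 * s0]; at unit scale the variation of [P] is therefore a
    small fraction of [q]. *)
Lemma Pc_local d (t : R) w w' : admissible d -> 0 <= t -> 0 <= Re w -> 0 <= Re w' ->
  Cmod (w - t) <= 4 -> Cmod (w' - t) <= 4 ->
  Cmod (Pc d w - Pc d w') <= 4 * s0 * Cmod (w - w') * qr d t.
Proof.
  intros H Ht Hw Hw' Dw Dw'. unfold Pc. rewrite <- CS_minus by (apply summable_Pin; auto).
  set (D := Cmod (w - w')). assert (HD : 0 <= D) by apply Cmod_ge_0.
  pose proof (qr_pos d t H Ht) as Hq. pose proof (qr_le d t H Ht) as Hq6.
  apply Rle_trans with (2 / 3 * D * qr d t * qr d t).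
  - unfold qr at 2. rewrite <- Series_scal_l. apply CS_le; [|apply ex_series_rscal, ex_qr; auto].
    intros n. unfold Pin. rewrite <- CS_minus by (apply summable_Pterm; auto).
    replace (2 / 3 * D * qr d t * (cc d n * exp (- lam n * t))) with (2 / 3 * D * (cc d n * exp (- lam n * t)) * qr d t) by ring.
    unfold qr. rewrite <- Series_scal_l. apply CS_le; [|apply ex_series_rscal, ex_qr; auto].
    intros m. pose proof (lam_pos m). pose proof (lam_le m). pose proof (lam_pos n). pose proof (lam_le n).
    set (mu := lam n + lam m). assert (Hmu : 0 <= mu <= 1 / 100) by (unfold mu, s0 in *; lra).
    pose proof (exp_local mu t w w' Hmu Dw Dw') as K. fold D in K.
    unfold Pterm. fold mu.
    match goal with |- Cmod ?x <= _ => replace x with (RtoC (pc d n m) *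
      (cexp (RtoC (- mu) * w) - cexp (RtoC (- mu) * w')))%C by ring end.
    rewrite Cmod_mult, Cmod_R, Rabs_pos_eq by (left; apply pc_pos; auto).
    assert (Hm : Cmod (cexp (RtoC (- mu) * w) - cexp (RtoC (- mu) * w')) <= exp (- mu * t) * (2 * mu * D)).
    { set (A := (cexp (RtoC (- mu) * w) - cexp (RtoC (- mu) * w'))%C) in *.
      set (X := (RtoC (exp (- mu * t)) * (mu * (w - w')))%C) in *.
      replace A with ((A + X) + - X)%C by ring. eapply Rle_trans; [apply Cmod_triangle|].
      rewrite Cmod_opp. unfold X at 2.
      rewrite !Cmod_mult, !Cmod_R, (Rabs_pos_eq (exp _)), (Rabs_pos_eq mu) by (try (left; apply exp_pos); lra).
      fold D. pose proof (exp_pos (- mu * t)) as Hp.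
      assert (24 * mu * (mu * D) <= mu * D) by (assert (0 <= mu * D) by (apply Rmult_le_pos; lra); nra).
      assert (exp (- mu * t) * (24 * mu * (mu * D)) <= exp (- mu * t) * (mu * D)) by (apply Rmult_le_compat_l; lra).
      lra. }
    eapply Rle_trans; [apply Rmult_le_compat_l; [left; apply pc_pos; auto|apply Hm]|].
    right. replace (- mu * t) with (- lam n * t + - lam m * t) by (unfold mu; ring). rewrite exp_plus.
    replace (pc d n m * (exp (- lam n * t) * exp (- lam m * t) * (2 * mu * D))) with
      ((pc d n m * mu) * (2 * D) * (exp (- lam n * t) * exp (- lam m * t))) by ring.
    unfold mu. rewrite pc_mul. field.
  - replace (2 / 3 * D * qr d t * qr d t) with (2 / 3 * qr d t * (D * qr d t)) by ring.
    replace (4 * s0 * D * qr d t) with (4 * s0 * (D * qr d t)) by ring.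
    apply Rmult_le_compat_r; [apply Rmult_le_pos; lra|]. lra.
Qed.

(* [F] is, at unit scale, a similarity of ratio [i q(t)]. *)
Lemma Fc_local d (t : R) w w' : admissible d -> 0 <= t -> 0 <= Re w -> 0 <= Re w' ->
  Cmod (w - t) <= 4 -> Cmod (w' - t) <= 4 ->
  Cmod (Fc d w - Fc d w' - Ci * qr d t * (w - w')) <= / 100 * qr d t * Cmod (w - w').
Proof.
  intros H Ht Hw Hw' Dw Dw'.
  pose proof (Hc_local d t w w' H Ht Hw Hw' Dw Dw') as K1.
  pose proof (Pc_local d t w w' H Ht Hw Hw' Dw Dw') as K2.
  unfold Fc.
  replace (Pc d w + Ci * Hc d w - (Pc d w' + Ci * Hc d w') - Ci * qr d t * (w - w'))%C with
    ((Pc d w - Pc d w') + Ci * (Hc d w - Hc d w' - qr d t * (w - w')))%C by ring.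
  eapply Rle_trans; [apply Cmod_triangle|]. rewrite Cmod_mult, Cmod_Ci.
  pose proof (Cmod_ge_0 (w - w')). pose proof (qr_pos d t H Ht).
  unfold s0 in *. nra.
Qed.

Lemma Fc_real d t : Fc d (RtoC t) = (Pr d t, Hr d t).
Proof. unfold Fc. rewrite Pc_real, Hc_real. unfold Ci, Cmult, Cplus, RtoC; simpl. f_equal; ring. Qed.

(* With [w = t + i s], this reads [F w = P t - s q t + i H t + O(q t / 50)]. *)
Lemma Fc_cross d w : admissible d -> 0 <= Re w -> Rabs (Im w) <= 2 ->
  Rabs (Re (Fc d w) - (Pr d (Re w) - qr d (Re w) * Im w)) <= / 50 * qr d (Re w) /\
  Rabs (Im (Fc d w) - Hr d (Re w)) <= / 50 * qr d (Re w).
Proof.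
  intros H Hw Hs. set (t := Re w) in *. set (s := Im w) in *.
  assert (E : (w - t)%C = (Ci * s)%C) by (apply injective_projections; unfold t, s, Ci, Cminus, Cplus, Copp, Cmult, RtoC, Re, Im; simpl; ring).
  assert (Em : Cmod (w - t) = Rabs s) by (rewrite E, Cmod_mult, Cmod_Ci, Cmod_R; ring).
  pose proof (Fc_local d t w t H Hw Hw Hw ltac:(lra) ltac:(unfold Cminus; rewrite Cplus_opp_r, Cmod_0; lra)) as K.
  rewrite Em, Fc_real in K. rewrite E in K.
  replace (Ci * qr d t * (Ci * s))%C with (RtoC (- (qr d t * s))) in K.
  2:{ unfold Ci, Cmult, RtoC; apply injective_projections; simpl; ring. }
  pose proof (qr_pos d t H Hw).
  assert (K' : Cmod (Fc d w - (Pr d t, Hr d t) - RtoC (- (qr d t * s))) <= / 50 * qr d t) by nra.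
  split; (eapply Rle_trans; [|apply K']).
  - eapply Rle_trans; [|apply re_le_Cmod]. right. f_equal. simpl. unfold Re. simpl. ring.
  - eapply Rle_trans; [|apply im_le_Cmod]. right. f_equal. simpl. unfold Im. simpl. ring.
Qed.

Lemma Analytic_Fc_zeta d : admissible d -> Analytic (fun z => Fc d (zeta z)).
Proof.
  intros H.
  assert (Hexp : forall l, Analytic (fun z => cexp (RtoC (- l) * zeta z))).
  { intros l. apply (Analytic_cexp (fun z => RtoC (- l) * zeta z)%C), Analytic_scal, Analytic_zeta. }
  assert (Hz : forall r z, 0 < r < 1 -> Cmod z = r -> 0 <= Re (zeta z)).
  { intros r z Hr Hz. left. apply Re_zeta_pos. lra. }
  unfold Fc. apply Analytic_plus.
  - unfold Pc. apply (Analytic_sum (fun n z => Pin d n (zeta z))).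
    + intros n. unfold Pin. apply (Analytic_sum (fun m z => Pterm d n (zeta z) m)).
      * intros m. unfold Pterm. apply Analytic_scal, Hexp.
      * intros r Hr. exists (fun m => / 6 * d n * d m). split; [apply ex_series_rscal, H|].
        intros m z Hm. apply Pterm_le; eauto.
    + intros r Hr. exists d. split; [apply H|]. intros n z Hm. apply Pin_le; eauto.
  - apply Analytic_scal. unfold Hc. apply (Analytic_sum (fun m z => Hterm d (zeta z) m)).
    + intros m. unfold Hterm. apply Analytic_scal.
      apply (Analytic_ext (fun z => 1 + (-1) * cexp (RtoC (- lam m) * zeta z))%C); [intros; ring|].
      apply Analytic_plus; [apply Analytic_const|]. apply Analytic_scal, Hexp.
    + intros r Hr. destruct Analytic_zeta as [a Ha]. destruct (PS_bounded a zeta r Ha ltac:(lra)) as [Bd [HB0 HB]].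
      exists (fun m => 2 * Bd * cc d m). split; [apply ex_series_rscal, ex_cc; auto|].
      intros m z Hm. eapply Rle_trans; [apply Hterm_le; eauto|].
      apply Rmult_le_compat_r; [apply cc_ge0; auto|]. specialize (HB z ltac:(lra)). lra.
Qed.

(** For the upper bound, [cos (16 / 10)] is negative by its alternating Taylor sum up to degree 8.
    The bound places the strip |Im| < pi/2 inside |Im| <= 16/10, where the local estimates on [F]
    are applied. *)
Lemma PI_bounds : 3 < PI < 32 / 10.
Proof.
  split; [pose proof PI2_3_2; lra|].
  apply Rnot_le_lt. intros H.
  assert (H0 : 0 <= cos (16 / 10)) by (apply cos_ge_0; lra).
  apply Rle_not_lt in H0. apply H0. destruct (pre_cos_bound (16 / 10) 1%nat ltac:(lra) ltac:(lra)) as [_ Hu].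
  eapply Rle_lt_trans; [apply Hu|]. clear.
  change (2 * (1 + 1))%nat with 4%nat. unfold cos_approx. cbn [sum_f_R0]. unfold cos_term.
  cbn [Nat.mul Nat.add].
  replace (INR (Factorial.fact 0)) with 1 by (simpl; lra).
  replace (INR (Factorial.fact 2)) with 2 by (simpl; lra).
  replace (INR (Factorial.fact 4)) with 24 by (simpl; lra).
  replace (INR (Factorial.fact 6)) with 720 by (rewrite INR_IZR_INZ; vm_compute (Z.of_nat _); reflexivity).
  replace (INR (Factorial.fact 8)) with 40320 by (rewrite INR_IZR_INZ; vm_compute (Z.of_nat _); reflexivity).
  cbn [pow]. lra.
Qed.

Lemma sin_sq_le x : Rabs x <= 1 -> sin x ^ 2 <= x ^ 2.
Proof.
  assert (W : forall y, 0 <= y <= 1 -> sin y ^ 2 <= y ^ 2).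
  { intros y Hy. apply pow_incr. split; [apply sin_ge_0; pose proof PI_bounds; lra|].
    destruct (Req_dec y 0) as [->|]; [rewrite sin_0; lra|left; apply sin_lt_x; lra]. }
  intros H. apply Rabs_le_between in H. destruct (Rle_dec 0 x); [apply W; lra|].
  specialize (W (- x) ltac:(lra)). rewrite sin_neg in W.
  replace ((- sin x) ^ 2) with (sin x ^ 2) in W by ring. replace ((- x) ^ 2) with (x ^ 2) in W by ring. auto.
Qed.

Lemma cos_ge_quadratic x : Rabs x <= 2 -> 1 - x ^ 2 / 2 <= cos x.
Proof.
  intros H. replace (cos x) with (cos (2 * (x / 2))) by (f_equal; field). rewrite cos_2a_sin.
  assert (Rabs (x / 2) <= 1) by (rewrite Rabs_div, (Rabs_pos_eq 2) by lra; lra).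
  pose proof (sin_sq_le (x / 2) H0). nra.
Qed.

Lemma incr_derive f f' a b : 0 < a <= b -> (forall t, 0 < t -> is_derive f t (f' t)) ->
  (forall t, a <= t <= b -> 0 <= f' t) -> f a <= f b.
Proof.
  intros Hab Hd Hp.
  destruct (MVT_gen f a b f') as [c [Hc E]].
  - intros x Hx. apply Hd. rewrite Rmin_left, Rmax_right in Hx; lra.
  - intros x Hx. rewrite Rmin_left, Rmax_right in Hx by lra.
    apply continuity_pt_filterlim. apply (ex_derive_continuous (V:=R_NormedModule) f). exists (f' x). apply Hd. lra.
  - rewrite Rmin_left, Rmax_right in Hc by lra. specialize (Hp c Hc). nra.
Qed.

(** * Slow variation of the width, injectivity, and the cost of a turn *)

Section Profile.
Context (d : nat -> R) (Hd : admissible d).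

Ltac profile_derive x Hx :=
  let T := fresh in let U := fresh in let V := fresh in
  pose proof (is_derive_qr d x Hd Hx : is_derive (fun x : R => qr d x) x _) as T;
  pose proof (is_derive_Hr d x Hd Hx : is_derive (fun x : R => Hr d x) x _) as U;
  pose proof (is_derive_Pr d x Hd Hx : is_derive (fun x : R => Pr d x) x _) as V;
  assert (ex_derive (fun x : R => qr d x) x) by (eexists; apply T);
  assert (ex_derive (fun x : R => Hr d x) x) by (eexists; apply U);
  assert (ex_derive (fun x : R => Pr d x) x) by (eexists; apply V);
  apply is_derive_unique in T; apply is_derive_unique in U; apply is_derive_unique in V;
  auto_derive; [auto|rewrite ?T, ?U, ?V].

Lemma qr_decr t u : 0 < t <= u -> qr d u <= qr d t.
Proof.
  intros H. cut (- qr d t <= - qr d u); [lra|].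
  apply (incr_derive (fun t => - qr d t) (q1 d)); auto.
  - intros x Hx. profile_derive x Hx. ring.
  - intros x Hx. apply q1_le; auto; lra.
Qed.

Lemma Hr_incr_ge t u : 0 < t <= u -> qr d u * (u - t) <= Hr d u - Hr d t.
Proof.
  intros H. cut (Hr d t - qr d u * t <= Hr d u - qr d u * u); [lra|].
  apply (incr_derive (fun x => Hr d x - qr d u * x) (fun x => qr d x - qr d u)); auto.
  - intros x Hx. profile_derive x Hx. ring.
  - intros x Hx. pose proof (qr_decr x u ltac:(lra)). lra.
Qed.

Lemma Hr_incr_le t u : 0 < t <= u -> Hr d u - Hr d t <= qr d t * (u - t).
Proof.
  intros H. cut (qr d t * t - Hr d t <= qr d t * u - Hr d u); [lra|].
  apply (incr_derive (fun x => qr d t * x - Hr d x) (fun x => qr d t - qr d x)); auto.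
  - intros x Hx. profile_derive x Hx. ring.
  - intros x Hx. pose proof (qr_decr t x ltac:(lra)). lra.
Qed.

Lemma Hr_lt t u : 0 < t < u -> Hr d t < Hr d u.
Proof.
  intros H. pose proof (Hr_incr_ge t u ltac:(lra)). pose proof (qr_pos d u Hd ltac:(lra)). nra.
Qed.

Lemma Hr_le_inv t u : 0 < t -> 0 < u -> Hr d t <= Hr d u -> t <= u.
Proof. intros Ht Hu H. apply Rnot_lt_le. intros L. pose proof (Hr_lt u t ltac:(lra)). lra. Qed.

(** The constant of [q1_le]: with the height as parameter, the logarithmic derivative of [q] is at
    least [- kappa]. *)
Definition kappa : R := 16 * s0.

(** [q * exp (kappa * H)] is nondecreasing. Over one turn the width loses at most the factor
    [exp (- 2 pi kappa)], about one percent. *)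
Lemma qr_slow t u : 0 < t <= u -> qr d t * exp (- kappa * (Hr d u - Hr d t)) <= qr d u.
Proof.
  intros H.
  assert (E : qr d t * exp (kappa * Hr d t) <= qr d u * exp (kappa * Hr d u)).
  { apply (incr_derive (fun x => qr d x * exp (kappa * Hr d x)) (fun x => (- q1 d x + kappa * qr d x ^ 2) * exp (kappa * Hr d x))); auto.
    - intros x Hx. profile_derive x Hx. ring.
    - intros x Hx. apply Rmult_le_pos; [|left; apply exp_pos]. pose proof (q1_le d x Hd ltac:(lra)). unfold kappa.
      lra. }
  apply (Rmult_le_reg_r (exp (kappa * Hr d u))); [apply exp_pos|].
  replace (qr d t * exp (- kappa * (Hr d u - Hr d t)) * exp (kappa * Hr d u)) with (qr d t * exp (kappa * Hr d t)); auto.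
  rewrite Rmult_assoc, <- exp_plus. do 2 f_equal. ring.
Qed.

(** [3 dP = - q dH] is integrated with the lower bound of [qr_slow] for [q]; the quotient by [kappa]
    is the integral of the exponential, close to the increment of height as [kappa] is small. *)
Lemma Pr_drop_ge t u : 0 < t <= u ->
  qr d t * ((1 - exp (- kappa * (Hr d u - Hr d t))) / kappa) <= 3 * (Pr d t - Pr d u).
Proof.
  intros H. assert (Hk : kappa <> 0) by (unfold kappa, s0; lra).
  set (f := fun x => - 3 * Pr d x + qr d t / kappa * exp (- kappa * (Hr d x - Hr d t))).
  assert (E : f t <= f u).
  { apply (incr_derive f (fun x => qr d x * (qr d x - qr d t * exp (- kappa * (Hr d x - Hr d t))))); auto.
    - intros x Hx. unfold f. profile_derive x Hx. unfold Rminus. simpl. field. auto.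
    - intros x Hx. apply Rmult_le_pos; [left; apply qr_pos; auto; lra|]. pose proof (qr_slow t x ltac:(lra)). lra. }
  unfold f in E. replace (Hr d t - Hr d t) with 0 in E by ring. rewrite Rmult_0_r, exp_0 in E.
  replace (qr d t * ((1 - exp (- kappa * (Hr d u - Hr d t))) / kappa)) with (qr d t / kappa * 1 - qr d t / kappa * exp (- kappa * (Hr d u - Hr d t))) by (field; auto).
  lra.
Qed.

Lemma Pr_drop_le t u : 0 < t <= u -> 3 * (Pr d t - Pr d u) <= qr d t * (Hr d u - Hr d t).
Proof.
  intros H. cut (3 * Pr d t + qr d t * Hr d t <= 3 * Pr d u + qr d t * Hr d u); [lra|].
  apply (incr_derive (fun x => 3 * Pr d x + qr d t * Hr d x) (fun x => qr d x * (qr d t - qr d x))); auto.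
  - intros x Hx. profile_derive x Hx. field.
  - intros x Hx. apply Rmult_le_pos; [left; apply qr_pos; auto; lra|]. pose proof (qr_decr t x ltac:(lra)). lra.
Qed.

(** Points with nearby abscissae are separated because [F] is almost a similarity there. Beyond a
    distance of 2 the heights on the axis differ by nearly [q], against errors of at most [q / 50]
    each. *)
Lemma Fc_inj_ordered w w' : 0 < Re w' <= Re w -> Rabs (Im w) <= 16 / 10 -> Rabs (Im w') <= 16 / 10 ->
  Fc d w = Fc d w' -> w = w'.
Proof.
  intros Ht Hi Hi' E. set (t := Re w) in *. set (t' := Re w') in *.
  pose proof (qr_pos d t' Hd ltac:(lra)) as Hq'. pose proof (qr_le d t' Hd ltac:(lra)) as Hq6.
  destruct (Rle_dec (t - t') 2) as [Hc|Hc].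
  - assert (W : forall v, Rabs (Re v - t') <= 2 -> Rabs (Im v) <= 16 / 10 -> Cmod (v - t') <= 4).
    { intros v H1 H2. replace (v - t')%C with (RtoC (Re v - t') + Ci * RtoC (Im v))%C.
      - eapply Rle_trans; [apply Cmod_triangle|]. rewrite Cmod_mult, Cmod_Ci, !Cmod_R. lra.
      - apply injective_projections; unfold Ci, Cminus, Cplus, Copp, Cmult, RtoC, Re, Im; simpl; ring. }
    pose proof (Fc_local d t' w w' Hd ltac:(lra) ltac:(fold t; lra) ltac:(fold t'; lra)) as K.
    specialize (K (W w ltac:(fold t; rewrite Rabs_pos_eq; lra) Hi) (W w' ltac:(fold t'; rewrite Rminus_diag, Rabs_R0; lra) Hi')).
    rewrite E in K.
    replace (Fc d w' - Fc d w' - Ci * qr d t' * (w - w'))%C with (- (Ci * qr d t' * (w - w')))%C in K by ring.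
    rewrite Cmod_opp, !Cmod_mult, Cmod_Ci, Cmod_R, Rabs_pos_eq in K by lra.
    pose proof (Cmod_ge_0 (w - w')). assert (Cmod (w - w') = 0) by nra.
    apply Ceq_minus, Cmod_eq_0; auto.
  - exfalso.
    destruct (Fc_cross d w Hd ltac:(fold t; lra) ltac:(lra)) as [_ K].
    destruct (Fc_cross d w' Hd ltac:(fold t'; lra) ltac:(lra)) as [_ K'].
    rewrite E in K. fold t in K. fold t' in K'. apply Rabs_le_between in K. apply Rabs_le_between in K'.
    pose proof (qr_decr t' t ltac:(lra)).
    (* A single unit step already separates the heights: over it the increment of [Hr] is at most
       [q], so [qr_slow] keeps 99 percent of [q]. *)
    pose proof (Hr_incr_ge t' (t' + 1) ltac:(lra)) as G. pose proof (Hr_incr_le t' (t' + 1) ltac:(lra)) as G2.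
    pose proof (Hr_lt (t' + 1) t ltac:(lra)). pose proof (qr_slow t' (t' + 1) ltac:(lra)) as Sl.
    set (D := Hr d (t' + 1) - Hr d t') in *.
    pose proof (exp_ge_1p (- kappa * D)). unfold kappa, s0 in *.
    assert (99 / 100 * qr d t' <= qr d (t' + 1)).
    { eapply Rle_trans; [|apply Sl]. rewrite Rmult_comm. apply Rmult_le_compat_l; lra. }
    unfold D in *. lra.
Qed.

Lemma Fc_inj w w' : 0 < Re w -> 0 < Re w' -> Rabs (Im w) <= 16 / 10 -> Rabs (Im w') <= 16 / 10 ->
  Fc d w = Fc d w' -> w = w'.
Proof.
  intros H H' Hi Hi' E. destruct (Rle_dec (Re w') (Re w)).
  - apply Fc_inj_ordered; auto.
  - symmetry. apply Fc_inj_ordered; auto. lra.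
Qed.

(* Two turns of the spiral lower P by more than the width of the channel. *)
Lemma Fc_no_double_turn w w' : 0 < Re w -> 0 < Re w' -> Rabs (Im w) <= 16 / 10 -> Rabs (Im w') <= 16 / 10 ->
  Re (Fc d w) = Re (Fc d w') -> Im (Fc d w) - Im (Fc d w') < 4 * PI.
Proof.
  intros H H' Hi Hi' E. apply Rnot_le_lt. intros Hge. pose proof PI_bounds.
  set (t := Re w) in *. set (t' := Re w') in *.
  destruct (Fc_cross d w Hd ltac:(fold t; lra) ltac:(lra)) as [K1 K2].
  destruct (Fc_cross d w' Hd ltac:(fold t'; lra) ltac:(lra)) as [K1' K2'].
  fold t in K1, K2. fold t' in K1', K2'.
  apply Rabs_le_between in K1. apply Rabs_le_between in K1'. apply Rabs_le_between in K2.
  apply Rabs_le_between in K2'.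
  apply Rabs_le_between in Hi. apply Rabs_le_between in Hi'.
  pose proof (qr_pos d t Hd ltac:(lra)) as Hq. pose proof (qr_le d t Hd ltac:(lra)) as Hq6.
  pose proof (qr_le d t' Hd ltac:(lra)) as Hq6'.
  assert (HD : 11 <= Hr d t - Hr d t') by (unfold s0 in *; lra).
  assert (Htt : t' <= t) by (apply Hr_le_inv; lra).
  pose proof (qr_decr t' t ltac:(lra)).
  pose proof (Pr_drop_ge t' t ltac:(lra)) as Dg.
  (* The heights on the axis differ by at least 11, which is [4 * PI > 12] minus the errors, and
     [kappa] is so small that 10 remains after damping. *)
  assert (Hex : 10 <= (1 - exp (- kappa * (Hr d t - Hr d t'))) / kappa).
  { assert (He : exp (- kappa * (Hr d t - Hr d t')) <= / (1 + kappa * 11)).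
    { apply Rle_trans with (exp (- (kappa * 11))).
      - apply exp_mono. unfold kappa, s0. nra.
      - rewrite exp_Ropp. apply Rinv_le_contravar; [unfold kappa, s0; lra|]. apply exp_ge_1p. }
    unfold kappa, s0 in *. lra. }
  (* In units of [qr d t'], the drop is at least 10/3, whereas the full width is at most
     [2 * (16 / 10)] and the two errors add [2 / 50], in total 3.24. *)
  assert (10 * qr d t' <= 3 * (Pr d t' - Pr d t)) by nra.
  assert (A3 : - (16 / 10) * qr d t <= qr d t * Im w) by nra.
  assert (A4 : qr d t' * Im w' <= 16 / 10 * qr d t') by nra.
  lra.
Qed.

(** The channel extends by less than [2 q] on either side of [P], and [P >= 200 q]. *)
Lemma Re_Fc_ge w : 0 < Re w -> Rabs (Im w) <= 16 / 10 -> Pr d (Re w) / 2 <= Re (Fc d w).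
Proof.
  intros H Hi. destruct (Fc_cross d w Hd ltac:(lra) ltac:(lra)) as [K1 _]. set (t := Re w) in *.
  apply Rabs_le_between in K1. apply Rabs_le_between in Hi.
  pose proof (Pr_ge_qr d t Hd ltac:(lra)) as Hp.
  assert (qr d t * Im w <= 16 / 10 * qr d t) by nra. unfold s0 in *.
  assert (qr d t * 200 <= Pr d t).
  { eapply Rle_trans; [|apply Hp]. replace (qr d t / (48 * / 10000)) with (qr d t * (10000 / 48)) by field. lra. }
  lra.
Qed.

Lemma Pr_pos t : 0 < t -> 0 < Pr d t.
Proof.
  intros H. pose proof (qr_pos d t Hd ltac:(lra)). eapply Rlt_le_trans; [|apply Pr_ge_qr; auto; lra].
  apply Rdiv_lt_0_compat; auto. unfold s0; lra.
Qed.

End Profile.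

(** The first step is at most half of [r] and the steps halve, so the iterates stay in the ball;
    their limit is obtained as the sum of the series of steps. *)
Lemma Banach_fixed_point (T : C -> C) w0 r : 0 < r ->
  (forall w w', Cmod (w - w0) <= r -> Cmod (w' - w0) <= r -> Cmod (T w - T w') <= / 2 * Cmod (w - w')) ->
  Cmod (T w0 - w0) <= r / 2 -> exists w, Cmod (w - w0) <= r /\ T w = w.
Proof.
  intros Hr HT H0.
  set (x := fun n => Nat.iter n T w0).
  assert (Hx : forall n, Cmod (x (S n) - x n) <= r / 2 * (/ 2) ^ n /\ Cmod (x n - w0) <= r * (1 - (/ 2) ^ n) /\ Cmod (x (S n) - w0) <= r * (1 - (/ 2) ^ (S n))).
  { induction n as [|n [I1 [I2 I3]]].
    - split; [|split]; simpl.
      + lra.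
      + replace (w0 - w0)%C with (RtoC 0) by ring. rewrite Cmod_0. lra.
      + lra.
    - assert (Hp : 0 < (/ 2) ^ n) by (apply pow_lt; lra).
      assert (Hrp : 0 < r * (/ 2) ^ n) by (apply Rmult_lt_0_compat; lra).
      assert (J1 : Cmod (x (S (S n)) - x (S n)) <= r / 2 * (/ 2) ^ S n).
      { change (x (S (S n))) with (T (x (S n))). change (x (S n)) with (T (x n)) at 2.
        eapply Rle_trans; [apply HT|].
        - eapply Rle_trans; [apply I3|]. simpl. lra.
        - eapply Rle_trans; [apply I2|]. lra.
        - simpl ((/ 2) ^ S n). lra. }
      split; [exact J1|]. split; [exact I3|].
      replace (x (S (S n)) - w0)%C with ((x (S (S n)) - x (S n)) + (x (S n) - w0))%C by ring.
      eapply Rle_trans; [apply Cmod_triangle|]. simpl in *. lra. }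
  set (a := fun n => (x (S n) - x n)%C).
  assert (Hs : summable a).
  { apply (summable_dom _ (fun n => r / 2 * (/ 2) ^ n)); [intros n; apply Hx|].
    apply ex_series_rscal, ex_series_geom_pos. lra. }
  assert (Hc : forall n, csum a n = (x n - w0)%C).
  { induction n; [change (RtoC 0 = (w0 - w0)%C); ring|].
    change (csum a (S n)) with (csum a n + a n)%C. rewrite IHn. unfold a. ring. }
  set (w := (w0 + CS a)%C).
  assert (Hl : forall eps, 0 < eps -> exists n, Cmod (w - x n) < eps /\ Cmod (w - x (S n)) < eps).
  { intros eps He. destruct (csum_lim a Hs eps He) as [N HN]. exists N.
    assert (E : forall n, (w - x n)%C = (- (csum a n - CS a))%C) by (intros n; rewrite Hc; unfold w; ring).
    rewrite !E, !Cmod_opp. split; apply HN; lia. }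
  assert (Hw : Cmod (w - w0) <= r).
  { apply le_epsilon. intros eps He. destruct (Hl eps He) as [n [H1 _]].
    replace (w - w0)%C with ((w - x n) + (x n - w0))%C by ring. eapply Rle_trans; [apply Cmod_triangle|].
    destruct (Hx n) as [_ [H2 _]]. assert (0 < (/ 2) ^ n) by (apply pow_lt; lra). nra. }
  exists w. split; auto. apply Ceq_minus, Cmod_eq_0. apply Rle_antisym; [|apply Cmod_ge_0].
  apply le_epsilon. intros eps He. destruct (Hl (eps / 2) ltac:(lra)) as [n [H1 H2]].
  replace (T w - w)%C with ((T w - T (x n)) + - (w - x (S n)))%C by (change (x (S n)) with (T (x n)); ring).
  eapply Rle_trans; [apply Cmod_triangle|]. rewrite Cmod_opp.
  assert (Hxn : Cmod (x n - w0) <= r).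
  { destruct (Hx n) as [_ [H3 _]]. assert (0 < (/ 2) ^ n) by (apply pow_lt; lra). nra. }
  pose proof (HT w (x n) Hw Hxn). lra.
Qed.

(** * The channel meets every point of the strip 0 < x <= 1/10 modulo the period *)

Section Covering.
Context (d : nat -> R) (Hd : admissible d).

Lemma Fc_local_surj t x : 4 <= t -> Rabs (x - Pr d t) <= 11 / 10 * qr d t ->
  exists w, Fc d w = (x, Hr d t) /\ 38 / 10 <= Re w /\ Rabs (Im w) <= 12 / 10.
Proof.
  intros Ht Hx. pose proof (qr_pos d t Hd ltac:(lra)) as Hq. set (q := qr d t) in *.
  set (s := (Pr d t - x) / q).
  assert (Hs : Rabs s <= 11 / 10).
  { unfold s. rewrite Rabs_div by lra. rewrite (Rabs_pos_eq q), Rabs_minus_sym by lra.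
    apply (Rmult_le_reg_r q); auto. replace (Rabs (x - Pr d t) / q * q) with (Rabs (x - Pr d t)) by (field; lra).
    auto. }
  set (w0 := (t, s) : C). set (v := (x, Hr d t) : C).
  assert (Hqc : (Ci * q)%C <> 0).
  { apply Cmult_neq_0; [apply Ci_nz|]. intros E. apply RtoC_inj in E. lra. }
  set (T := fun w => (w - (Fc d w - v) / (Ci * q))%C).
  assert (Hball : forall w, Cmod (w - w0) <= / 10 -> 38 / 10 <= Re w /\ Rabs (Im w) <= 12 / 10 /\ Cmod (w - t) <= 4).
  { intros w Hw.
    pose proof (re_le_Cmod (w - w0)) as R1. pose proof (im_le_Cmod (w - w0)) as R2.
    assert (Er : Re (w - w0) = Re w - t) by (unfold w0, Cminus; rewrite re_plus, re_opp; reflexivity).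
    assert (Ei : Im (w - w0) = Im w - s) by (unfold w0, Cminus; rewrite im_plus, im_opp; reflexivity).
    rewrite Er in R1. rewrite Ei in R2. apply Rabs_le_between in Hs.
    assert (B1 : Rabs (Re w - t) <= / 10) by lra. assert (B2 : Rabs (Im w - s) <= / 10) by lra.
    split; [apply Rabs_le_between in B1; lra|]. split; [apply Rabs_le_between in B2; apply Rabs_le; lra|].
    replace (w - t)%C with ((w - w0) + Ci * s)%C.
    - eapply Rle_trans; [apply Cmod_triangle|]. rewrite Cmod_mult, Cmod_Ci, Cmod_R.
      assert (Rabs s <= 11/10) by (apply Rabs_le; lra). lra.
    - apply injective_projections; unfold w0, Ci, Cminus, Cplus, Copp, Cmult, RtoC, Re, Im; simpl; ring. }
  destruct (Banach_fixed_point T w0 (/ 10)) as [w [H1 H2]]; [lra| | |].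
  - intros w w' Hw Hw'. destruct (Hball w Hw) as [B1 [B2 B3]]. destruct (Hball w' Hw') as [B1' [B2' B3']].
    pose proof (Fc_local d t w w' Hd ltac:(lra) ltac:(lra) ltac:(lra) B3 B3') as K. fold q in K.
    unfold T. replace (w - (Fc d w - v) / (Ci * q) - (w' - (Fc d w' - v) / (Ci * q)))%C with
      (- ((Fc d w - Fc d w' - Ci * q * (w - w')) / (Ci * q)))%C by (field; split; [intros E; apply RtoC_inj in E; lra|apply Ci_nz]).
    rewrite Cmod_opp, Cmod_div, Cmod_mult, Cmod_Ci, Cmod_R, Rmult_1_l, (Rabs_pos_eq q) by (auto; lra).
    apply (Rmult_le_reg_r q); auto.
    match goal with |- ?a / q * q <= _ => replace (a / q * q) with a by (field; lra) end.
    eapply Rle_trans; [apply K|]. pose proof (Cmod_ge_0 (w - w')). nra.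
  - unfold T. replace (w0 - (Fc d w0 - v) / (Ci * q) - w0)%C with (- ((Fc d w0 - v) / (Ci * q)))%C by ring.
    rewrite Cmod_opp, Cmod_div, Cmod_mult, Cmod_Ci, Cmod_R, Rmult_1_l, (Rabs_pos_eq q) by (auto; lra).
    apply (Rmult_le_reg_r q); auto.
    match goal with |- ?a / q * q <= _ => replace (a / q * q) with a by (field; lra) end.
    destruct (Fc_cross d w0 Hd) as [K1 K2]; [change (0 <= t); lra|change (Rabs s <= 2); lra|].
    change (Re w0) with t in K1, K2. change (Im w0) with s in K1. fold q in K1, K2.
    replace (q * s) with (Pr d t - x) in K1 by (unfold s; field; lra).
    replace (Fc d w0 - v)%C with (RtoC (Re (Fc d w0) - (Pr d t - (Pr d t - x))) + Ci * RtoC (Im (Fc d w0) - Hr d t))%C.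
    + eapply Rle_trans; [apply Cmod_triangle|]. rewrite Cmod_mult, Cmod_Ci, !Cmod_R. lra.
    + apply injective_projections; unfold v, Ci, Cminus, Cplus, Copp, Cmult, RtoC, Re, Im; simpl; ring.
  - exists w. destruct (Hball w H1) as [B1 [B2 _]]. split; [|auto].
    unfold T in H2. apply Ceq_minus.
    assert (Hz : ((Fc d w - v) / (Ci * q))%C = 0).
    { replace ((Fc d w - v) / (Ci * q))%C with (w - (w - (Fc d w - v) / (Ci * q)))%C by ring. rewrite H2. ring. }
    fold v. transitivity ((Fc d w - v) / (Ci * q) * (Ci * q))%C; [|rewrite Hz; ring].
    field. split; [intros E; apply RtoC_inj in E; lra|apply Ci_nz].
Qed.

Lemma Hr_onto y : Hr d 4 <= y -> exists t, 4 <= t /\ Hr d t = y.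
Proof.
  intros Hy. destruct (Hr_lim d (y + 1) Hd) as [T [HT0 HT]].
  set (b := Rmax T 5). assert (Hb : 5 <= b) by apply Rmax_r.
  assert (Hyb : y < Hr d b) by (specialize (HT b (Rmax_l _ _)); lra).
  destruct (Req_dec (Hr d 4) y) as [E|E]; [exists 4; split; [lra|auto]|].
  destruct (IVT_interv (fun x => Hr d x - y) 4 b) as [t [Ht1 Ht2]]; [| lra | lra | lra|].
  - intros x Hx. apply continuity_pt_minus; [|apply continuity_pt_const; intros ? ?; auto].
    apply continuity_pt_filterlim. apply (ex_derive_continuous (V:=R_NormedModule) (Hr d)). exists (qr d x).
    apply is_derive_Hr; auto; lra.
  - exists t. split; lra.
Qed.

(** Along the abscissae [t n] at which the height is [th] modulo [2 pi], [P] descends to 0 by steps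
    smaller than the window of width [22 / 10 * q] reached by [Fc_local_surj]. Hence [x] lies in the
    window of some [t n]. *)
Lemma spiral_covers x th : 0 < x <= / 10 -> exists w (k : Z), Fc d w = (x, th + 2 * PI * IZR k) /\ 38 / 10 <= Re w /\ Rabs (Im w) <= 12 / 10.
Proof.
  intros Hx. pose proof PI_bounds as HPI.
  set (h0 := Hr d 4).
  set (k0 := up ((h0 - th) / (2 * PI))).
  destruct (archimed ((h0 - th) / (2 * PI))) as [A1 A2]. fold k0 in A1, A2.
  assert (Hk0 : h0 < th + 2 * PI * IZR k0 <= h0 + 2 * PI).
  { assert (E : h0 - th = 2 * PI * ((h0 - th) / (2 * PI))) by (field; lra). set (u := (h0 - th) / (2 * PI)) in *.
    split; nra. }
  set (y := fun n : nat => th + 2 * PI * IZR (k0 + Z.of_nat n)).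
  assert (Hy : forall n, y n = th + 2 * PI * IZR k0 + 2 * PI * INR n).
  { intros n. unfold y. rewrite plus_IZR, <- INR_IZR_INZ. ring. }
  assert (Hyt : forall n, exists t, 4 <= t /\ Hr d t = y n).
  { intros n. apply Hr_onto. fold h0. rewrite Hy. pose proof (pos_INR n). nra. }
  destruct (choice (fun n t => 4 <= t /\ Hr d t = y n) Hyt) as [t Ht]. clear Hyt.
  assert (Hq : forall n, 0 < qr d (t n)) by (intros n; apply qr_pos; auto; destruct (Ht n); lra).
  (* At abscissa 4, [P] is at least almost 1/6, thanks to [d 0 = 1], and the descent to the first
     height costs at most [7 * 6 * s0 / 3]. What remains is above 1/10. *)
  assert (P0 : x <= Pr d (t 0%nat)).
  { destruct (Ht 0%nat) as [T1 T2]. rewrite Hy in T2. simpl in T2.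
    pose proof (Pr_drop_le d Hd 4 (t 0%nat) ltac:(lra)) as D. fold h0 in D.
    pose proof (qr_le d 4 Hd ltac:(lra)) as Q. pose proof (qr_pos d 4 Hd ltac:(lra)) as Q0.
    pose proof (Pr_ge_term d 0 4 Hd ltac:(lra)) as G. destruct Hd as [E _]. rewrite E in G.
    unfold lam in G. simpl in G.
    pose proof (exp_ge_1p (- (2 * (s0 * (s0 * 1) * 1)) * 4)) as X. unfold s0 in *.
    assert (qr d 4 * (Hr d (t 0%nat) - h0) <= 6 * / 10000 * 7) by (apply Rmult_le_compat; lra). lra. }
  (* The cost of a turn is [2 PI / 3 < 214 / 100] in units of [q], and by [qr_slow] the next [q]
     keeps 98 percent. *)
  assert (Hgap : forall n, Pr d (t n) - Pr d (t (S n)) <= 214 / 100 * qr d (t n) /\ qr d (t n) * (98 / 100) <= qr d (t (S n))).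
  { intros n. destruct (Ht n) as [T1 T2], (Ht (S n)) as [T3 T4].
    assert (Dy : Hr d (t (S n)) - Hr d (t n) = 2 * PI) by (rewrite T2, T4, !Hy, S_INR; ring).
    assert (Hle : t n <= t (S n)) by (apply (Hr_le_inv d Hd); lra).
    pose proof (Pr_drop_le d Hd (t n) (t (S n)) ltac:(lra)) as D1. rewrite Dy in D1.
    pose proof (qr_slow d Hd (t n) (t (S n)) ltac:(lra)) as D2. rewrite Dy in D2.
    specialize (Hq n). split; [nra|]. eapply Rle_trans; [|apply D2]. apply Rmult_le_compat_l; [lra|].
    pose proof (exp_ge_1p (- kappa * (2 * PI))). unfold kappa, s0 in *. lra. }
  assert (Hex : exists n, Pr d (t n) < x).
  { destruct (Pr_lim d x Hd) as [T [HT0 HT]]; [lra|].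
    destruct (INR_archimed 1 (Rabs (Hr d T) + Rabs h0)) as [n Hn]; [lra|]. exists n. apply HT.
    destruct (Ht n) as [T1 T2]. apply (Hr_le_inv d Hd); [auto|lra|]. rewrite T2, Hy.
    pose proof (Rle_abs (Hr d T)). pose proof (Rle_abs (- h0)). rewrite Rabs_Ropp in *. pose proof (pos_INR n). nra. }
  assert (Hstep : exists n, Pr d (t (S n)) < x <= Pr d (t n)).
  { destruct Hex as [N HN]. induction N as [|N IH]; [lra|].
    destruct (Rlt_le_dec (Pr d (t N)) x); [auto|]. exists N. lra. }
  destruct Hstep as [n Hn]. destruct (Hgap n) as [G1 G2].
  (* The nearer of the two ends is taken. Half of the gap is [107 / 100] in units of the larger [q],
     and in units of the smaller one [107 / 98 < 11 / 10]. *)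
  assert (Hsol : exists m, Rabs (x - Pr d (t m)) <= 11 / 10 * qr d (t m)).
  { specialize (Hq n). destruct (Rle_dec (Pr d (t n) - x) (107 / 100 * qr d (t n))).
    - exists n. rewrite Rabs_left1; lra.
    - exists (S n). rewrite Rabs_pos_eq; lra. }
  destruct Hsol as [m Hm]. destruct (Ht m) as [T1 T2].
  destruct (Fc_local_surj (t m) x T1 Hm) as [w [W1 W2]]. rewrite T2 in W1.
  exists w, (k0 + Z.of_nat m)%Z. split; auto.
Qed.

End Covering.

(** * The symbol *)

Definition psi (d : nat -> R) (z : C) : C := cexp (- Fc d (zeta z)).
(** Matches [x <= / 10] in [spiral_covers]: the values of [exp (- F)] fill the annulus from [a0] to
    1. *)
Definition a0 : R := exp (- / 10).
Definition moebius (w : C) : C := ((w - a0) / (1 - a0 * w))%C.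
Definition symbol (d : nat -> R) (z : C) : C := (moebius (psi d z) ^ 2)%C.

Lemma a0_bounds : 9 / 10 <= a0 <= 92 / 100.
Proof.
  unfold a0. split; [pose proof (exp_ge_1p (- / 10)); lra|].
  rewrite exp_Ropp. apply Rle_trans with (/ (1 + / 10)); [|lra].
  apply Rinv_le_contravar; [lra|apply exp_ge_1p].
Qed.

Lemma moebius_den w : Cmod w < 1 -> (1 - a0 * w)%C <> 0.
Proof.
  intros H. apply Cmod_lt_1_neq. rewrite Cmod_mult, Cmod_R, Rabs_pos_eq by (pose proof a0_bounds; lra).
  pose proof a0_bounds. nra.
Qed.

Lemma moebius_identity w : (1 - a0 ^ 2) * (1 - Cmod w ^ 2) = Cmod (1 - a0 * w) ^ 2 - Cmod (w - a0) ^ 2.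
Proof.
  rewrite !Cmod2_alt. unfold Cminus. rewrite !re_plus, !im_plus, !re_opp, !im_opp, re_scal_l, im_scal_l.
  simpl. ring.
Qed.

(** By [moebius_identity], passing from [w] to [moebius w] multiplies one minus the squared modulus
    by [(1 - a0 ^ 2) / |1 - a0 w| ^ 2], at least [(1 - a0) / (1 + a0) >= / 25]. The decay of |psi|
    is kept up to this factor. *)
Lemma moebius_gap w : Cmod w < 1 -> Cmod (moebius w) ^ 2 <= 1 - / 25 * (1 - Cmod w ^ 2).
Proof.
  intros H. pose proof a0_bounds. pose proof (Cmod_ge_0 w). pose proof (moebius_den w H) as Hn.
  assert (Hp : 0 < Cmod (1 - a0 * w)) by (apply Cmod_gt_0; auto).
  assert (Hle : Cmod (1 - a0 * w) <= 1 + a0).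
  { unfold Cminus. eapply Rle_trans; [apply Cmod_triangle|].
    rewrite Cmod_1, Cmod_opp, Cmod_mult, Cmod_R, Rabs_pos_eq by lra. nra. }
  pose proof (moebius_identity w) as E. unfold moebius. rewrite Cmod_div by auto.
  set (D := Cmod (1 - a0 * w)) in *. set (m := Cmod w) in *. set (N := Cmod (w - a0)) in *.
  assert (D2 : 0 < D ^ 2) by (apply pow_lt; auto).
  apply (Rmult_le_reg_r (D ^ 2)); auto. replace ((N / D) ^ 2 * D ^ 2) with (N ^ 2) by (field; lra).
  assert (D ^ 2 <= (1 + a0) ^ 2) by (apply pow_incr; lra).
  assert (0 <= 1 - m ^ 2) by nra.
  assert (/ 25 * (1 + a0) ^ 2 <= 1 - a0 ^ 2) by nra.
  nra.
Qed.

Lemma moebius_disc w : Cmod w < 1 -> Cmod (moebius w) < 1.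
Proof.
  intros H. pose proof (moebius_gap w H). pose proof (Cmod_ge_0 w). pose proof (Cmod_ge_0 (moebius w)).
  nra.
Qed.

Lemma moebius_inj w w' : Cmod w < 1 -> Cmod w' < 1 -> moebius w = moebius w' -> w = w'.
Proof.
  intros H H' E. pose proof (moebius_den w H). pose proof (moebius_den w' H').
  assert (K : ((w - a0) * (1 - a0 * w') = (w' - a0) * (1 - a0 * w))%C).
  { transitivity (moebius w * ((1 - a0 * w) * (1 - a0 * w')))%C; [unfold moebius; field; auto|].
    rewrite E. unfold moebius; field; auto. }
  assert (K2 : (RtoC (1 - a0 ^ 2) * (w - w') = 0)%C).
  { rewrite RtoC_minus, RtoC_pow. transitivity ((w - a0) * (1 - a0 * w') - (w' - a0) * (1 - a0 * w))%C; [ring|].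
    rewrite K. ring. }
  apply Ceq_minus. destruct (Ceq_dec (w - w') 0) as [|Hn]; auto. exfalso.
  revert K2. apply Cmult_neq_0; auto. intros E2. apply RtoC_inj in E2. pose proof a0_bounds. nra.
Qed.

(* One of the two square roots [u], [-u] of a point of the disc has non-negative real part, and then its
   preimage under the Moebius map stays at distance at least [a0] from the origin. *)
Lemma moebius_inverse u : Cmod u < 1 -> 0 <= Re u -> exists w, a0 <= Cmod w < 1 /\ moebius w = u.
Proof.
  intros Hu Hr. pose proof a0_bounds as Ha. pose proof (Cmod_ge_0 u).
  assert (Hn : (1 + a0 * u)%C <> 0).
  { replace (1 + a0 * u)%C with (1 - a0 * - u)%C by ring. apply moebius_den. rewrite Cmod_opp; auto. }
  set (w := ((u + a0) / (1 + a0 * u))%C). exists w.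
  assert (Hp : 0 < Cmod (1 + a0 * u)) by (apply Cmod_gt_0; auto).
  assert (E1 : Cmod (u + a0) ^ 2 - a0 ^ 2 * Cmod (1 + a0 * u) ^ 2 = Cmod u ^ 2 * (1 - a0 ^ 4) + 2 * a0 * Re u * (1 - a0 ^ 2)).
  { rewrite !Cmod2_alt. rewrite !re_plus, !im_plus, re_scal_l, im_scal_l. simpl. ring. }
  assert (E2 : Cmod (1 + a0 * u) ^ 2 - Cmod (u + a0) ^ 2 = (1 - a0 ^ 2) * (1 - Cmod u ^ 2)).
  { rewrite !Cmod2_alt. rewrite !re_plus, !im_plus, re_scal_l, im_scal_l. simpl. ring. }
  assert (Hm : Cmod w = Cmod (u + a0) / Cmod (1 + a0 * u)) by (unfold w; apply Cmod_div; auto).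
  pose proof (Cmod_ge_0 (u + a0)).
  assert (A2 : 0 < 1 - a0 ^ 2) by nra.
  assert (G2 : 0 <= 2 * a0 * Re u * (1 - a0 ^ 2)) by (apply Rmult_le_pos; [apply Rmult_le_pos|]; lra).
  assert (G3 : 0 < (1 - a0 ^ 2) * (1 - Cmod u ^ 2)) by (apply Rmult_lt_0_compat; nra).
  assert (Hw : a0 <= Cmod w < 1).
  { rewrite Hm. split.
    - apply (Rmult_le_reg_r (Cmod (1 + a0 * u))); auto.
      match goal with |- _ <= ?x / ?y * ?y => replace (x / y * y) with x by (field; lra) end.
      apply Rsqr_incr_0_var; auto. unfold Rsqr. nra.
    - apply (Rmult_lt_reg_r (Cmod (1 + a0 * u))); auto.
      match goal with |- ?x / ?y * ?y < _ => replace (x / y * y) with x by (field; lra) end.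
      rewrite Rmult_1_l. apply Rsqr_incrst_0; [unfold Rsqr; nra| |]; lra. }
  split; auto. unfold moebius, w in *.
  assert (RtoC (1 - a0 ^ 2) <> 0) by (intros E; apply RtoC_inj in E; lra).
  rewrite RtoC_minus, RtoC_pow in H1.
  field. split; auto. replace (1 + a0 * u - a0 * (u + a0))%C with (1 - a0 ^ 2)%C by ring. auto.
Qed.

Lemma square_root (w : C) : exists u, (u ^ 2)%C = w /\ 0 <= Re u.
Proof.
  assert (H : exists u, (u ^ 2)%C = w).
  { destruct (Ceq_dec w 0) as [->|Hw]; [exists 0; ring|].
    destruct (polar w Hw) as [v Hv]. exists (cexp (/ 2 * v))%C.
    replace (cexp (/ 2 * v) ^ 2)%C with (cexp (/ 2 * v) * cexp (/ 2 * v))%C by ring.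
    rewrite <- cexp_plus, <- Hv. f_equal. field. }
  destruct H as [u Hu]. destruct (Rle_dec 0 (Re u)); [exists u; auto|].
  exists (- u)%C. split; [rewrite <- Hu; ring|]. rewrite re_opp. lra.
Qed.

Section Symbol.
Context (d : nat -> R) (Hd : admissible d).

Lemma Im_zeta_abs z : Rabs (Im (zeta z)) <= 16 / 10.
Proof. pose proof (Im_zeta z). pose proof PI_bounds. apply Rabs_le. lra. Qed.

Lemma Cmod_psi z : Cmod z < 1 -> Cmod (psi d z) <= exp (- (Pr d (Re (zeta z)) / 2)).
Proof.
  intros Hz. unfold psi. rewrite Cmod_cexp, re_opp. apply exp_mono.
  pose proof (Re_Fc_ge d Hd (zeta z) (Re_zeta_pos z Hz) (Im_zeta_abs z)). lra.
Qed.

Lemma psi_disc z : Cmod z < 1 -> Cmod (psi d z) < 1.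
Proof.
  intros Hz. eapply Rle_lt_trans; [apply Cmod_psi; auto|]. rewrite <- exp_0. apply exp_increasing.
  pose proof (Pr_pos d Hd (Re (zeta z)) (Re_zeta_pos z Hz)). lra.
Qed.

Lemma Analytic_psi : Analytic (psi d).
Proof.
  unfold psi. apply (Analytic_cexp (fun z => - Fc d (zeta z))%C).
  apply (Analytic_ext (fun z => (-1) * Fc d (zeta z))%C); [intros; ring|].
  apply Analytic_scal, Analytic_Fc_zeta; auto.
Qed.

Lemma Analytic_symbol : Analytic (symbol d).
Proof.
  unfold symbol. apply (Analytic_pow (fun z => moebius (psi d z))). pose proof a0_bounds.
  (* The quotient in [moebius] is expanded as a geometric series in [a0 * psi d z], dominated by
     [a0 ^ k]. *)
  assert (G : Analytic (fun z => CS (fun k => (a0 ^ k * psi d z ^ k)%C))).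
  { apply (Analytic_sum (fun k z => (a0 ^ k * psi d z ^ k)%C)).
    - intros k. apply (Analytic_scal (a0 ^ k)%C (fun z => (psi d z ^ k)%C)), Analytic_pow, Analytic_psi.
    - intros r Hr. exists (fun k => a0 ^ k). split; [apply ex_series_geom_pos; lra|].
      intros k z Hz. rewrite Cmod_mult, !Cmod_pow, Cmod_R, Rabs_pos_eq by lra.
      pose proof (psi_disc z ltac:(lra)). pose proof (Cmod_ge_0 (psi d z)).
      assert (Cmod (psi d z) ^ k <= 1) by (rewrite <- (pow1 k); apply pow_incr; lra).
      assert (0 <= a0 ^ k) by (apply pow_le; lra). nra. }
  apply (Analytic_ext (fun z => (psi d z + (- a0)) * CS (fun k => (a0 ^ k * psi d z ^ k)%C))%C).
  - intros z Hz. pose proof (psi_disc z Hz) as Hp.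
    rewrite (CS_ext _ (fun k => (a0 * psi d z) ^ k)%C) by (intros; rewrite Cpow_mult_l; auto).
    destruct (CS_geom (a0 * psi d z)%C) as [_ ->].
    + rewrite Cmod_mult, Cmod_R, Rabs_pos_eq by lra. nra.
    + unfold moebius, Cdiv, Cminus. reflexivity.
  - apply Analytic_mult; auto. apply Analytic_plus; [apply Analytic_psi|apply Analytic_const].
Qed.

Lemma symbol_disc z : Cmod z < 1 -> Cmod (symbol d z) < 1.
Proof.
  intros Hz. unfold symbol. rewrite Cmod_pow. pose proof (moebius_disc _ (psi_disc z Hz)).
  pose proof (Cmod_ge_0 (moebius (psi d z))). nra.
Qed.

Lemma psi_covers v : a0 <= Cmod v < 1 -> exists z, Cmod z < 1 /\ psi d z = v.
Proof.
  intros Hv. pose proof a0_bounds as Ha.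
  assert (Hv0 : v <> 0) by (apply Cmod_gt_0; lra).
  destruct (polar v Hv0) as [y Hy].
  assert (Hm : Cmod v = exp (Re y)) by (rewrite <- Hy; apply Cmod_cexp).
  assert (Hx : 0 < - Re y <= / 10).
  { rewrite Hm in Hv. destruct Hv as [V1 V2]. split.
    - rewrite <- exp_0 in V2. apply exp_lt_inv in V2. lra.
    - apply Rnot_lt_le. intros L. apply (Rle_not_lt _ _ V1). unfold a0. apply exp_increasing. lra. }
  (* Real part and angle change sign because [psi] is the exponential of [- F]. *)
  destruct (spiral_covers d Hd (- Re y) (- Im y) Hx) as [w [k [W1 [W2 W3]]]].
  destruct (zeta_surj w) as [z [Z1 Z2]].
  - apply Rabs_le_between in W3. pose proof PI_bounds. lra.
  (* [exp (1 - 38 / 10)] is below 1/3 and [2 * cos (12 / 10)] is at least 56/100: the part of the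
     strip used for the covering lies in the image of [zeta]. *)
  - apply Rabs_le_between in W3. apply Rle_lt_trans with (1 / 3).
    + apply Rle_trans with (/ exp (28 / 10)).
      * rewrite <- exp_Ropp. apply exp_mono. lra.
      * replace (1 / 3) with (/ 3) by field. apply Rinv_le_contravar; [lra|]. pose proof (exp_ge_1p (28 / 10)). lra.
    + pose proof (cos_ge_quadratic (Im w) ltac:(apply Rabs_le; lra)). nra.
  - exists z. split; auto. unfold psi. rewrite Z2, W1, <- Hy.
    replace (Copp (- Re y, - Im y + 2 * PI * IZR k)) with (Cplus y (0, 2 * PI * IZR (- k))).
    + rewrite cexp_plus. replace (cexp (0, 2 * PI * IZR (- k))) with (RtoC 1); [ring|].
      unfold cexp. simpl. rewrite exp_0. unfold cis.
      rewrite (Rmult_comm (2 * PI)).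
      assert (P : forall n : nat, cis (INR n * (2 * PI)) = 1) by apply cis_2PI_INR.
      assert (Hz : cis (IZR (- k) * (2 * PI)) = 1).
      { destruct (Z.le_gt_cases 0 (- k)) as [L|L].
        - rewrite <- (Z2Nat.id (- k)) by auto. rewrite <- INR_IZR_INZ. apply P.
        - assert (E : cis (IZR k * (2 * PI)) = 1) by (rewrite <- (Z2Nat.id k) by lia; rewrite <- INR_IZR_INZ; apply P).
          rewrite opp_IZR, Ropp_mult_distr_l_reverse, <- cis_conj, E. unfold Cconj, RtoC; simpl; f_equal; ring. }
      unfold cis in Hz. rewrite Hz. ring.
    + rewrite opp_IZR. apply injective_projections; unfold Cplus, Copp, Re, Im; simpl; ring.
Qed.

Lemma symbol_surj w : Cmod w < 1 -> exists z, Cmod z < 1 /\ symbol d z = w.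
Proof.
  intros Hw. destruct (square_root w) as [u [Hu1 Hu2]].
  assert (Hu : Cmod u < 1).
  { rewrite <- Hu1, Cmod_pow in Hw. nra. }
  destruct (moebius_inverse u Hu Hu2) as [v [Hv1 Hv2]]. destruct (psi_covers v Hv1) as [z [Hz1 Hz2]].
  exists z. split; auto. unfold symbol. rewrite Hz2, Hv2. auto.
Qed.

(** Equal values of [psi] mean that the values of [F] differ by [2 pi i k], with |k| <= 1 by
    [Fc_no_double_turn], and [k = 0] forces the points to coincide. Three distinct points would give
    nonzero [k], [l] and [k + l], all in {-1, 1}, which is impossible. *)
Lemma psi_three z1 z2 z3 : Cmod z1 < 1 -> Cmod z2 < 1 -> Cmod z3 < 1 ->
  psi d z1 = psi d z2 -> psi d z2 = psi d z3 -> z1 = z2 \/ z2 = z3 \/ z1 = z3.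
Proof.
  intros H1 H2 H3 E12 E23.
  assert (K : forall z z', Cmod z < 1 -> Cmod z' < 1 -> psi d z = psi d z' ->
    exists k : Z, (Fc d (zeta z') - Fc d (zeta z))%C = (0, 2 * PI * IZR k) /\ (k = 0%Z -> z = z') /\ (-2 < k < 2)%Z).
  { intros z z' Hz Hz' E. destruct (cexp_eq _ _ E) as [k Hk]. exists k.
    assert (Ed : (Fc d (zeta z') - Fc d (zeta z))%C = (0, 2 * PI * IZR k)) by (rewrite <- Hk; ring).
    split; auto.
    pose proof (f_equal fst Ed) as Er. pose proof (f_equal snd Ed) as Ei.
    change (Re (Fc d (zeta z') - Fc d (zeta z)) = 0) in Er.
    change (Im (Fc d (zeta z') - Fc d (zeta z)) = 2 * PI * IZR k) in Ei.
    unfold Cminus in Er, Ei. rewrite re_plus, re_opp in Er. rewrite im_plus, im_opp in Ei.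
    pose proof PI_bounds. split; [|split].
    - intros ->. apply zeta_inj; auto. apply (Fc_inj d Hd); auto using Re_zeta_pos, Im_zeta_abs.
      symmetry. apply Ceq_minus. rewrite Ed, Rmult_0_r. reflexivity.
    - assert (L : Im (Fc d (zeta z)) - Im (Fc d (zeta z')) < 4 * PI) by (apply (Fc_no_double_turn d Hd); auto using Re_zeta_pos, Im_zeta_abs; lra).
      apply lt_IZR. nra.
    - assert (L : Im (Fc d (zeta z')) - Im (Fc d (zeta z)) < 4 * PI) by (apply (Fc_no_double_turn d Hd); auto using Re_zeta_pos, Im_zeta_abs; lra).
      apply lt_IZR. nra. }
  destruct (K z1 z2 H1 H2 E12) as [k [K1 [K2 K3]]]. destruct (K z2 z3 H2 H3 E23) as [l [L1 [L2 L3]]].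
  destruct (K z1 z3 H1 H3 (eq_trans E12 E23)) as [m [M1 [M2 M3]]].
  assert (Em : (m = k + l)%Z).
  { apply eq_IZR. rewrite plus_IZR. pose proof PI_bounds.
    assert (Es : (0, 2 * PI * IZR m) = Cplus (0, 2 * PI * IZR k) (0, 2 * PI * IZR l) :> C) by (rewrite <- M1, <- K1, <- L1; ring).
    apply (f_equal snd) in Es. unfold Cplus in Es; simpl in Es. apply (Rmult_eq_reg_l (2 * PI)); lra. }
  assert (k = 0 \/ l = 0 \/ m = 0)%Z by lia. intuition.
Qed.

Lemma psi_two_valent v (l : list C) : NoDup l -> (forall z, In z l -> Cmod z < 1 /\ psi d z = v) -> (length l <= 2)%nat.
Proof.
  intros Hn Hl. destruct l as [|z1 [|z2 [|z3 l]]]; simpl; try lia. exfalso.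
  destruct (Hl z1) as [A1 B1]; [simpl; auto|]. destruct (Hl z2) as [A2 B2]; [simpl; auto|].
  destruct (Hl z3) as [A3 B3]; [simpl; auto|].
  inversion Hn as [|? ? N1 N1']; subst. inversion N1' as [|? ? N2 N2']; subst.
  destruct (psi_three z1 z2 z3) as [E|[E|E]]; auto; try congruence; subst; simpl in *; tauto.
Qed.

(** On the fibre, [moebius (psi d z)] is one of two opposite numbers; the list is split accordingly
    by [P]. Each part has at most two points, as [moebius] is injective and [psi] is two-valent. *)
Lemma symbol_four_valent w (l : list C) : NoDup l -> (forall z, In z l -> Cmod z < 1 /\ symbol d z = w) -> (length l <= 4)%nat.
Proof.
  intros Hn Hl. destruct l as [|z0 l0]; [simpl; lia|]. set (l := z0 :: l0) in *.
  assert (Hz0 : In z0 l) by (simpl; auto). destruct (Hl z0 Hz0) as [Hz0' Hw]. set (u := moebius (psi d z0)).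
  set (P := fun z => if Ceq_dec (moebius (psi d z)) u then true else false).
  assert (Hlen : forall m : list C, length m = (length (filter P m) + length (filter (fun z => negb (P z)) m))%nat).
  { induction m as [|x m IH]; simpl; auto. destruct (P x); simpl; lia. }
  assert (Hgen : forall (Q : C -> bool) (c : C), (forall z, In z l -> Q z = true -> moebius (psi d z) = c) -> (length (filter Q l) <= 2)%nat).
  { intros Q c HQ. destruct (filter Q l) as [|z1 l1] eqn:El; [simpl; lia|]. rewrite <- El.
    assert (Hin : In z1 (filter Q l)) by (rewrite El; simpl; auto). apply filter_In in Hin.
    apply (psi_two_valent (psi d z1)); [apply NoDup_filter; auto|].
    intros z Hz. apply filter_In in Hz. destruct Hz as [Z1 Z2], Hin as [I1 I2]. destruct (Hl z Z1), (Hl z1 I1).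
    split; auto.
    apply moebius_inj; auto using psi_disc. rewrite (HQ z), (HQ z1); auto. }
  rewrite (Hlen l). assert (length (filter P l) <= 2)%nat.
  { apply (Hgen P u). intros z _. unfold P. destruct (Ceq_dec _ _); auto; discriminate. }
  assert (length (filter (fun z => negb (P z)) l) <= 2)%nat; [|lia].
  apply (Hgen _ (- u)%C). intros z Hz. unfold P. destruct (Ceq_dec _ _) as [|Hne]; [discriminate|]. intros _.
  destruct (Hl z Hz) as [_ Hzw]. rewrite <- Hw in Hzw. unfold symbol in Hzw. fold u in Hzw.
  set (v := moebius (psi d z)) in *.
  assert (E : ((v - u) * (v + u) = 0)%C) by (transitivity (v ^ 2 - u ^ 2)%C; [ring|rewrite Hzw; ring]).
  destruct (Ceq_dec (v + u) 0) as [E2|E2].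
  - apply Ceq_minus. rewrite <- E2. ring.
  - exfalso. revert E. apply Cmult_neq_0; auto. apply Cminus_eq_contra; auto.
Qed.

(** The squared modulus of [psi] is at most [exp (- h) <= 1 - h / 2], where [h <= 1] is used, and
    [moebius_gap] divides the gap by 25; hence the 50. *)
Lemma symbol_decay z h : Cmod z < 1 -> 0 <= h <= 1 -> h <= Pr d (Re (zeta z)) -> Cmod (symbol d z) <= exp (- (h / 50)).
Proof.
  intros Hz Hh HP. unfold symbol. rewrite Cmod_pow. eapply Rle_trans; [apply moebius_gap, psi_disc; auto|].
  assert (Hps : Cmod (psi d z) ^ 2 <= exp (- h)).
  { apply Rle_trans with (exp (- (Pr d (Re (zeta z)) / 2)) ^ 2).
    - apply pow_incr. split; [apply Cmod_ge_0|apply Cmod_psi; auto].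
    - set (x := - (Pr d (Re (zeta z)) / 2)). replace (exp x ^ 2) with (exp x * exp x) by ring.
      rewrite <- exp_plus. apply exp_mono. unfold x. lra. }
  assert (He : exp (- h) <= 1 - h / 2).
  { rewrite exp_Ropp. apply Rle_trans with (/ (1 + h)).
    - apply Rinv_le_contravar; [lra|apply exp_ge_1p].
    - apply (Rmult_le_reg_r (1 + h)); [lra|]. rewrite Rinv_l by lra. nra. }
  eapply Rle_trans; [|apply exp_ge_1p]. lra.
Qed.

End Symbol.

(** * Choice of the profile *)

(* The bump of height [2^-i] is placed at the first admissible scale beyond [f i]; the state is the index of the next bump. *)
Fixpoint bump_index (f : nat -> nat) (m : nat) : nat :=
  match m with
  | O => 0
  | S m => if Nat.leb (f (bump_index f m)) (S m) then S (bump_index f m) else bump_index f m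
  end.

Definition bump (f : nat -> nat) (m : nat) : R :=
  if Nat.leb (f (bump_index f m)) (S m) then (/ 2) ^ bump_index f m else 0.

(** Halving is the fastest decrease that [admissible] permits. The bumps have total mass at most 2,
    which leads to a sum of at most [2 * (1 + 2) = 6]. *)
Fixpoint profile (f : nat -> nat) (m : nat) : R :=
  match m with O => 1 | S m => profile f m / 2 + bump f m end.

Lemma bump_ge0 f m : 0 <= bump f m.
Proof. unfold bump. destruct (Nat.leb _ _); [apply pow_le|]; lra. Qed.

(** Invariant of the state: the second summand is the mass of the whole geometric tail of bumps
    still to be placed. *)
Lemma bump_sum f m : rsum (bump f) m + 2 * (/ 2) ^ bump_index f m = 2.
Proof.
  induction m; [simpl; lra|].
  change (rsum (bump f) (S m)) with (rsum (bump f) m + bump f m).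
  change (bump_index f (S m)) with (if Nat.leb (f (bump_index f m)) (S m) then S (bump_index f m) else bump_index f m).
  unfold bump at 2. destruct (Nat.leb _ _); simpl pow; lra.
Qed.

Lemma profile_sum f m : rsum (profile f) (S m) + profile f m = 2 * (1 + rsum (bump f) m).
Proof.
  induction m; [simpl; lra|].
  change (rsum (profile f) (S (S m))) with (rsum (profile f) (S m) + profile f (S m)).
  change (rsum (bump f) (S m)) with (rsum (bump f) m + bump f m).
  change (profile f (S m)) with (profile f m / 2 + bump f m). lra.
Qed.

Lemma profile_pos f m : (/ 2) ^ m <= profile f m.
Proof.
  induction m; [simpl; lra|]. change (profile f (S m)) with (profile f m / 2 + bump f m).
  pose proof (bump_ge0 f m). simpl pow. lra.
Qed.

Lemma profile_admissible f : admissible (profile f).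
Proof.
  assert (Hp : forall m, 0 < profile f m) by (intros m; eapply Rlt_le_trans; [|apply profile_pos]; apply pow_lt; lra).
  assert (Hb : forall n, rsum (profile f) n <= 6).
  { intros [|n]; [simpl; lra|]. pose proof (profile_sum f n). pose proof (bump_sum f n). specialize (Hp n).
    assert (0 < (/ 2) ^ bump_index f n) by (apply pow_lt; lra). lra. }
  assert (He : ex_series (profile f)) by (apply ex_series_bounded with 6; auto; intros; left; auto).
  split; [reflexivity|]. split; [auto|].
  split; [|split; [apply profile_pos|split; [auto|apply Series_le_bound; auto]]].
  intros m. change (profile f (S m)) with (profile f m / 2 + bump f m). pose proof (bump_ge0 f m). lra.
Qed.

(** While bump [i] waits, the state stays at [i]; [n] bounds the number of scales still to be
    skipped. *)
Lemma bump_wait f i n m : bump_index f m = i -> (f i <= S m + n)%nat ->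
  exists m', bump_index f m' = i /\ (f i <= S m')%nat.
Proof.
  revert m. induction n; intros m Hm Hn; [exists m; split; [auto|lia]|].
  destruct (Nat.leb_spec (f i) (S m)) as [L|L]; [exists m; auto|].
  apply (IHn (S m)); [|lia]. cbn [bump_index]. rewrite Hm. destruct (Nat.leb_spec (f i) (S m)); [lia|auto].
Qed.

Lemma bump_reached f i : exists m, bump_index f m = i /\ (f i <= S m)%nat.
Proof.
  induction i as [|i [m [M1 M2]]].
  - apply (bump_wait f 0%nat (f 0%nat) 0%nat); [auto|lia].
  - apply (bump_wait f (S i) (f (S i)) (S m)); [|lia]. cbn [bump_index]. rewrite M1.
    destruct (Nat.leb_spec (f i) (S m)); [auto|lia].
Qed.

Lemma profile_bump f i : exists m, (f i <= m)%nat /\ (/ 2) ^ i <= profile f m.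
Proof.
  destruct (bump_reached f i) as [m [M1 M2]]. exists (S m). split; auto.
  change (profile f (S m)) with (profile f m / 2 + bump f m). unfold bump. rewrite M1.
  destruct (Nat.leb_spec (f i) (S m)); [|lia]. pose proof (profile_pos f m).
  assert (0 < (/ 2) ^ m) by (apply pow_lt; lra). lra.
Qed.

Lemma pow_quarter_small (b : R) : 0 < b -> exists N, forall m, (m >= N)%nat -> (/ 4) ^ m < b.
Proof.
  intros Hb. destruct (pow_lt_1_zero (/ 4) ltac:(rewrite Rabs_pos_eq; lra) b Hb) as [N HN]. exists N. intros m Hm.
  specialize (HN m Hm). rewrite Rabs_pos_eq in HN; auto. apply pow_le; lra.
Qed.

(** When [eta k] is at most [4 ^ (- i) / 2700], a bump [d m >= 2 ^ (- i)] with
    [lam m * (4 k + 1) <= 1] suffices: by [Pr_ge_term], [P] is at least [exp (- 2) / 6 >= 1 / 54]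
    times [4 ^ (- i)] on the relevant range [t <= 4 k + 1]. [symbol_decay] divides by 50, and 54
    times 50 is 2700. *)
Lemma symbol_exists (eta : nat -> R) : Un_cv eta 0 ->
  exists phi, Analytic phi /\ (forall z, Cmod z < 1 -> Cmod (phi z) < 1) /\
    (forall w, Cmod w < 1 -> exists z, Cmod z < 1 /\ phi z = w) /\
    (forall w (l : list C), NoDup l -> (forall z, In z l -> Cmod z < 1 /\ phi z = w) -> (length l <= 4)%nat) /\
    exists k0, forall k, (k >= k0)%nat -> forall z, Cmod z < 1 -> exp (- (4 * INR k)) <= Cmod (1 - z) -> Cmod (phi z) <= exp (- eta k).
Proof.
  intros Heta.
  (* As [eta] tends to 0, only finitely many [k] lie above the threshold of index [i], so one scale
     [f i] is late enough for all of them; [profile] puts bump [i] beyond it. *)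
  assert (Hf : forall i, exists N, forall m, (m >= N)%nat -> forall k, / 2700 * (/ 4) ^ S i < eta k -> lam m * (4 * INR k + 1) <= 1).
  { intros i. assert (Hp : 0 < / 2700 * (/ 4) ^ S i) by (apply Rmult_lt_0_compat; [lra|apply pow_lt; lra]).
    destruct (Heta _ Hp) as [N HN].
    assert (HNp : 0 < 4 * INR N + 1) by (pose proof (pos_INR N); lra).
    destruct (pow_quarter_small (/ (4 * INR N + 1))) as [N1 HN1]; [apply Rinv_0_lt_compat; auto|].
    exists N1. intros m Hm k Hk. specialize (HN1 m Hm).
    assert (HkN : (k < N)%nat).
    { destruct (Nat.lt_ge_cases k N) as [|Hge]; auto. specialize (HN k Hge). unfold Rdist in HN.
      rewrite Rminus_0_r in HN.
      apply Rabs_def2 in HN. lra. }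
    apply lt_INR in HkN. apply (Rmult_lt_compat_r (4 * INR N + 1)) in HN1; auto. rewrite Rinv_l in HN1 by lra.
    assert (lam m <= (/ 4) ^ m).
    { unfold lam, s0. assert (0 < (/ 4) ^ m) by (apply pow_lt; lra). lra. }
    pose proof (lam_pos m). nra. }
  destruct (choice _ Hf) as [f Hf']. clear Hf.
  pose proof (profile_admissible f) as Hd. set (d := profile f) in *.
  exists (symbol d).
  split; [apply Analytic_symbol; auto|]. split; [apply symbol_disc; auto|]. split; [apply symbol_surj; auto|].
  split; [apply symbol_four_valent; auto|].
  destruct (Heta (/ 2700) ltac:(lra)) as [k0 Hk0]. exists k0. intros k Hk z Hz H1z.
  specialize (Hk0 k Hk). unfold Rdist in Hk0. rewrite Rminus_0_r in Hk0. apply Rabs_def2 in Hk0.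
  destruct (Rle_dec (eta k) 0) as [Hle|Hgt].
  { eapply Rle_trans; [left; apply symbol_disc; auto|]. rewrite <- exp_0. apply exp_mono. lra. }
  assert (Hi : exists i, / 2700 * (/ 4) ^ S i < eta k <= / 2700 * (/ 4) ^ i).
  { destruct (pow_quarter_small (2700 * eta k)) as [N HN]; [lra|]. specialize (HN N (Nat.le_refl N)).
    assert (HN' : / 2700 * (/ 4) ^ N < eta k) by lra. clear HN. induction N; [simpl in HN'; lra|].
    destruct (Rlt_le_dec (/ 2700 * (/ 4) ^ N) (eta k)); [auto|]. exists N. lra. }
  destruct Hi as [i [Hi1 Hi2]]. destruct (profile_bump f i) as [m [Hm1 Hm2]]. fold d in Hm2.
  specialize (Hf' i m Hm1 k Hi1).
  assert (Hp : 0 < (/ 2) ^ i) by (apply pow_lt; lra).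
  assert (H4 : (/ 4) ^ i = ((/ 2) ^ i) ^ 2) by (rewrite <- pow_mult, Nat.mul_comm, pow_mult; f_equal; field).
  assert (Hp1 : (/ 4) ^ i <= 1) by (rewrite <- (pow1 i); apply pow_incr; lra).
  set (t := Re (zeta z)). assert (Ht0 : 0 < t) by (apply Re_zeta_pos; auto).
  assert (Ht : t <= 4 * INR k + 1).
  { unfold t. rewrite Re_zeta by auto. assert (- (4 * INR k) <= ln (Cmod (1 - z))).
    { rewrite <- (ln_exp (- (4 * INR k))).
      destruct H1z as [L|E]; [left; apply ln_increasing; auto; apply exp_pos|rewrite E; lra]. }
    lra. }
  apply Rle_trans with (exp (- (((/ 4) ^ i / 54) / 50))); [|apply exp_mono; lra].
  apply symbol_decay; auto; [lra|]. fold t.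
  eapply Rle_trans; [|apply (Pr_ge_term d m t Hd); lra].
  assert (He : / 9 <= exp (- (2 * lam m) * t)).
  { apply Rle_trans with (exp (Ropp 2)).
    - rewrite exp_Ropp. apply Rinv_le_contravar; [apply exp_pos|]. replace 2 with (1 + 1) by ring. rewrite exp_plus.
      pose proof exp_le_3. pose proof (exp_pos 1). nra.
    - apply exp_mono. nra. }
  assert ((/ 4) ^ i <= d m ^ 2) by (rewrite H4; apply pow_incr; lra).
  assert (/ 9 * (/ 4) ^ i <= exp (- (2 * lam m) * t) * d m ^ 2) by (apply Rmult_le_compat; lra). lra.
Qed.

(** * Composition operators on H^2 *)

Definition toC (z : Cplx) : C := (Defs.Re z, Defs.Im z).
Definition ofC (z : C) : Cplx := mkC (fst z) (snd z).

Lemma toC_ofC z : toC (ofC z) = z.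
Proof. destruct z; reflexivity. Qed.

Lemma ofC_toC z : ofC (toC z) = z.
Proof. destruct z; reflexivity. Qed.

Lemma toC_inj z w : toC z = toC w -> z = w.
Proof. intros H. rewrite <- (ofC_toC z), <- (ofC_toC w), H. auto. Qed.

Lemma Cmod_toC z : Cmod (toC z) = Defs.Cmod z.
Proof. reflexivity. Qed.

Lemma toC_mul z w : toC (Cmul z w) = (toC z * toC w)%C.
Proof. reflexivity. Qed.

Lemma toC_add z w : toC (Cadd z w) = (toC z + toC w)%C.
Proof. reflexivity. Qed.

Lemma toC_sub z w : toC (Csub z w) = (toC z - toC w)%C.
Proof. reflexivity. Qed.

Lemma toC_pow z n : toC (Defs.Cpow z n) = (toC z ^ n)%C.
Proof. induction n; [reflexivity|]. simpl Defs.Cpow. rewrite toC_mul, IHn. reflexivity. Qed.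

Lemma toC_Csum a n : toC (Csum a n) = csum (fun k => toC (a k)) (S n).
Proof.
  induction n.
  - simpl. rewrite Cplus_0_l. reflexivity.
  - simpl Csum. rewrite toC_add, IHn. reflexivity.
Qed.

Lemma Cseries_cv_summable a l : summable (fun k => toC (a k)) -> toC l = CS (fun k => toC (a k)) -> Cseries_cv a l.
Proof.
  intros H Hl eps He. destruct (csum_lim _ H eps He) as [N HN]. exists N. intros n Hn.
  rewrite <- Cmod_toC, toC_sub, toC_Csum, Hl. apply HN. lia.
Qed.

Lemma Cseries_cv_unique a l : Cseries_cv a l -> toC l = CS (fun k => toC (a k)).
Proof.
  intros H. symmetry. apply CS_unique_lim. intros eps He. destruct (H eps He) as [N HN]. exists (S N).
  intros [|n] Hn; [lia|].
  rewrite <- toC_Csum, <- toC_sub, Cmod_toC. apply HN. lia.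
Qed.

Definition l2 (f : nat -> C) : Prop := ex_series (fun k => Cmod (f k) ^ 2).

Lemma in_H2_l2 f : in_H2 f <-> l2 (fun k => toC (f k)).
Proof.
  split; intros [s Hs]; exists s; apply is_series_Reals; exact Hs.
Qed.

Lemma H2_norm_eq f : in_H2 f -> H2_norm f = sqrt (Series (fun k => Cmod (toC (f k)) ^ 2)).
Proof.
  intros H. unfold H2_norm. f_equal. symmetry. apply is_series_unique, is_series_Reals.
  exact (epsilon_spec (inhabits 0) (fun s => H2_norm2_is f s) H).
Qed.

Lemma Series_sq_nonneg f : l2 f -> 0 <= Series (fun k => Cmod (f k) ^ 2).
Proof. intros H. apply Series_nonneg; auto. intros; apply pow2_ge_0. Qed.

Lemma Cauchy_Schwarz_Series a b : (forall k, 0 <= a k) -> (forall k, 0 <= b k) ->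
  ex_series (fun k => a k ^ 2) -> ex_series (fun k => b k ^ 2) ->
  ex_series (fun k => a k * b k) /\ Series (fun k => a k * b k) ^ 2 <= Series (fun k => a k ^ 2) * Series (fun k => b k ^ 2).
Proof.
  intros Ha Hb HA HB.
  assert (HS : ex_series (fun k => a k * b k)).
  { eapply ex_series_dom; [|apply (ex_series_rplus _ _ HA HB)]. intros k. specialize (Ha k). specialize (Hb k).
    rewrite Rabs_pos_eq by (apply Rmult_le_pos; auto). nra. }
  split; auto. set (A := Series (fun k => a k ^ 2)). set (B := Series (fun k => b k ^ 2)).
  set (S := Series (fun k => a k * b k)).
  assert (K : forall l, 0 <= l ^ 2 * A - 2 * l * S + B).
  { intros l. assert (E : l ^ 2 * A - 2 * l * S + B = Series (fun k => (l * a k - b k) ^ 2)).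
    { unfold A, B, S. rewrite <- !Series_scal_l, <- Series_minus, <- Series_plus.
      - apply Series_ext. intros; ring.
      - apply (ex_series_minus (V:=R_NormedModule)); apply ex_series_rscal; auto.
      - auto.
      - apply ex_series_rscal; auto.
      - apply ex_series_rscal; auto. }
    rewrite E. apply Series_nonneg; [intros; apply pow2_ge_0|].
    apply (ex_series_rext (fun k => (l ^ 2 * a k ^ 2 - 2 * l * (a k * b k)) + b k ^ 2)); [intros; ring|].
    apply ex_series_rplus; auto. apply (ex_series_minus (V:=R_NormedModule)); apply ex_series_rscal; auto. }
  assert (HA0 : 0 <= A) by (apply Series_nonneg; auto; intros; apply pow2_ge_0).
  assert (HS0 : 0 <= S) by (apply Series_nonneg; auto; intros; apply Rmult_le_pos; auto).
  destruct (Req_dec A 0) as [E|E].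
  (* In the degenerate case [A = 0] the quadratic form is affine in [l], and a positive [S] would
     make it negative for large [l]. *)
  - assert (S = 0); [|nra]. apply Rle_antisym; auto. apply Rnot_lt_le. intros L.
    specialize (K ((B + 1) / (2 * S))). rewrite E in K.
    replace (2 * ((B + 1) / (2 * S)) * S) with (B + 1) in K by (field; lra). lra.
  - specialize (K (S / A)).
    replace ((S / A) ^ 2 * A - 2 * (S / A) * S + B) with (B - S ^ 2 / A) in K by (field; auto).
    assert (K' : S ^ 2 / A <= B) by lra. apply (Rmult_le_compat_r A) in K'; auto.
    replace (S ^ 2 / A * A) with (S ^ 2) in K' by (field; auto). lra.
Qed.

Lemma Cauchy_Schwarz_CS x y : l2 x -> l2 y ->
  summable (fun k => (x k * y k)%C) /\
  Cmod (CS (fun k => (x k * y k)%C)) ^ 2 <= Series (fun k => Cmod (x k) ^ 2) * Series (fun k => Cmod (y k) ^ 2).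
Proof.
  intros Hx Hy.
  destruct (Cauchy_Schwarz_Series (fun k => Cmod (x k)) (fun k => Cmod (y k))) as [H1 H2]; auto using Cmod_ge_0.
  assert (Hs : summable (fun k => (x k * y k)%C)).
  { eapply summable_dom; [|apply H1]. intros k. rewrite Cmod_mult. lra. }
  split; auto. eapply Rle_trans; [|apply H2]. apply pow_incr. split; [apply Cmod_ge_0|].
  eapply Rle_trans; [apply Cmod_CS_le; auto|]. right. apply Series_ext. intros; apply Cmod_mult.
Qed.

Lemma l2_shift f N : l2 f -> l2 (fun k => f (N + k)%nat) /\ Series (fun k => Cmod (f (N + k)%nat) ^ 2) <= Series (fun k => Cmod (f k) ^ 2).
Proof.
  intros H. assert (H1 : l2 (fun k => f (N + k)%nat)) by (apply (ex_series_incr_n (fun k => Cmod (f k) ^ 2) N); auto).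
  split; auto. rewrite (Series_incr_rsum _ N H).
  assert (0 <= rsum (fun k => Cmod (f k) ^ 2) N) by (apply rsum_ge0; intros; apply pow2_ge_0). lra.
Qed.

Lemma l2_PS_summable g z : l2 g -> Cmod z < 1 -> summable (fun n => (g n * z ^ n)%C).
Proof.
  intros H Hz. pose proof (Cmod_ge_0 z).
  eapply summable_dom; [|apply (ex_series_rscal (1 + Series (fun k => Cmod (g k) ^ 2))), (ex_series_geom_pos (Cmod z)); lra].
  intros n. rewrite Cmod_mult, Cmod_pow. apply Rmult_le_compat_r; [apply pow_le; auto|].
  pose proof (term_le_Series (fun k => Cmod (g k) ^ 2) n (fun k => pow2_ge_0 _) H). cbv beta in *. nra.
Qed.

(* [p k] are the Taylor coefficients of [phi ^ k] and [tau k] bounds the square of their l^2 norm;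
   summability of [tau] makes the composition operator Hilbert-Schmidt. *)
Section HilbertSchmidt.
Context (phi : C -> C) (p : nat -> nat -> C) (tau : nat -> R).
Context (Hp : forall k, PS (p k) (fun z => (phi z ^ k)%C)).
Context (Htau : ex_series tau) (Hptau : forall k, l2 (p k) /\ Series (fun n => Cmod (p k n) ^ 2) <= tau k).

Definition phiD (z : Cplx) : Cplx := ofC (phi (toC z)).
Definition comp_coef (f : nat -> C) (n : nat) : C := CS (fun k => (f k * p k n)%C).

Lemma tau_ge0 k : 0 <= tau k.
Proof. destruct (Hptau k) as [H1 H2]. pose proof (Series_sq_nonneg _ H1). lra. Qed.

Lemma p_le_tau k n : Cmod (p k n) ^ 2 <= tau k.
Proof.
  destruct (Hptau k) as [H1 H2]. eapply Rle_trans; [|apply H2].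
  apply (term_le_Series (fun n => Cmod (p k n) ^ 2)); auto. intros; apply pow2_ge_0.
Qed.

Lemma l2_column n : l2 (fun k => p k n).
Proof. eapply ex_series_dom; [|apply Htau]. intros k. rewrite Rabs_pos_eq by apply pow2_ge_0. apply p_le_tau. Qed.

Lemma comp_coef_PS f : l2 f -> PS (comp_coef f) (fun z => CS (fun k => (f k * phi z ^ k)%C)) /\
  forall z, Cmod z < 1 -> summable (fun k => (f k * phi z ^ k)%C).
Proof.
  intros Hf. apply (PS_sum (fun k n => (f k * p k n)%C) (fun k z => (f k * phi z ^ k)%C)).
  - intros k. apply (PSC_scal (f k) (p k) (fun z => (phi z ^ k)%C)), Hp.
  - intros r Hr. exists (fun k => Cmod (f k) ^ 2 + tau k). split; [apply ex_series_rplus; auto|].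
    intros k n. rewrite Cmod_mult. pose proof (p_le_tau k n).
    assert (0 <= r ^ n <= 1) by (split; [apply pow_le; lra|rewrite <- (pow1 n); apply pow_incr; lra]).
    pose proof (pow2_ge_0 (Cmod (f k) - Cmod (p k n))).
    nra.
Qed.

(** Cauchy-Schwarz in [k] for each coefficient [n], then summation over [n] by [Fubini_le]: the tail
    is controlled by its Hilbert-Schmidt norm. For [N = 0] it is the whole operator. *)
Lemma tail_bound f N : l2 f ->
  l2 (fun n => CS (fun k => (f (N + k)%nat * p (N + k)%nat n)%C)) /\
  Series (fun n => Cmod (CS (fun k => (f (N + k)%nat * p (N + k)%nat n)%C)) ^ 2)
    <= Series (fun k => Cmod (f k) ^ 2) * Series (fun k => tau (N + k)%nat).
Proof.
  intros Hf. destruct (l2_shift f N Hf) as [Hs1 Hs2].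
  assert (HtN : ex_series (fun k => tau (N + k)%nat)) by (apply (ex_series_incr_n tau N); auto).
  destruct (Fubini_le (fun k n => Cmod (p (N + k)%nat n) ^ 2) (fun k => tau (N + k)%nat)) as [F1 F2].
  - intros; apply pow2_ge_0.
  - intros; apply Hptau.
  - intros; apply Hptau.
  - auto.
  - set (A := Series (fun k => Cmod (f k) ^ 2)) in *. assert (HA : 0 <= A) by (apply Series_sq_nonneg; auto).
    assert (Hn : forall n, 0 <= Cmod (CS (fun k => (f (N + k)%nat * p (N + k)%nat n)%C)) ^ 2 <= A * Series (fun k => Cmod (p (N + k)%nat n) ^ 2)).
    { intros n. split; [apply pow2_ge_0|]. destruct (l2_shift _ N (l2_column n)) as [Hc _].
      destruct (Cauchy_Schwarz_CS _ _ Hs1 Hc) as [_ C2]. eapply Rle_trans; [apply C2|].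
      apply Rmult_le_compat_r; auto. apply (Series_sq_nonneg (fun k => p (N + k)%nat n)); auto. }
    assert (He : ex_series (fun n => A * Series (fun k => Cmod (p (N + k)%nat n) ^ 2))) by (apply ex_series_rscal; auto).
    split.
    + eapply ex_series_dom; [|apply He]. intros n. destruct (Hn n). rewrite Rabs_pos_eq; auto.
    + eapply Rle_trans; [apply Series_le; [apply Hn|auto]|]. rewrite Series_scal_l. apply Rmult_le_compat_l; auto.
Qed.

Lemma comp_coef_l2 f : l2 f -> l2 (comp_coef f).
Proof. intros Hf. apply (tail_bound f 0 Hf). Qed.

(** [Cphi] is a choice among the H^2 sequences that represent the composition. The matrix formula
    [comp_coef] provides one, and uniqueness of Taylor coefficients identifies the chosen sequence
    with it. *)
Lemma Cphi_eq f : in_H2 f -> in_H2 (Cphi phiD f) /\ forall n, toC (Cphi phiD f n) = comp_coef (fun k => toC (f k)) n.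
Proof.
  intros Hf. apply in_H2_l2 in Hf. set (F := fun k => toC (f k)) in *.
  destruct (comp_coef_PS F Hf) as [P1 P2].
  assert (Hex : exists g, in_H2 g /\ composes phiD f g).
  { exists (fun n => ofC (comp_coef F n)). split.
    - apply in_H2_l2. apply (ex_series_rext (fun k => Cmod (comp_coef F k) ^ 2)); [|apply comp_coef_l2; auto].
      intros n. rewrite toC_ofC. auto.
    - intros z Hz. change (Cmod (toC z) < 1) in Hz. exists (ofC (CS (fun k => (F k * phi (toC z) ^ k)%C))).
      destruct (P1 (toC z) Hz) as [Q1 Q2]. split.
      + assert (E : forall k, toC (Cmul (f k) (Defs.Cpow (phiD z) k)) = (F k * phi (toC z) ^ k)%C).
        { intros k. rewrite toC_mul, toC_pow. unfold phiD. rewrite toC_ofC. reflexivity. }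
        apply Cseries_cv_summable.
        * eapply summable_ext; [intros k; symmetry; apply E|]. auto.
        * rewrite toC_ofC. apply CS_ext. intros; symmetry; apply E.
      + assert (E : forall k, toC (Cmul (ofC (comp_coef F k)) (Defs.Cpow z k)) = (comp_coef F k * toC z ^ k)%C).
        { intros k. rewrite toC_mul, toC_pow, toC_ofC. reflexivity. }
        apply Cseries_cv_summable.
        * eapply summable_ext; [intros k; symmetry; apply E|]. auto.
        * rewrite toC_ofC, Q2. apply CS_ext. intros; symmetry; apply E. }
  destruct (epsilon_spec (inhabits (fun _ : nat => C0)) (fun g => in_H2 g /\ composes phiD f g) Hex) as [G1 G2].
  change (in_H2 (Cphi phiD f)) in G1. change (composes phiD f (Cphi phiD f)) in G2.
  split; auto. set (g := Cphi phiD f) in *.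
  apply (PS_unique _ _ (fun z => CS (fun k => (F k * phi z ^ k)%C))); auto.
  intros z Hz. pose proof (l2_PS_summable (fun k => toC (g k)) z (proj1 (in_H2_l2 g) G1) Hz) as Hs. split; auto.
  destruct (G2 (ofC z)) as [w [W1 W2]]; [unfold in_disc; rewrite <- Cmod_toC, toC_ofC; auto|].
  apply Cseries_cv_unique in W1. apply Cseries_cv_unique in W2. transitivity (toC w).
  - rewrite W1. apply CS_ext. intros k. rewrite toC_mul, toC_pow. unfold phiD. rewrite !toC_ofC. reflexivity.
  - rewrite W2. apply CS_ext. intros k. rewrite toC_mul, toC_pow, toC_ofC. reflexivity.
Qed.

Definition truncation (N : nat) : op := fun f n => ofC (csum (fun k => (toC (f k) * p k n)%C) N).

Lemma truncation_linear N : op_linear (truncation N).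
Proof.
  intros f g a b _ _ n. apply toC_inj. unfold truncation. rewrite toC_add, !toC_mul, !toC_ofC.
  rewrite <- !csum_scal, <- csum_plus. apply csum_ext. intros k _. rewrite toC_add, !toC_mul. ring.
Qed.

Lemma lincomb_csum (f : cseq) (P : nat -> cseq) m s n :
  toC (lincomb (map f (seq s m)) (map P (seq s m)) n) = csum (fun k => (toC (f (s + k)%nat) * toC (P (s + k)%nat n))%C) m.
Proof.
  revert s. induction m; intros s; [reflexivity|].
  rewrite csum_incr_1. simpl. rewrite toC_add, toC_mul, IHm, Nat.add_0_r. f_equal.
  apply csum_ext. intros k _. rewrite Nat.add_succ_r. reflexivity.
Qed.

Lemma truncation_rank N : rank_lt (truncation N) (S N).
Proof.
  exists (map (fun k n => ofC (p k n)) (seq 0 N)). split; [|split].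
  - rewrite length_map, length_seq. lia.
  - intros v Hv. apply in_map_iff in Hv. destruct Hv as [k [<- _]]. apply in_H2_l2.
    destruct (Hptau k) as [H1 _]. eapply ex_series_rext; [|apply H1]. intros n. simpl. rewrite toC_ofC. auto.
  - intros f Hf. exists (map f (seq 0 N)). split; [rewrite !length_map; auto|].
    intros n. apply toC_inj. rewrite lincomb_csum. unfold truncation. rewrite toC_ofC. apply csum_ext.
    intros k _. rewrite toC_ofC. reflexivity.
Qed.

(** Keeping [N] terms gives rank at most [N], which competes for the approximation number of index
    [N + 1]; the remainder starts at [k = N]. *)
Lemma approx_bounds_tail N : approx_bounds (Cphi phiD) (S N) (sqrt (Series (fun k => tau (N + k)%nat))).
Proof.
  exists (truncation N). split; [apply truncation_linear|]. split; [apply truncation_rank|].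
  intros f Hf. destruct (Cphi_eq f Hf) as [G1 G2]. pose proof (proj1 (in_H2_l2 f) Hf) as Hl.
  set (F := fun k => toC (f k)) in *. destruct (tail_bound F N Hl) as [T1 T2].
  assert (E : forall n, toC (Csub (Cphi phiD f n) (truncation N f n)) = CS (fun k => (F (N + k)%nat * p (N + k)%nat n)%C)).
  { intros n. rewrite toC_sub, G2. unfold truncation. rewrite toC_ofC. unfold comp_coef.
    destruct (Cauchy_Schwarz_CS F _ Hl (l2_column n)) as [S1 _]. rewrite (CS_incr_n _ N S1). fold F.
    change (fun k => (toC (f k) * p k n)%C) with (fun k => (F k * p k n)%C). ring. }
  assert (Hin : in_H2 (fun k => Csub (Cphi phiD f k) (truncation N f k))).
  { apply in_H2_l2. eapply ex_series_rext; [|apply T1]. intros n. cbv beta. rewrite E. auto. }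
  split; auto. rewrite !H2_norm_eq by auto.
  rewrite <- sqrt_mult.
  - apply sqrt_le_1_alt. rewrite Rmult_comm. eapply Rle_trans; [|apply T2]. right. apply Series_ext. intros n.
    rewrite E. auto.
  - apply Series_nonneg; [intros; apply tau_ge0|]. apply (ex_series_incr_n tau N); auto.
  - apply Series_sq_nonneg; auto.
Qed.

Lemma bounded_Cphi : bounded_op (Cphi phiD).
Proof.
  exists (sqrt (Series (fun k => tau (0 + k)%nat))). intros f Hf. destruct (Cphi_eq f Hf) as [G1 G2]. split; auto.
  pose proof (proj1 (in_H2_l2 f) Hf) as Hl. destruct (tail_bound _ 0 Hl) as [T1 T2].
  rewrite !H2_norm_eq by auto. rewrite <- sqrt_mult.
  - apply sqrt_le_1_alt. rewrite Rmult_comm. eapply Rle_trans; [|apply T2]. right. apply Series_ext. intros n.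
    rewrite G2. reflexivity.
  - apply Series_nonneg; [intros; apply tau_ge0|]. auto.
  - apply (Series_sq_nonneg (fun k => toC (f k))); auto.
Qed.

End HilbertSchmidt.

(** * Approximation numbers *)

(** Tested on the first unit vector. Nonnegativity gives the set of bounds an infimum, so that the
    choice made in [Rinf] is meaningful. *)
Lemma op_bound_ge0 T c : op_bound T c -> 0 <= c.
Proof.
  intros H. set (e := fun k => ofC (one_coef k)).
  assert (Hs : is_series (fun k => Cmod (toC (e k)) ^ 2) 1).
  { apply (Series_unique_lim (fun k => Cmod (toC (e k)) ^ 2)). intros eps He. exists 1%nat. intros n Hn.
    replace (rsum (fun k => Cmod (toC (e k)) ^ 2) n) with 1; [rewrite Rminus_diag, Rabs_R0; auto|].
    destruct n as [|n]; [lia|]. clear Hn. induction n.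
    - simpl rsum. unfold e. rewrite toC_ofC. simpl. rewrite Cmod_1. ring.
    - change (1 = rsum (fun k => Cmod (toC (e k)) ^ 2) (S n) + Cmod (toC (e (S n))) ^ 2).
      rewrite <- IHn. unfold e. rewrite toC_ofC. simpl. rewrite Cmod_0. ring. }
  assert (He : in_H2 e) by (apply in_H2_l2; exists 1; exact Hs).
  destruct (H e He) as [_ H2]. rewrite (H2_norm_eq e He), (is_series_unique _ _ Hs), sqrt_1 in H2.
  assert (0 <= H2_norm (T e)) by apply sqrt_pos. lra.
Qed.

Lemma glb_exists (E : R -> Prop) c : E c -> (forall x, E x -> 0 <= x) -> exists m, is_glb E m.
Proof.
  intros Hc H0.
  destruct (completeness (fun x => E (- x))) as [m [M1 M2]].
  - exists 0. intros x Hx. specialize (H0 _ Hx). lra.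
  - exists (- c). rewrite Ropp_involutive. auto.
  - exists (- m). split.
    + intros x Hx. assert (- x <= m); [|lra]. apply M1. rewrite Ropp_involutive. auto.
    + intros b Hb. assert (m <= - b); [|lra]. apply M2. intros x Hx. specialize (Hb _ Hx). lra.
Qed.

Lemma approx_number_bounds T n c : approx_bounds T n c -> 0 <= approx_number T n <= c.
Proof.
  intros H. assert (H0 : forall x, approx_bounds T n x -> 0 <= x).
  { intros x [R0 [_ [_ Hb]]]. apply (op_bound_ge0 _ _ Hb). }
  pose proof (epsilon_spec (inhabits 0) (fun m => is_glb (approx_bounds T n) m) (glb_exists _ c H H0)) as [G1 G2].
  split; [apply G2; exact H0|apply G1; exact H].
Qed.

Lemma bernoulli_le x n : 0 <= x <= 1 -> 1 - INR n * x <= (1 - x) ^ n.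
Proof.
  intros Hx. induction n; [simpl; lra|]. rewrite S_INR. simpl pow.
  assert ((1 - x) ^ n <= 1) by (replace 1 with (1 ^ n) at 2 by apply pow1; apply pow_incr; lra).
  assert (x * (1 - x) ^ n <= x) by nra. lra.
Qed.

(** The passage of [r] to 1 in a finite sum, made explicit with [r = 1 - x] and Bernoulli's
    inequality; all exponents are below [2 N]. *)
Lemma rsum_radius_limit c M N : (forall j, 0 <= c j) ->
  (forall r, 0 <= r < 1 -> rsum (fun j => c j * (r ^ j) ^ 2) N <= M) -> rsum c N <= M.
Proof.
  intros H0 H. apply le_epsilon. intros eps He.
  set (S := rsum c N). assert (HS : 0 <= S) by (apply rsum_ge0; auto).
  set (B := 2 * INR N * S + 1). assert (HB : 1 <= B) by (unfold B; pose proof (pos_INR N); nra).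
  set (x := Rmin (1 / 2) (eps / B)).
  assert (Hx : 0 < x) by (apply Rmin_pos; [lra|apply Rdiv_lt_0_compat; lra]).
  assert (Hx1 : x <= 1 / 2) by apply Rmin_l.
  assert (Hx2 : x * B <= eps).
  { assert (h : x <= eps / B) by apply Rmin_r. apply (Rmult_le_compat_r B) in h; [|lra].
    replace (eps / B * B) with eps in h by (field; lra). auto. }
  specialize (H (1 - x) ltac:(lra)).
  assert (K : (1 - INR (N * 2) * x) * S <= M).
  { eapply Rle_trans; [|apply H]. unfold S. rewrite <- rsum_scal. apply rsum_le. intros k Hk.
    rewrite Rmult_comm. apply Rmult_le_compat_l; auto. rewrite <- pow_mult.
    eapply Rle_trans; [|apply bernoulli_le; lra].
    apply Rplus_le_compat_l, Ropp_le_contravar, Rmult_le_compat_r; [lra|]. apply le_INR. lia. }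
  rewrite mult_INR in K. simpl (INR 2) in K. unfold B in Hx2. fold S. nra.
Qed.

(** * Harmonic majorants and the norms of the powers of the symbol *)

Lemma PS_at_0 b g : PS b g -> b 0%nat = g 0.
Proof.
  intros H. destruct (H 0) as [H1 ->]; [rewrite Cmod_0; lra|].
  apply eq_sym, CS_at_0.
Qed.

Lemma norm_majorant a f g : PS a f -> Analytic g -> (forall z, Cmod z < 1 -> Cmod (f z) ^ 2 <= Re (g z)) ->
  l2 a /\ Series (fun n => Cmod (a n) ^ 2) <= Re (g 0).
Proof.
  intros Hf [b Hg] Hm.
  assert (Hb : forall N, rsum (fun n => Cmod (a n) ^ 2) N <= Re (g 0)).
  { intros N. apply rsum_radius_limit; [intros; apply pow2_ge_0|]. intros r Hr. rewrite <- (PS_at_0 b g Hg).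
    apply (Parseval_majorant a b f g r N Hf Hg Hr). intros z Hz. apply Hm. lra. }
  assert (Hl : l2 a) by (apply ex_series_bounded with (Re (g 0)); auto; intros; apply pow2_ge_0).
  split; auto. apply Series_le_bound; auto.
Qed.

(* [(1 - z)^(-1/2)], used as a positive harmonic majorant near the boundary point 1. *)
Definition peak (z : C) : C := cexp (/ 2 * clogm z).

Lemma Analytic_peak : Analytic peak.
Proof. apply (Analytic_cexp (fun z => / 2 * clogm z)%C), Analytic_scal. eexists; apply PS_clogm. Qed.

Lemma peak_0 : peak 0 = 1.
Proof. unfold peak. rewrite clogm_0. replace (/ 2 * 0)%C with (RtoC 0) by ring. apply cexp_0. Qed.

(** The argument of [1 - z] is below pi/2 in absolute value, so that of [peak z] is below pi/4: the
    real part is comparable to the modulus. *)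
Lemma Re_peak z : Cmod z < 1 -> exp (- ln (Cmod (1 - z)) / 2) / 2 <= Re (peak z).
Proof.
  intros Hz. unfold peak, cexp. rewrite re_scal_l.
  rewrite <- RtoC_inv, re_scal_l, im_scal_l by lra.
  pose proof (Re_zeta z Hz) as E. unfold zeta in E. rewrite re_plus in E. simpl (Re 1) in E.
  replace (Re (clogm z)) with (- ln (Cmod (1 - z))) by lra.
  replace (/ 2 * - ln (Cmod (1 - z))) with (- ln (Cmod (1 - z)) / 2) by field.
  apply Rmult_le_compat_l; [left; apply exp_pos|].
  pose proof (Im_zeta z) as Hi. unfold zeta in Hi. rewrite im_plus in Hi. simpl (Im 1) in Hi. pose proof PI_bounds.
  set (y := Im (clogm z)) in *. simpl.
  pose proof (cos_ge_quadratic (/ 2 * y) ltac:(apply Rabs_le; lra)). nra.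
Qed.

Lemma pow_norm_bound phi k p eta : Analytic phi -> (forall z, Cmod z < 1 -> Cmod (phi z) < 1) ->
  PS p (fun z => (phi z ^ k)%C) ->
  (forall z, Cmod z < 1 -> exp (- (4 * INR k)) <= Cmod (1 - z) -> Cmod (phi z) <= exp (- eta)) ->
  l2 p /\ Series (fun n => Cmod (p n) ^ 2) <= exp (- (2 * INR k * eta)) + 2 * exp (- (2 * INR k)).
Proof.
  intros Ha Hd Hp Hdec.
  (* Where |1 - z| < exp (- 4 k), [peak] has real part at least [exp (2 k) / 2], and [B] is the
     constant that lifts this to 1. Elsewhere [A] dominates. Since [peak 0 = 1], the majorant takes
     the value [A + B] at 0. *)
  set (A := exp (- (2 * INR k * eta))). set (B := 2 * exp (- (2 * INR k))).
  assert (HA : 0 < A) by apply exp_pos. assert (HB : 0 < B) by (unfold B; pose proof (exp_pos (- (2 * INR k))); lra).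
  destruct (norm_majorant p (fun z => (phi z ^ k)%C) (fun z => (A + B * peak z)%C) Hp) as [H1 H2].
  - apply Analytic_plus; [apply Analytic_const|apply Analytic_scal, Analytic_peak].
  - intros z Hz. rewrite re_plus, re_scal_l. change (Re A) with A.
    pose proof (Re_peak z Hz) as Hpk. rewrite Cmod_pow.
    pose proof (exp_pos (- ln (Cmod (1 - z)) / 2)) as Hep. pose proof (Cmod_ge_0 (phi z)).
    destruct (Rle_dec (exp (- (4 * INR k))) (Cmod (1 - z))) as [L|L].
    + specialize (Hdec z Hz L). assert (HK : (Cmod (phi z) ^ k) ^ 2 <= A).
      { rewrite <- pow_mult. apply Rle_trans with (exp (- eta) ^ (k * 2)); [apply pow_incr; auto|].
        right. unfold A. rewrite <- (exp_ln (exp (- eta) ^ (k * 2))) by (apply pow_lt, exp_pos).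
        rewrite ln_pow by apply exp_pos. rewrite ln_exp, mult_INR. simpl (INR 2). f_equal. ring. }
      assert (0 <= B * Re (peak z)) by (apply Rmult_le_pos; lra). lra.
    + assert (Hk1 : (Cmod (phi z) ^ k) ^ 2 <= 1).
      { rewrite <- pow_mult, <- (pow1 (k * 2)). apply pow_incr. specialize (Hd z Hz). lra. }
      assert (Hlog : ln (Cmod (1 - z)) <= - (4 * INR k)).
      { rewrite <- (ln_exp (- (4 * INR k))). left. apply ln_increasing; [apply Cmod_gt_0, Cmod_lt_1_neq; auto|lra]. }
      assert (He : exp (2 * INR k) <= exp (- ln (Cmod (1 - z)) / 2)) by (apply exp_mono; lra).
      assert (Hmul : exp (- (2 * INR k)) * exp (2 * INR k) = 1) by (rewrite <- exp_plus, Rplus_opp_l; apply exp_0).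
      assert (1 <= B * Re (peak z)); [|lra].
      apply Rle_trans with (B * (exp (2 * INR k) / 2)); [unfold B; lra|]. apply Rmult_le_compat_l; lra.
  - split; auto. eapply Rle_trans; [apply H2|]. rewrite peak_0, Cmult_1_r. simpl. lra.
Qed.

(** * Choice of the rate *)

(** The sequence [n * eps n] need not be monotone; its running maximum serves every [n <= k + 1] at
    once. *)
Fixpoint running_max (a : nat -> R) (k : nat) : R :=
  match k with O => a 0%nat | S k => Rmax (running_max a k) (a (S k)) end.

Lemma running_max_ge a k n : (n <= k)%nat -> a n <= running_max a k.
Proof.
  induction k; intros H.
  - replace n with 0%nat by lia. simpl. lra.
  - simpl. destruct (Nat.eq_dec n (S k)) as [->|]; [apply Rmax_r|].
    eapply Rle_trans; [apply IHk; lia|apply Rmax_l].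
Qed.

Lemma running_max_sublinear (eps : nat -> R) : Un_cv eps 0 -> forall e, 0 < e ->
  exists B, 0 <= B /\ forall k, running_max (fun j => INR (S j) * eps (S j)) k <= B + e * INR (S k).
Proof.
  intros H e He. destruct (H e He) as [N HN].
  set (a := fun j => INR (S j) * eps (S j)).
  exists (Rabs (running_max a N)). split; [apply Rabs_pos|].
  assert (Ha : forall j, a j <= Rabs (running_max a N) + e * INR (S j)).
  { intros j. pose proof (pos_INR (S j)). destruct (Nat.le_gt_cases j N) as [L|L].
    - pose proof (running_max_ge a N j L). pose proof (Rle_abs (running_max a N)). nra.
    - specialize (HN (S j) ltac:(lia)). unfold Rdist in HN. rewrite Rminus_0_r in HN. apply Rabs_def2 in HN.
      pose proof (Rabs_pos (running_max a N)). unfold a at 1. nra. }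
  induction k; [apply (Ha 0%nat)|]. simpl running_max. apply Rmax_lub; [|apply Ha].
  eapply Rle_trans; [apply IHk|]. rewrite !S_INR. nra.
Qed.

(** The logarithm contributes the factor [/ INR (S k) ^ 2] to [exp (- (2 * rate))]. It makes the
    tails summable and is itself sublinear. *)
Definition rate (eps : nat -> R) (k : nat) : R :=
  running_max (fun j => INR (S j) * eps (S j)) k + ln (INR (S k)).

Lemma INR_S_pos k : 1 <= INR (S k).
Proof. rewrite S_INR. pose proof (pos_INR k). lra. Qed.

Lemma ln_le_linear x e : 0 < x -> 0 < e -> ln x <= e * x + / e.
Proof.
  intros Hx He. replace x with (/ e * (e * x)) at 1 by (field; lra).
  assert (0 < / e) by (apply Rinv_0_lt_compat; auto).
  assert (L : forall y, 0 < y -> ln y <= y).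
  { intros y Hy. pose proof (exp_ge_1p (ln y)). rewrite exp_ln in H0 by auto. lra. }
  rewrite ln_mult by nra. pose proof (L (/ e) H). pose proof (L (e * x) ltac:(nra)). lra.
Qed.

(** [Rmax 0] leaves an upper bound to prove, and both parts of [rate] are sublinear. *)
Lemma rate_lim eps : Un_cv eps 0 -> Un_cv (fun k => Rmax 0 (rate eps k / INR k)) 0.
Proof.
  intros H e He.
  destruct (running_max_sublinear eps H (e / 8) ltac:(lra)) as [B [HB0 HB]].
  destruct (INR_archimed (e / 8) (B + / (e / 8))) as [N HN]; [lra|].
  exists (S N). intros k Hk. unfold Rdist. rewrite Rminus_0_r, Rabs_pos_eq by apply Rmax_l.
  apply Rmax_lub_lt; auto.
  assert (Hk1 : INR (S N) <= INR k) by (apply le_INR; lia). pose proof (INR_S_pos N). rewrite S_INR in Hk1, H0.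
  apply (Rmult_lt_reg_r (INR k)); [lra|]. replace (rate eps k / INR k * INR k) with (rate eps k) by (field; lra).
  unfold rate. specialize (HB k).
  pose proof (ln_le_linear (INR (S k)) (e / 8) ltac:(pose proof (INR_S_pos k); lra) ltac:(lra)).
  rewrite S_INR in *. nra.
Qed.

Lemma exp_rate_le eps k n : (forall n, (n >= 1)%nat -> 0 < eps n) -> (1 <= n <= S k)%nat ->
  exp (- (2 * rate eps k)) <= exp (- (2 * (INR n * eps n))) * / INR (S k) ^ 2.
Proof.
  intros He Hn. unfold rate. set (a := fun j => INR (S j) * eps (S j)).
  assert (Ha : INR n * eps n <= running_max a k).
  { destruct n as [|n]; [lia|]. apply (running_max_ge a k n). lia. }
  pose proof (INR_S_pos k).
  replace (- (2 * (running_max a k + ln (INR (S k))))) with (- (2 * running_max a k) + (- ln (INR (S k)) + - ln (INR (S k)))) by ring.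
  rewrite !exp_plus, (exp_Ropp (ln _)), exp_ln by lra.
  replace (/ INR (S k) ^ 2) with (/ INR (S k) * / INR (S k)) by (field; lra).
  apply Rmult_le_compat_r.
  - nra.
  - apply exp_mono. lra.
Qed.

Lemma inv_sq_series : ex_series (fun k => / INR (S k) ^ 2) /\ Series (fun k => / INR (S k) ^ 2) <= 2.
Proof.
  assert (H0 : forall k, 0 <= / INR (S k) ^ 2).
  { intros k. left. apply Rinv_0_lt_compat, pow_lt. pose proof (INR_S_pos k). lra. }
  assert (Hb : forall n, rsum (fun k => / INR (S k) ^ 2) (S n) <= 2 - / INR (S n)).
  { induction n; [simpl; lra|].
    change (rsum (fun k => / INR (S k) ^ 2) (S (S n))) with (rsum (fun k => / INR (S k) ^ 2) (S n) + / INR (S (S n)) ^ 2).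
    rewrite (S_INR (S n)). pose proof (INR_S_pos n). set (x := INR (S n)) in *.
    assert (K : / (x + 1) ^ 2 <= / x - / (x + 1)).
    { apply (Rmult_le_reg_r (x * (x + 1) ^ 2)); [nra|]. field_simplify; try lra; nra. }
    lra. }
  assert (Hb' : forall n, rsum (fun k => / INR (S k) ^ 2) n <= 2).
  { intros [|n]; [simpl; lra|]. specialize (Hb n).
    assert (0 < / INR (S n)) by (apply Rinv_0_lt_compat; pose proof (INR_S_pos n); lra). lra. }
  assert (He : ex_series (fun k => / INR (S k) ^ 2)) by (apply ex_series_bounded with 2; auto).
  split; auto. apply Series_le_bound; auto.
Qed.

Lemma fast_symbol (eps : nat -> R) : (forall n, (n >= 1)%nat -> 0 < eps n) -> Un_cv eps 0 ->
  exists phi : Cplx -> Cplx,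
    (analytic_on_disc phi /\ maps_disc_to_disc phi /\ surjective_on_disc phi /\ four_valent phi) /\
    bounded_op (Cphi phi) /\
    exists K, 0 < K /\ forall n, (n >= 1)%nat -> 0 <= approx_number (Cphi phi) n <= K * exp (- (INR n * eps n)).
Proof.
  intros He Hcv.
  pose proof (rate_lim eps Hcv) as Hr. set (eta := fun k => Rmax 0 (rate eps k / INR k)) in *.
  destruct (symbol_exists eta Hr) as [phi [S1 [S2 [S3 [S4 [k0 S5]]]]]].
  destruct (choice (fun k p => PS p (fun z => (phi z ^ k)%C)) (fun k => Analytic_pow phi k S1)) as [p Hp].
  destruct (Hr 1 ltac:(lra)) as [k1 Hk1].
  (* From [N] on, [k] is positive and beyond the threshold of [symbol_exists], and [eta k < 1] gives
     [rate eps k <= k], so that the term [2 * exp (- 2 k)] of [pow_norm_bound] is absorbed. *)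
  set (N := S (max k0 k1)).
  (* The 3 collects the constants 1 and 2 of [pow_norm_bound]. For [k < N] the finite sum raises
     [tau k] to at least 1, which bounds the norm since |phi| < 1. *)
  set (Ctau := 3 + rsum (fun k => exp (2 * rate eps k)) N).
  assert (HC : 3 <= Ctau).
  { unfold Ctau.
    assert (0 <= rsum (fun k => exp (2 * rate eps k)) N) by (apply rsum_ge0; intros; left; apply exp_pos). lra. }
  set (tau := fun k => Ctau * exp (- (2 * rate eps k))).
  assert (Hptau : forall k, l2 (p k) /\ Series (fun n => Cmod (p k n) ^ 2) <= tau k).
  { intros k. destruct (Nat.lt_ge_cases k N) as [L|L].
    - destruct (norm_majorant (p k) (fun z => (phi z ^ k)%C) (fun _ => RtoC 1) (Hp k)) as [H1 H2].
      + apply Analytic_const.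
      + intros z Hz. rewrite Cmod_pow, <- pow_mult. simpl (Re 1). rewrite <- (pow1 (k * 2)). apply pow_incr.
        specialize (S2 z Hz). split; [apply Cmod_ge_0|lra].
      + split; auto. eapply Rle_trans; [apply H2|]. simpl (Re 1). unfold tau.
        assert (G : exp (2 * rate eps k) <= Ctau).
        { unfold Ctau.
          pose proof (rsum_term_le (fun k => exp (2 * rate eps k)) N k (fun k => Rlt_le _ _ (exp_pos _)) L).
          cbv beta in *. lra. }
        apply (Rmult_le_compat_r (exp (- (2 * rate eps k)))) in G; [|left; apply exp_pos].
        rewrite <- exp_plus, Rplus_opp_r, exp_0 in G. auto.
    - assert (Hk : 1 <= INR k) by (change 1 with (INR 1); apply le_INR; unfold N in L; lia).
      destruct (pow_norm_bound phi k (p k) (eta k) S1 S2 (Hp k) (S5 k ltac:(unfold N in L; lia))) as [H1 H2].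
      split; auto. eapply Rle_trans; [apply H2|]. unfold tau.
      assert (He1 : rate eps k <= INR k * eta k).
      { apply (Rmult_le_reg_r (/ INR k)); [apply Rinv_0_lt_compat; lra|].
        replace (INR k * eta k * / INR k) with (eta k) by (field; lra). apply Rmax_r. }
      assert (He2 : rate eps k <= INR k).
      { specialize (Hk1 k ltac:(unfold N in L; lia)). unfold Rdist in Hk1. rewrite Rminus_0_r in Hk1.
        apply Rabs_def2 in Hk1. nra. }
      assert (exp (- (2 * INR k * eta k)) <= exp (- (2 * rate eps k))) by (apply exp_mono; lra).
      assert (exp (- (2 * INR k)) <= exp (- (2 * rate eps k))) by (apply exp_mono; lra).
      pose proof (exp_pos (- (2 * rate eps k))). nra. }
  assert (Htail : forall n, (n >= 1)%nat -> forall k, 0 <= tau (pred n + k)%nat <= Ctau * exp (- (2 * (INR n * eps n))) * / INR (S (pred n + k)) ^ 2).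
  { intros n Hn k. unfold tau. split; [apply Rmult_le_pos; [lra|left; apply exp_pos]|].
    rewrite Rmult_assoc. apply Rmult_le_compat_l; [lra|]. apply exp_rate_le; auto. lia. }
  destruct inv_sq_series as [I1 I2].
  assert (I3 : forall m, ex_series (fun k => / INR (S (m + k)) ^ 2) /\ Series (fun k => / INR (S (m + k)) ^ 2) <= 2).
  { intros m. split; [apply (ex_series_incr_n (fun k => / INR (S k) ^ 2) m); auto|].
    rewrite (Series_incr_rsum _ m I1) in I2.
    assert (0 <= rsum (fun k => / INR (S k) ^ 2) m).
    { apply rsum_ge0. intros k _. left. apply Rinv_0_lt_compat, pow_lt. pose proof (INR_S_pos k). lra. }
    lra. }
  assert (Htau : ex_series tau).
  { eapply ex_series_dom; [|apply (ex_series_rscal (Ctau * exp (- (2 * (INR 1 * eps 1%nat)))) _ I1)]. intros k.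
    destruct (Htail 1%nat ltac:(lia) k) as [T1 T2]. simpl (pred 1 + k)%nat in T1, T2. rewrite Rabs_pos_eq; auto. }
  exists (phiD phi). split; [split; [|split; [|split]]|split].
  - destruct S1 as [a Ha]. exists (fun n => ofC (a n)). intros z Hz.
    destruct (Ha (toC z) Hz) as [A1 A2].
    assert (E : forall k, toC (Cmul (ofC (a k)) (Defs.Cpow z k)) = (a k * toC z ^ k)%C).
    { intros k. rewrite toC_mul, toC_pow, toC_ofC. reflexivity. }
    apply Cseries_cv_summable.
    + eapply summable_ext; [intros k; symmetry; apply E|]. auto.
    + unfold phiD. rewrite toC_ofC, A2. apply CS_ext. intros; symmetry; apply E.
  - intros z Hz. unfold in_disc, phiD. rewrite <- Cmod_toC, toC_ofC. apply S2. exact Hz.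
  - intros w Hw. destruct (S3 (toC w) Hw) as [z [Z1 Z2]]. exists (ofC z). split.
    + unfold in_disc. rewrite <- Cmod_toC, toC_ofC. auto.
    + unfold phiD. rewrite toC_ofC, Z2. apply ofC_toC.
  - intros w l Hn Hl. rewrite <- (length_map toC). apply (S4 (toC w)).
    + apply (NoDup_map_NoDup_ForallPairs toC); auto. intros x y _ _. apply toC_inj.
    + intros z Hz. apply in_map_iff in Hz. destruct Hz as [x [<- Hx]]. destruct (Hl x Hx) as [L1 L2].
      split; [exact L1|].
      rewrite <- L2. unfold phiD. rewrite toC_ofC. auto.
  - apply (bounded_Cphi phi p tau); auto.
  - exists (sqrt (2 * Ctau)). split; [apply sqrt_lt_R0; lra|]. intros n Hn.
    (* Keeping [pred n] terms gives rank below [n]; the tail then involves [rate] at indices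
       [k >= n - 1], where it dominates [n * eps n]. *)
    pose proof (approx_bounds_tail phi p tau Hp Htau Hptau (pred n)) as Hb.
    replace (S (pred n)) with n in Hb by lia. apply approx_number_bounds in Hb. destruct Hb as [B1 B2]. split; auto.
    eapply Rle_trans; [apply B2|].
    replace (exp (- (INR n * eps n))) with (sqrt (exp (- (2 * (INR n * eps n))))).
    2:{ replace (- (2 * (INR n * eps n))) with (- (INR n * eps n) + - (INR n * eps n)) by ring.
        rewrite exp_plus. apply sqrt_square. left; apply exp_pos. }
    rewrite <- sqrt_mult; [|lra|left; apply exp_pos]. apply sqrt_le_1_alt.
    destruct (I3 (pred n)) as [J1' J2].
    eapply Rle_trans; [apply Series_le; [apply (Htail n Hn)|apply ex_series_rscal; auto]|].
    rewrite Series_scal_l. pose proof (exp_pos (- (2 * (INR n * eps n)))).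
    replace (2 * Ctau * exp (- (2 * (INR n * eps n)))) with (Ctau * exp (- (2 * (INR n * eps n))) * 2) by ring.
    apply Rmult_le_compat_l; [|auto]. apply Rmult_le_pos; lra.
Qed.

(** * Decay at the rate exp (- sqrt n) and Schatten classes *)

Lemma inv_sqrt_lim : Un_cv (fun n => / sqrt (INR n)) 0.
Proof.
  intros e He. destruct (INR_archimed 1 (/ e ^ 2)) as [N HN]; [lra|]. rewrite Rmult_1_r in HN.
  exists N. intros n Hn. unfold Rdist. rewrite Rminus_0_r.
  assert (INR N <= INR n) by (apply le_INR; lia).
  assert (Hs : / e < sqrt (INR n)).
  { rewrite <- (sqrt_Rsqr (/ e)) by (left; apply Rinv_0_lt_compat; auto). apply sqrt_lt_1_alt.
    split; [apply Rle_0_sqr|]. replace ((/ e)²) with (/ e ^ 2) by (unfold Rsqr; field; lra). lra. }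
  assert (0 < / e) by (apply Rinv_0_lt_compat; auto).
  rewrite Rabs_pos_eq by (left; apply Rinv_0_lt_compat; lra).
  rewrite <- (Rinv_inv e). apply Rinv_lt_contravar; auto. apply Rmult_lt_0_compat; lra.
Qed.

(** [exp x >= (x / 4) ^ 4] at [x = p * sqrt m]: the fourth power turns the square root into [m ^ 2],
    which is summable after inversion, for every [p]. *)
Lemma exp_neg_sqrt_le p m : 0 < p -> 0 < m -> exp (- (p * sqrt m)) <= 256 / p ^ 4 * / m ^ 2.
Proof.
  intros Hp Hm. assert (Hs : 0 < sqrt m) by (apply sqrt_lt_R0; auto).
  assert (Hs2 : sqrt m * sqrt m = m) by (apply sqrt_sqrt; lra).
  set (x := p * sqrt m). assert (Hx : 0 < x) by (apply Rmult_lt_0_compat; auto).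
  assert (E : (x / 4) ^ 4 <= exp x).
  { replace (exp x) with (exp (x / 4) ^ 4).
    - apply pow_incr. pose proof (exp_ge_1p (x / 4)). lra.
    - simpl. rewrite Rmult_1_r, <- !exp_plus. f_equal. field. }
  rewrite exp_Ropp.
  apply Rle_trans with (/ (x / 4) ^ 4).
  - apply Rinv_le_contravar; auto. apply pow_lt; lra.
  - right. unfold x. replace ((p * sqrt m / 4) ^ 4) with (p ^ 4 * (sqrt m * sqrt m) ^ 2 / 256) by field. rewrite Hs2.
    field. lra.
Qed.

Theorem theorem3p2 :
  (forall eps : nat -> R,
      (forall n, (n >= 1)%nat -> 0 < eps n) -> Un_cv eps 0 ->
      exists phi : Cplx -> Cplx,
        analytic_on_disc phi /\ maps_disc_to_disc phi /\
        surjective_on_disc phi /\ four_valent phi /\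
        bounded_op (Cphi phi) /\
        exists K, 0 < K /\
          forall n, (n >= 1)%nat ->
            approx_number (Cphi phi) n <= K * exp (- (INR n * eps n)))
  /\
  (exists phi : Cplx -> Cplx,
      analytic_on_disc phi /\ maps_disc_to_disc phi /\
      surjective_on_disc phi /\ four_valent phi /\
      forall p, 0 < p -> in_Schatten (Cphi phi) p).
Proof.
  split.
  - intros eps He Hcv. destruct (fast_symbol eps He Hcv) as [phi [[H1 [H2 [H3 H4]]] [H5 [K [HK H6]]]]].
    exists phi. repeat (split; [assumption|]). exists K. split; auto. intros n Hn. apply H6; auto.
  (* With this choice [n * eps n = sqrt n], so the approximation numbers are at most
     [K * exp (- sqrt n)]. Every positive power of this bound is summable, and one symbol serves all
     [p]. *)
  - destruct (fast_symbol (fun n => / sqrt (INR n))) as [phi [[H1 [H2 [H3 H4]]] [H5 [K [HK H6]]]]].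
    + intros n Hn. apply Rinv_0_lt_compat, sqrt_lt_R0, lt_0_INR. lia.
    + apply inv_sqrt_lim.
    + exists phi. do 4 (split; [assumption|]). intros p Hp. split; auto.
      set (a := fun n => Rpow_nn (approx_number (Cphi phi) (S n)) p).
      assert (Ha : forall n, 0 <= a n <= exp (p * ln K) * (256 / p ^ 4) * / INR (S n) ^ 2).
      { intros n. assert (HS : 0 < INR (S n)) by (pose proof (INR_S_pos n); lra).
        assert (Hp4 : 0 < 256 / p ^ 4) by (apply Rdiv_lt_0_compat; [lra|apply pow_lt; auto]).
        assert (Hi : 0 < / INR (S n) ^ 2) by (apply Rinv_0_lt_compat, pow_lt; auto).
        pose proof (exp_pos (p * ln K)) as HeK.
        unfold a, Rpow_nn. destruct (Rle_dec _ 0) as [L|L].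
        - split; [lra|]. apply Rmult_le_pos; [apply Rmult_le_pos|]; lra.
        - split; [left; apply exp_pos|]. destruct (H6 (S n) ltac:(lia)) as [_ Hle].
          assert (Hs : 0 < sqrt (INR (S n))) by (apply sqrt_lt_R0; auto).
          replace (INR (S n) * / sqrt (INR (S n))) with (sqrt (INR (S n))) in Hle.
          2:{ rewrite <- (sqrt_sqrt (INR (S n))) at 2 by lra. field. lra. }
          unfold Rpower. apply Rle_trans with (exp (p * ln K + - (p * sqrt (INR (S n))))).
          + apply exp_mono. apply Rle_trans with (p * ln (K * exp (- sqrt (INR (S n))))).
            * apply Rmult_le_compat_l; [lra|].
              destruct Hle as [Hlt|Heq]; [left; apply ln_increasing; lra|rewrite Heq; lra].
            * rewrite ln_mult, ln_exp by (auto; apply exp_pos). lra.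
          + rewrite exp_plus, Rmult_assoc. apply Rmult_le_compat_l; [lra|]. apply exp_neg_sqrt_le; auto. }
      destruct inv_sq_series as [I1 _].
      assert (Hex : ex_series a).
      { eapply ex_series_dom; [|apply (ex_series_rscal (exp (p * ln K) * (256 / p ^ 4)) _ I1)]. intros n.
        destruct (Ha n). rewrite Rabs_pos_eq; auto. }
      exists (Series a). apply is_series_Reals, Series_correct. exact Hex.
Qed.
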